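(* Let $p>0$ be a prime number and let $S$ be a complete local domain of mixed characteristic $p$ with finite residue field. Then there exist an $S$-algebra $T$ and a non-zero non-unit element $\pi\in T$ such that the following conditions hold: (i) $T$ is a normal domain and $S\subset T\subset S^+$. (ii) $T/\pi T$ is a reduced $\mathbb{F}_p$-algebra. (iii) For every prime ideal $P$ of $T$ that is minimal over $\pi T$, the Frobenius endomorphism $x\mapsto x^p$ is bijective on the quotient ring $T/P$.
   Context: All rings are commutative with unity and are not assumed Noetherian unless stated; a local ring is a Noetherian ring with a unique maximal ideal. For an integral domain $A$, the absolute integral closure $A^+$ is the integral closure of $A$ in an algebraic closure of $\mathrm{Frac}(A)$. A ring $A$ is of mixed characteristic $p$ if $p$ is a non-zero divisor in $A$ and $pA\neq A$. $\mathbb{F}_p=\mathbb{Z}/p\mathbb{Z}$. A ring $A$ is normal if $A_{\mathfrak p}$ is an integrally closed domain for every prime ideal $\mathfrak p$; for a domain this means integrally closed in its field of fractions. *)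

(* Defs.v *)
From HB Require Import structures.
From mathcomp Require Import all_boot all_algebra.
From mathcomp Require Import boolp classical_sets cardinality.

Set Implicit Arguments.
Unset Strict Implicit.
Unset Printing Implicit Defensive.

Import GRing.Theory.
Local Open Scope ring_scope.

(* Terms of type [idealr R] and [prime_idealr R] are proper by construction. *)

Section Ideals.
Variable R : comNzRingType.
Implicit Types (I J m : idealr R) (P Q : prime_idealr R).

Definition finitely_generated I : Prop :=
  exists s : seq R, forall x : R,
    x \in I <-> exists c : 'I_(size s) -> R, x = \sum_(i < size s) c i * s`_i.

(* The unit ideal, which is not an [idealr], is generated by 1. *)
Definition noetherian : Prop := forall I, finitely_generated I.

Definition maximal_ideal I : Prop :=
  forall J, {subset I <= J} -> {subset J <= I}.

Definition local_ring m : Prop :=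
  [/\ noetherian, maximal_ideal m & forall J, maximal_ideal J -> J =i m].

(* The coefficient u.1 makes the 0-th power the whole ring. *)
Definition ideal_power I (n : nat) : set R :=
  [set x : R | exists s : seq (R * n.-tuple R),
     (forall u, u \in s -> forall y, y \in u.2 -> y \in I) /\
     x = \sum_(u <- s) u.1 * \prod_(y <- u.2) y].

Definition adic_cauchy I (u : nat -> R) : Prop :=
  forall n, exists N, forall i j,
    (N <= i)%N -> (N <= j)%N -> ideal_power I n (u i - u j).

Definition adic_limit I (u : nat -> R) (l : R) : Prop :=
  forall n, exists N, forall i, (N <= i)%N -> ideal_power I n (u i - l).

Definition adically_complete I : Prop :=
  (forall x, (forall n, ideal_power I n x) -> x = 0) /\
  (forall u, adic_cauchy I u -> exists l, adic_limit I u l).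

Definition minimal_over I P : Prop :=
  {subset I <= P} /\
  forall Q, {subset I <= Q} -> {subset Q <= P} -> {subset P <= Q}.

Definition reduced : Prop := forall (x : R) (n : nat), x ^+ n = 0 -> x = 0.

Definition mixed_characteristic (p : nat) : Prop :=
  GRing.lreg (p%:R : R) /\ ~ (forall x : R, exists y : R, x = p%:R * y).

End Ideals.

Arguments noetherian : clear implicits.
Arguments reduced : clear implicits.
Arguments mixed_characteristic : clear implicits.

Section PrincipalIdeal.
Variables (R : comUnitRingType) (a : R) (a_nunit : a \isn't a GRing.unit).

Definition principal_pred : {pred R} := fun x => `[< exists y, x = a * y >].

Lemma principal_idealr_closed : idealr_closed principal_pred.
Proof.
split.
- by apply/asboolP; exists 0; rewrite mulr0.
- apply/negP => /asboolP[y e]; move/negP: a_nunit; apply.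
  by apply/unitrP; exists y; rewrite mulrC -e.
- move=> b x y /asboolP[x' ->] /asboolP[y' ->]; apply/asboolP.
  by exists (b * x' + y'); rewrite mulrDr mulrCA.
Qed.

Definition principal_ideal : idealr R :=
  HB.pack principal_pred (isIdealr.Build R principal_pred principal_idealr_closed).

End PrincipalIdeal.

Definition normal_domain (A : idomainType) : Prop :=
  forall z : {fraction A}, integralOver (@tofrac A) z -> exists a : A, z = tofrac a.

Definition algebraic_closure (F : fieldType) (E : closedFieldType)
    (iota : {rmorphism F -> E}) : Prop :=
  forall z : E, algebraicOver iota z.

(* A^+, as a subset of an algebraic closure E of Frac(A). *)
Definition absolute_integral_closure (A : idomainType) (E : closedFieldType)
    (iota : {rmorphism {fraction A} -> E}) : set E :=
  [set z : E | integralOver (iota \o @tofrac A) z].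

(* Main.v *)
Require Import Defs.
From HB Require Import structures.
From mathcomp Require Import all_boot all_order all_algebra ring.
From mathcomp Require Import boolp classical_sets cardinality.

Set Implicit Arguments.
Unset Strict Implicit.
Unset Printing Implicit Defensive.

Import GRing.Theory Num.Theory Order.TTheory.
Local Open Scope ring_scope.

(** The ring S contains a subring A isomorphic to Z_p[[x_1, ..., x_n]] over
    which it is a finite module ([cohen_structure]). Everything then takes
    place in the algebraically closed field E, of which three properties
    of A are remembered: A is normal, p is a prime element of A, and no
    nonzero element of A is infinitely divisible by p ([base_ring]). Let I
    be the integral closure of A in E, and call place a valuation ring of
    E that contains I and whose maximal ideal meets A in pA. An element z
    such that p z is integral and z has no pole at any place is integral
    ([int_of_places], [int_of_coprime]).

    The ring T is L /\ I for a well chosen field L between Frac S and E; it is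
    normal because L is a field and I is integrally closed. Two properties
    of L are needed. The first is the existence of pi in T, dividing p,
    that generates the value group of L at every place. Then an element of
    T with a power in pi T has positive value at every place, so it is a
    multiple of pi: this makes T / pi T reduced ([reduced_mod_pi]). The
    second is that the residue field of L at every place is perfect.

    Fields of finite degree over Frac A have finitely many places, up to the
    primes of I on which their elements are compared ([places_finite]),
    and discrete valuations ([uniformizer]). The common uniformizer pi is
    obtained over such a field M ([uniform_extension]). If n = 0 the
    Chinese remainder theorem suffices. If n > 0 the residue fields are
    imperfect, because x = x_1 is far from being a p-th power modulo p
    ([frob_indep]). Multiplying p by a suitable unit u = 1 + x^p y of I,
    one gets p u = w^e v at each place, with w a uniformizer of M and v a
    unit whose residue is not a p-th power ([choose_unit]). Now adjoin pi,
    an N-th root of p u with N divisible by all the exponents e. At each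
    place the unit v is made an e-th power by an extension with
    inseparable residue extension of full degree followed by an etale one,
    which leave the value group unchanged; a totally ramified root
    extraction then yields pi ([fierce_unif], [etale_unif], [ram_unif]).

    Next, Zorn's lemma gives a maximal field L over M in which pi remains a
    uniformizer at all places and, over each of the finitely many classes
    of places of M, either the residue fields are perfect already or the
    class has not split ([admissible], [maximal_admissible]). If some
    residue field of L were not perfect, a root of one polynomial X^p + r
    X - a, etale over the classes of the first kind and extracting a p-th
    root of a non-power in the residue fields over the other classes,
    would enlarge L ([all_perfect]).

    Perfect residue fields do not yet make Frobenius surjective on T / Q,
    since the p-th root of an element of T / Q is only known to be a
    quotient e / t of elements of T / Q. Here maximality is used again: if
    r is a unit at all places, the roots of X^p + r X - b generate etale
    extensions and lie in T. Let e / t be a p-th root of a at the place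
    considered, and q a unit there. With r congruent to q t and b to a + q
    e, the residue of e / t is a root, so that it is the residue of an
    element of T ([frobenius_surj]). Finally every prime of T containing
    pi contains the kernel of the residue map of some place
    ([place_below]). *)

(** * Subrings as domains, primes avoiding a multiplicative set *)

Section SubDomain.
Variables (R : idomainType) (D : subringClosed R).

Record subdom := Subdom { subdom_val :> R; subdom_valP : subdom_val \in D }.
HB.instance Definition _ := [isSub for subdom_val].
HB.instance Definition _ := [Choice of subdom by <:].
HB.instance Definition _ := [SubChoice_isSubComNzRing of subdom by <:].

Definition subdom_unit : pred subdom :=
  fun x => (val x \is a GRing.unit) && ((val x)^-1 \in D).
Definition subdom_inv (x : subdom) : subdom :=
  if subdom_unit x then insubd x (val x)^-1 else x.

Lemma subdom_mulVr : {in subdom_unit, left_inverse 1 subdom_inv *%R}.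
Proof.
move=> x ux; apply: val_inj; rewrite /subdom_inv.
have ux' : subdom_unit x by [].
rewrite ux'; case/andP: ux' => xU xD.
by rewrite rmorphM /= insubdK // mulVr // rmorph1.
Qed.

Lemma subdom_unitPl (x y : subdom) : y * x = 1 -> subdom_unit x.
Proof.
move=> /(congr1 val) e0; have e : val y * val x = 1 by [].
have xU : val x \is a GRing.unit by apply/unitrP; exists (val y); rewrite [val x * _]mulrC e.
rewrite /subdom_unit xU /=; suff -> : (val x)^-1 = val y by apply: valP.
by apply: (mulIr xU); rewrite mulVr // e.
Qed.

Lemma subdom_inv_out : {in [predC subdom_unit], subdom_inv =1 id}.
Proof. by move=> x; rewrite inE /subdom_inv => /negbTE h; rewrite (h : subdom_unit x = false). Qed.

HB.instance Definition _ := GRing.ComNzRing_hasMulInverse.Build subdom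
  subdom_mulVr subdom_unitPl subdom_inv_out.

Lemma subdom_integral (x y : subdom) : x * y = 0 -> (x == 0) || (y == 0).
Proof.
by move=> /(congr1 val)/eqP e; rewrite -mulf_eq0.
Qed.

HB.instance Definition _ := GRing.ComUnitRing_isIntegral.Build subdom subdom_integral.

End SubDomain.

Section Corestriction.
Variables (R S : idomainType) (D : subringClosed R) (phi : {rmorphism S -> R}).
Hypothesis phiD : forall s, phi s \in D.

Definition corestrict s : subdom D := Subdom (phiD s).
Lemma corestrict_zmod : zmod_morphism corestrict.
Proof. by move=> x y; apply: val_inj; rewrite /= rmorphB. Qed.
Lemma corestrict_monoid : monoid_morphism corestrict.
Proof. by split=> [|x y]; apply: val_inj; rewrite /= ?rmorph1 ?rmorphM. Qed.
HB.instance Definition _ := GRing.isZmodMorphism.Build S (subdom D) corestrict corestrict_zmod.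
HB.instance Definition _ := GRing.isMonoidMorphism.Build S (subdom D) corestrict corestrict_monoid.
End Corestriction.

Section Krull.
Variable R : comNzRingType.

(** By Zorn's lemma there is a set maximal among the ideals containing [a] and
    disjoint from the multiplicative set [s]. If x and y lie outside this
    ideal I, then I + (x) and I + (y) meet [s], hence so does I + (x y): the
    ideal is prime. *)
Lemma krull_prime (a : set R) (s : set R) :
  a 0 -> (forall x y, a x -> a y -> a (x + y)) -> (forall r x, a x -> a (r * x)) ->
  s 1 -> (forall x y, s x -> s y -> s (x * y)) ->
  (forall x, a x -> s x -> False) ->
  exists P : prime_idealr R, (forall x, a x -> x \in P) /\ (forall x, s x -> x \notin P).
Proof.
move=> a0 aD aM s1 sM as0.
pose good (I : set R) := [/\ forall x, a x -> I x, forall x y, I x -> I y -> I (x + y),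
   forall r x, I x -> I (r * x) & forall x, I x -> s x -> False].
have ga : good a by rewrite /good; split.
pose PP (I : set R) := I = set0 \/ good I.
have [|I [[I0|[aI ID IM Is]] Imax]] := @Zorn_bigcup R PP.
- move=> F FP Ftot.
  have [[X FX [x0 Xx0]]|none] := pselect (exists2 X, F X & X !=set0)%classic; last first.
    apply: or_introl; apply/seteqP; split=> // x [X FX Xx]; apply: none; by exists X => //; exists x.
  have gX : forall Y, F Y -> (exists y, Y y) -> good Y.
    by move=> Y FY [y Yy]; case: (FP _ FY) => // Y0; rewrite Y0 in Yy.
  apply: or_intror; rewrite /good; split.
  + move=> x ax; exists X => //; have [h _ _ _] := gX X FX (ex_intro _ _ Xx0); exact: h.
  + move=> x y [Y FY Yx] [Z FZ Zy].
    have [YZ|ZY] := Ftot _ _ FY FZ.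
      exists Z => //; have [_ h _ _] := gX Z FZ (ex_intro _ _ Zy); apply: h => //; exact: YZ.
    exists Y => //; have [_ h _ _] := gX Y FY (ex_intro _ _ Yx); apply: h => //; exact: ZY.
  + move=> r x [Y FY Yx]; exists Y => //; have [_ _ h _] := gX Y FY (ex_intro _ _ Yx); exact: h.
  + move=> x [Y FY Yx]; have [_ _ _ h] := gX Y FY (ex_intro _ _ Yx); exact: h.
- exfalso; apply: (Imax a); last by apply: or_intror.
  by rewrite I0; split=> // /(_ 0 a0).
have mx (x : R) : ~ I x -> exists i r, I i /\ s (i + r * x).
  move=> nIx; apply: contrapT => H.
  apply: (Imax [set z | exists i r, I i /\ z = i + r * x]%classic).
    split; first by move=> z Iz; exists z, 0; rewrite mul0r addr0.
    move=> /(_ x) h; apply: nIx; apply: h; exists 0, 1; split; last by rewrite mul1r add0r.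
    by apply: aI.
  apply: or_intror; rewrite /good; split.
  + by move=> z az; exists z, 0; rewrite mul0r addr0; split=> //; apply: aI.
  + move=> z w [i [r [Ii ->]]] [i' [r' [Ii' ->]]].
    by exists (i + i'), (r + r'); split; [apply: ID|rewrite mulrDl addrACA].
  + move=> t z [i [r [Ii ->]]]; exists (t * i), (t * r).
    by split; [apply: IM|rewrite mulrDr mulrA].
  + by move=> z [i [r [Ii ->]]] sz; apply: H; exists i, r.
pose P : {pred R} := fun x => `[< I x >].
have Pid : idealr_closed P.
  split; rewrite /in_mem /=.
  - by apply/asboolP/aI.
  - by apply/asboolP => /Is; apply.
  - by move=> r x y /asboolP h /asboolP h'; apply/asboolP; apply: ID => //; apply: IM.
have Ppr : prime_idealr_closed P.
  move=> u v /asboolP Iuv; apply: contrapT => /negP; rewrite negb_or => /andP[/asboolP nu /asboolP nv].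
  have [i [r [Ii s1']]] := mx _ nu; have [j [t [Ij s2]]] := mx _ nv.
  apply: (Is ((i + r * u) * (j + t * v))); last exact: sM.
  rewrite mulrDl; apply: (ID); first by rewrite mulrC; apply: IM.
  rewrite mulrDr; apply: ID; first by apply: IM.
  by rewrite mulrACA; apply: IM.
pose Q1 : idealr R := HB.pack P (isIdealr.Build R P Pid).
pose Q : prime_idealr R := HB.pack P (isIdealr.Build R P Pid) (isPrimeIdealrClosed.Build R P Ppr).
exists Q; split.
- by move=> x ax; rewrite unfold_in; apply/asboolP; apply: aI.
- by move=> x sx; rewrite unfold_in; apply/asboolP => Ix; exact: (Is _ Ix sx).
Qed.
End Krull.

(** * The base ring and its integral closure in E *)

Section SubField.
Variables (F : fieldType) (D : divringClosed F).

Record subfld := Subfld { subfld_val :> F; subfld_valP : subfld_val \in D }.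
HB.instance Definition _ := [isSub for subfld_val].
HB.instance Definition _ := [Choice of subfld by <:].
HB.instance Definition _ := [SubChoice_isSubIntegralDomain of subfld by <:].
HB.instance Definition _ := [SubIntegralDomain_isSubField of subfld by <:].

Lemma polyOver_subfld (q : {poly F}) :
  q \is a polyOver D -> exists r : {poly subfld}, q = map_poly val r.
Proof.
move=> /polyOverP qD; exists (\poly_(i < size q) (insubd (0 : subfld) q`_i)).
apply/polyP => i; rewrite coef_map /= coef_poly; case: ltnP => [_|h].
  by rewrite (insubdK _ (qD i : q`_i \in D)).
by rewrite nth_default.
Qed.

Lemma polyOver_val (r : {poly subfld}) : map_poly val r \is a polyOver D.
Proof. by apply/polyOverP => i; rewrite coef_map /=; apply: valP. Qed.

(** Division of polynomials does not depend on the field of coefficients: it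
    can be carried out over the type of elements of the subfield. *)
Lemma polyOver_divp : {in polyOver D &, forall u v, u %/ v \is a polyOver D}.
Proof.
move=> u v /polyOver_subfld[u' ->] /polyOver_subfld[v' ->].
by rewrite -map_divp polyOver_val.
Qed.

Lemma polyOver_modp : {in polyOver D &, forall u v, u %% v \is a polyOver D}.
Proof.
move=> u v /polyOver_subfld[u' ->] /polyOver_subfld[v' ->].
by rewrite -map_modp polyOver_val.
Qed.

Lemma polyOver_gcdp : {in polyOver D &, forall u v, gcdp u v \is a polyOver D}.
Proof.
move=> u v /polyOver_subfld[u' ->] /polyOver_subfld[v' ->].
by rewrite -gcdp_map polyOver_val.
Qed.
End SubField.

Lemma drop_poly1_drop (R : nzRingType) k (g : {poly R}) :
  drop_poly 1 (drop_poly k g) = drop_poly k.+1 g.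
Proof. by apply/polyP => i; rewrite !coef_drop_poly addnAC addn1 addnS. Qed.

Definition dvdby (A : idomainType) (p : nat) (a : A) := exists b, a = p%:R * b.

(** What the construction retains of the regular ring Z_p[[x_1, ..., x_r]]. By
    [br_inj] and [br_alg], E is an algebraic closure of the fraction field of
    A; [br_nor] is normality, expressed inside E. *)
Record base_ring (p : nat) (A : idomainType) (E : closedFieldType)
    (j : {rmorphism A -> E}) : Prop := BaseRing {
  br_prime : prime p;
  br_inj : injective j;
  br_alg : forall z : E, exists2 f : {poly A}, f != 0 & root (map_poly j f) z;
  br_p0 : p%:R != 0 :> A;
  br_p1 : ~ dvdby p (1 : A);
  br_pM : forall a b : A, dvdby p (a * b) -> dvdby p a \/ dvdby p b;
  br_sep : forall a : A, a != 0 -> exists k b, a = p%:R ^+ k * b /\ ~ dvdby p b;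
  br_nor : forall a b : A, a != 0 -> integralOver j (j b / j a) -> exists c, b = a * c
}.

Section Core.
Variables (p : nat) (A : idomainType) (E : closedFieldType) (j : {rmorphism A -> E}).
Hypothesis B : base_ring p j.

Local Notation dv := (@dvdby A p).

Lemma dvD (a b : A) : dv a -> dv b -> dv (a + b).
Proof. by move=> [x ->] [y ->]; exists (x + y); rewrite mulrDr. Qed.
Lemma dvN (a : A) : dv a -> dv (- a).
Proof. by move=> [x ->]; exists (- x); rewrite mulrN. Qed.
Lemma dvMl (a b : A) : dv a -> dv (a * b).
Proof. by move=> [x ->]; exists (x * b); rewrite mulrA. Qed.
Lemma dvMr (a b : A) : dv b -> dv (a * b).
Proof. by rewrite mulrC; apply: dvMl. Qed.
Lemma dv0 : dv 0. Proof. by exists 0; rewrite mulr0. Qed.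
Lemma dvX (a : A) n : dv (a ^+ n) -> dv a.
Proof.
elim: n => [|n IH]; first by move/(br_p1 B).
by rewrite exprS => /(br_pM B)[|/IH].
Qed.

Lemma j0 (a : A) : (j a == 0) = (a == 0).
Proof. by rewrite -(inj_eq (br_inj B)) rmorph0. Qed.

Lemma p_neq0 : p%:R != 0 :> E.
Proof. by rewrite -(rmorph_nat j) j0 (br_p0 B). Qed.

Definition intp : {pred E} := fun z => `[< integralOver j z >].
Lemma intpP z : reflect (integralOver j z) (z \in intp).
Proof. exact: asboolP. Qed.

Lemma intp_closed : subring_closed intp.
Proof.
split; first by apply/intpP; apply: integral1.
- by move=> x y /intpP hx /intpP hy; apply/intpP; apply: integral_sub.
- by move=> x y /intpP hx /intpP hy; apply/intpP; apply: integral_mul.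
Qed.
Definition intI : subringClosed E :=
  HB.pack intp (GRing.isSubringClosed.Build E intp intp_closed).

Lemma intIP z : reflect (integralOver j z) (z \in intI).
Proof. exact: asboolP. Qed.

Lemma int_j a : j a \in intI.
Proof. by apply/intIP/integral_id. Qed.

Lemma int_root_monic (f : {poly E}) z :
  f \is monic -> f \is a polyOver intI -> root f z -> z \in intI.
Proof.
move=> fm /polyOverP fI fz; apply/intIP.
apply: (integral_root_monic fm fz); apply/integral_poly => i.
by apply/intIP; exact: fI.
Qed.

(** Common factors p can be removed from the c_i only finitely often, by
    [br_sep]. *)
Lemma min_split n (c : nat -> A) : (exists2 i, (i < n)%N & c i != 0) ->
  exists k c', (forall i, (i < n)%N -> c i = p%:R ^+ k * c' i) /\
     exists2 i, (i < n)%N & ~ dv (c' i).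
Proof.
move=> [i0 i0n ci0]; have [k0 [b [cb nb]]] := br_sep B ci0.
elim: k0 => [|k IH] in c b ci0 cb nb *.
  by exists 0%N, c; split=> [i _|]; [rewrite mul1r|exists i0; rewrite // cb mul1r].
have [ex|all] := pselect (exists2 i, (i < n)%N & ~ dv (c i)).
  by exists 0%N, c; split=> // i _; rewrite mul1r.
have /choice[c' Hc'] : forall i, exists x, (i < n)%N -> c i = p%:R * x.
  move=> i; have [lt|] := boolP (i < n)%N; last by exists 0.
  have [[x e]|nd] := pselect (dv (c i)); first by exists x.
  by exfalso; apply: all; exists i.
have c'i0 : c' i0 != 0.
  by apply: contraNneq ci0 => e; rewrite Hc' // e mulr0.
have c'b : c' i0 = p%:R ^+ k * b.
  apply: (mulfI (br_p0 B)); rewrite -Hc' // cb exprS mulrA //.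
have [k1 [c'' [H1 H2]]] := IH c' b c'i0 c'b nb.
exists k1.+1, c''; split=> // i lt; rewrite Hc' // H1 // exprS mulrA //.
Qed.

Lemma primitive_relation (z : E) : exists2 f : {poly A}, root (map_poly j f) z &
  exists i, ~ dv f`_i.
Proof.
have [f f0 fz] := br_alg B z.
have [|k [c [H1 [i ilt ni]]]] := @min_split (size f) (fun i => f`_i).
  exists (size f).-1; first by rewrite ltn_predL size_poly_gt0.
  by rewrite -lead_coefE lead_coef_eq0.
exists (\poly_(i < size f) c i); last by exists i; rewrite coef_poly ilt.
have pk0 : (p%:R ^+ k : A) != 0 by rewrite expf_neq0 // (br_p0 B).
have e : f = p%:R ^+ k *: (\poly_(i < size f) c i).
  apply/polyP => l; rewrite coefZ coef_poly; case: ltnP => lt; first exact: H1.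
  by rewrite mulr0 nth_default.
move: fz; rewrite {1}e map_polyZ /= rootE hornerZ mulf_eq0 j0 (negbTE pk0) /=.
by [].
Qed.

(** If f_0 + f_1 z + ... = 0, the tails b_i = f_i + f_(i+1) z + ... satisfy
    b_i = b_(i+1) z + f_i, and multiplying the relation by a power of b_(i+1)
    shows that b_(i+1) z is a root of a monic polynomial. So all b_i and b_i z
    are integral, by descending induction. *)
Lemma horner_tail_int (f : {poly A}) z (i : nat) : root (map_poly j f) z ->
  (drop_poly i (map_poly j f)).[z] \in intI /\ (drop_poly i (map_poly j f)).[z] * z \in intI.
Proof.
set g := map_poly j f => /rootP gz.
pose b i := (drop_poly i g).[z].
have bS k : b k = b k.+1 * z + g`_k.
  rewrite /b -[in LHS](poly_take_drop 1 (drop_poly k g)) drop_poly1_drop.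
  rewrite hornerD hornerM hornerXn expr1 addrC; congr (_ + _).
  by rewrite (size1_polyC (size_take_poly _ _)) hornerC coef_take_poly /= coef_drop_poly.
have bint k : b k.+1 \in intI -> b k.+1 * z \in intI.
  move=> bI.
  pose h : {poly E} := 'X^(k.+1) + \poly_(l < k.+1) (g`_l * b k.+1 ^+ (k - l)).
  have sh : (size (\poly_(l < k.+1) (g`_l * b k.+1 ^+ (k - l)))%R < size ('X^(k.+1) : {poly E}))%N.
    by rewrite size_polyXn ltnS size_poly.
  apply: (@int_root_monic h).
  - by rewrite monicE /h lead_coefDl // lead_coefXn.
  - rewrite rpredD //; first by apply/polyOverP => l; rewrite coefXn; case: (_ == _); rewrite ?rpred1 ?rpred0.
    apply: polyOver_poly => l _; apply: rpredM; last exact: rpredX.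
    by rewrite coef_map; apply: int_j.
  rewrite rootE /h hornerD hornerXn horner_poly.
  have -> : \sum_(l < k.+1) g`_l * b k.+1 ^+ (k - l) * (b k.+1 * z) ^+ l =
    b k.+1 ^+ k * \sum_(l < k.+1) g`_l * z ^+ l.
    rewrite mulr_sumr; apply: eq_bigr => -[l /= lt] _.
    have e : b k.+1 ^+ k = b k.+1 ^+ (k - l) * b k.+1 ^+ l by rewrite -exprD subnK.
    by rewrite e exprMn; ring.
  have -> : \sum_(l < k.+1) g`_l * z ^+ l = - (b k.+1 * z ^+ k.+1).
    apply/eqP; rewrite -addr_eq0; apply/eqP; rewrite -[RHS]gz.
    rewrite -[in RHS](poly_take_drop k.+1 g) hornerD hornerM hornerXn; congr (_ + _).
    by rewrite (horner_coef_wide _ (size_take_poly _ _)); apply: eq_bigr => -[l lt] _; rewrite coef_take_poly lt.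
  by rewrite exprMn mulrN mulrA -exprSr subrr.
have main : forall d k, (size g <= k + d)%N -> b k \in intI /\ b k * z \in intI.
  elim=> [|d IH] k; first by rewrite addn0 => h; rewrite /b (drop_poly_eq0 h) horner0 mul0r rpred0.
  rewrite addnS -addSn => /IH[b1 b2].
  have bk : b k \in intI by rewrite bS rpredD // coef_map; apply: int_j.
  split=> //; case: k {b1 b2} bk => [|k] bk; last exact: bint.
  by rewrite /b drop_poly0l gz mul0r rpred0.
by apply: (main (size g) i); rewrite leq_addl.
Qed.

(** Let b' = b_i and b = b_(i+1) be consecutive tails of a primitive relation
    of z, at a coefficient a = b' - b z prime to p. Modulo a prime over p one
    of b' and b z is nonzero, so that one of z = (b' z) / b', z = (b z) / b
    and 1 / z = b / (b z) has an invertible denominator: the localization of I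
    at the prime is a valuation ring. *)
Lemma valuation_relation (z : E) : exists a b b', [/\ ~ dv a, j a = b' - b * z,
  [/\ b \in intI, b * z \in intI, b' \in intI & b' * z \in intI] &
  forall L : subringClosed E, (forall a, j a \in L) -> z \in L -> b \in L /\ b' \in L].
Proof.
have [f fz [i ni]] := primitive_relation z.
have [h1 h2] := horner_tail_int i fz; have [h3 h4] := horner_tail_int i.+1 fz.
exists f`_i, (drop_poly i.+1 (map_poly j f)).[z], (drop_poly i (map_poly j f)).[z]; split=> //.
  rewrite -[in X in X - _](poly_take_drop 1 (drop_poly i _)) drop_poly1_drop.
  rewrite hornerD hornerM hornerXn expr1 addrK.
  by rewrite (size1_polyC (size_take_poly _ _)) hornerC coef_take_poly /= coef_drop_poly coef_map.
move=> L jL zL; have gL k : drop_poly k (map_poly j f) \is a polyOver L.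
  by apply/polyOverP => l; rewrite coef_drop_poly coef_map; apply: jL.
by split; apply: rpred_horner.
Qed.

End Core.

(** * Places lying over p *)

Section MinimalRelation.
Variables (A : idomainType) (E : closedFieldType) (j : {rmorphism A -> E}).
Hypothesis jinj : injective j.
Hypothesis alg : forall z : E, exists2 f : {poly A}, f != 0 & root (map_poly j f) z.

(** Up to powers of its leading coefficient, a relation of least degree
    divides all the others. *)
Lemma minimal_relation (z : E) : exists f : {poly A}, [/\ f != 0, root (map_poly j f) z &
  forall q : {poly A}, root (map_poly j q) z -> forall y, root (map_poly j f) y -> root (map_poly j q) y].
Proof.
have [n [f [f0 fz sf] nmin]] : exists2 n, exists f : {poly A}, [/\ f != 0, root (map_poly j f) z & size f = n] &
   forall g : {poly A}, g != 0 -> root (map_poly j g) z -> (n <= size g)%N.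
  pose P n := `[< exists f : {poly A}, [/\ f != 0, root (map_poly j f) z & size f = n] >].
  have exP : exists n, P n by have [f f0 fz] := alg z; exists (size f); apply/asboolP; exists f.
  case: (ex_minnP exP) => n /asboolP Pn nmin; exists n => // g g0 gz.
  by apply: nmin; apply/asboolP; exists g.
exists f; split=> // q qz y fy.
have e := Pdiv.Idomain.divp_eq q f.
have r0 : q %% f = 0.
  apply/eqP; apply: contraT => r0; have : (n <= size (q %% f)%R)%N.
    apply: nmin => //; move: (congr1 (fun u => (map_poly j u).[z]) e) => /=.
    rewrite rmorphD rmorphM /= hornerD hornerM (rootP fz) mulr0 add0r rootE => <-.
    by rewrite map_polyZ /= hornerZ (rootP qz) mulr0.
  by rewrite leqNgt -sf ltn_modp f0.
move: (congr1 (fun u => (map_poly j u).[y]) e) => /=.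
rewrite r0 addr0 rmorphM /= hornerM (rootP fy) mulr0 map_polyZ /= hornerZ => /eqP.
rewrite mulf_eq0 => /orP[|//]; rewrite -(rmorph0 j) (inj_eq jinj).
by rewrite expf_eq0 lead_coef_eq0 (negbTE f0) andbF.
Qed.

End MinimalRelation.

Section Core.
Variables (p : nat) (A : idomainType) (E : closedFieldType) (j : {rmorphism A -> E}).
Hypothesis B : base_ring p j.

Local Notation dv := (@dvdby A p).
Local Notation I := (intI j).

(** The conjugates y of z satisfy every relation of z, so the c y are integral
    too. Up to a power of c, the coefficients of f / lead_coef f are those of
    the product of the c X - c y: they are integral and lie in the fraction
    field of A, hence in A by normality. *)
Lemma conj_scaled_coef (z : E) (f : {poly A}) (c : A) :
  f != 0 -> root (map_poly j f) z ->
  (forall q : {poly A}, root (map_poly j q) z -> forall y, root (map_poly j f) y -> root (map_poly j q) y) ->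
  j c * z \in I -> forall k, exists x, c ^+ (size f).-1 * f`_k = lead_coef f * x.
Proof.
move=> f0 fz fmin cz k.
have [rs Hrs] := closed_field_poly_normal (map_poly j f).
have lj0 : j (lead_coef f) != 0 by rewrite (j0 B) lead_coef_eq0.
have lf : lead_coef (map_poly j f) = j (lead_coef f) by rewrite lead_coef_map_inj ?rmorph0 //; exact: (br_inj B).
have rsI y : y \in rs -> j c * y \in I.
  move=> yrs; have fy : root (map_poly j f) y.
    by rewrite Hrs rootZ ?lf // root_prod_XsubC.
  have [h hm hz] := intIP _ _ cz.
  have := fmin (h \Po (c *: 'X)); rewrite !map_comp_poly /= !map_polyZ /= !map_polyX.
  move=> H; apply/intIP; exists h => //.
  have := H _ y fy; rewrite !rootE !horner_comp !hornerZ !hornerX; apply.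
  by [].
have szrs : size rs = (size f).-1.
  have : size (map_poly j f) = size f by rewrite size_map_inj_poly ?rmorph0 //; exact: (br_inj B).
  rewrite {1}Hrs size_scale ?lf // size_prod_XsubC => <- //.
have key : j (c ^+ (size f).-1) * (map_poly j f)`_k = j (lead_coef f) *
    (\prod_(y <- rs) (j c *: 'X - (j c * y)%:P))`_k.
  rewrite {1}Hrs lf coefZ mulrCA; congr (_ * _).
  rewrite -coefZ; congr ((polyseq _)`_k); rewrite rmorphXn /= -szrs.
  elim: rs {Hrs rsI szrs} => [|y rs IH]; first by rewrite !big_nil expr0 scale1r.
  rewrite !big_cons /= -IH -scalerAr exprSr -scalerA scalerAl; congr (_ *: (_ * _)).
  by rewrite scalerBr -mul_polyC -mul_polyC -polyCM.
have [||x Hx] := @br_nor _ _ _ _ B (lead_coef f) (c ^+ (size f).-1 * f`_k).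
- by rewrite lead_coef_eq0.
- apply/(intIP j); rewrite rmorphM /= -coef_map /= key mulrAC divff // mul1r.
  suff /polyOverP H : \prod_(y <- rs) (j c *: 'X - (j c * y)%:P) \is a polyOver I by apply: H.
  rewrite big_seq; apply: rpred_prod => y /rsI yI.
  by apply: rpredB; rewrite ?polyOverC // polyOverZ ?polyOverX // int_j.
- by exists x.
Qed.

Lemma dv_cancel n (a x y : A) : ~ dv a -> p%:R ^+ n * x = a * y -> exists z, y = p%:R ^+ n * z.
Proof.
move=> na; elim: n x y => [|n IH] x y; first by exists y; rewrite mul1r.
rewrite exprS -mulrA => e; have : dv (a * y) by exists (p%:R ^+ n * x).
case/(br_pM B) => // -[y1 y1e]; move: e; rewrite y1e [RHS]mulrCA => /(mulfI (br_p0 B)).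
by move=> /IH[z hz]; exists z; rewrite hz; ring.
Qed.

(** By [conj_scaled_coef] the leading coefficient of a minimal relation of z
    divides a^n f_k and p^n f_k, hence f_k since p is prime and does not
    divide a. After division by the leading coefficient the relation is
    monic. *)
Lemma int_of_coprime (z : E) (a : A) : ~ dv a -> j a * z \in I -> p%:R * z \in I -> z \in I.
Proof.
move=> na az pz.
have [f [f0 fz fmin]] := minimal_relation (br_inj B) (br_alg B) z.
have pz' : j p%:R * z \in I by rewrite rmorph_nat.
have H1 := conj_scaled_coef f0 fz fmin az.
have H2 := conj_scaled_coef f0 fz fmin pz'.
have l0 : lead_coef f != 0 by rewrite lead_coef_eq0.
set n := (size f).-1 in H1 H2.
have nan : ~ dv (a ^+ n) by move/(dvX B).
have /choice[g Hg] : forall k, exists x, f`_k = lead_coef f * x.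
  move=> k; have [x hx] := H1 k; have [y hy] := H2 k.
  have e : p%:R ^+ n * x = a ^+ n * y.
    by apply: (mulfI l0); rewrite mulrCA -hx [RHS]mulrCA -hy mulrCA.
  have [t ht] := dv_cancel nan e.
  exists t; apply: (mulfI (expf_neq0 n (br_p0 B))).
  by rewrite hy ht mulrCA.
have fg : f = lead_coef f *: \poly_(k < size f) g k.
  apply/polyP => k; rewrite coefZ coef_poly; case: ltnP => h; first exact: Hg.
  by rewrite mulr0 nth_default.
apply/intIP; exists (\poly_(k < size f) g k).
  have : lead_coef f = lead_coef f * lead_coef (\poly_(k < size f) g k).
    by rewrite {1}fg lead_coefZ.
  by rewrite -{1}[lead_coef f]mulr1 => /(mulfI l0) h; rewrite monicE -h.
move: fz; by rewrite {1}fg map_polyZ /= rootZ // (j0 B).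
Qed.

(** A valuation ring of E that contains the integral elements, given with its
    residue field. The ring [pO] is a type embedded in E by [pv], and [pr] is
    the residue map. The axiom [pl_base] says that the maximal ideal meets A
    in pA. *)
Record place := Place {
  pO : comNzRingType;
  pk : fieldType;
  pv : {rmorphism pO -> E};
  pr : {rmorphism pO -> pk};
  pv_inj : injective pv;
  pl_int : forall z, z \in I -> exists o, pv o = z;
  pl_val : forall z, (exists o, pv o = z) \/ (exists o, pv o * z = 1 /\ pr o = 0);
  pl_unit : forall o, pr o != 0 -> exists o', o * o' = 1;
  pl_base : forall a o, pv o = j a -> pr o = 0 <-> dv a
}.

Local Notation Id := (subdom I).

Section PlaceOfPrime.
Local Open Scope quotient_scope.
Variable Q : prime_idealr Id.
Hypothesis QA : forall (a : A) (x : Id), val x = j a -> x \in Q <-> dv a.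

Definition locp : {pred E} := fun z => `[< exists x s : Id, s \notin Q /\ val x = z * val s >].
Definition maxp : {pred E} := fun z => `[< exists x s : Id, [/\ x \in Q, s \notin Q & val x = z * val s] >].

Lemma notinM (s t : Id) : s \notin Q -> t \notin Q -> s * t \notin Q.
Proof. by move=> h k; rewrite prime_idealrM negb_or h k. Qed.

Lemma notin1 : (1 : Id) \notin Q. Proof. by rewrite idealr1. Qed.

Lemma locp_closed : subring_closed locp.
Proof.
split; first by apply/asboolP; exists 1, 1; rewrite notin1 mulr1.
- move=> x y /asboolP[a [s [ns e]]] /asboolP[b [t [nt f]]]; apply/asboolP.
  exists (a * t - b * s), (s * t); split; first exact: notinM.
  by rewrite rmorphB !rmorphM /=; rewrite /= in e f; rewrite e f; ring.
- move=> x y /asboolP[a [s [ns e]]] /asboolP[b [t [nt f]]]; apply/asboolP.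
  exists (a * b), (s * t); split; first exact: notinM.
  by rewrite !rmorphM /=; rewrite /= in e f; rewrite e f; ring.
Qed.
(** The localization at Q of the ring of integral elements. *)
Definition locR : subringClosed E := HB.pack locp (GRing.isSubringClosed.Build E locp locp_closed).

Definition maxpred : {pred subdom locR} := fun z => val z \in maxp.
Lemma maxpred_closed : idealr_closed maxpred.
Proof.
split.
- by apply/asboolP; exists 0, 1; rewrite notin1 rpred0 mulr1.
- apply/asboolP => -[x [s [xQ /negP sQ]]]; rewrite rmorph1 mul1r => /val_inj e.
  by apply: sQ; rewrite -e.
- move=> z x y /asboolP[a [s [aQ ns e]]] /asboolP[b [t [bQ nt f]]].
  have /asboolP[c [u [nu g]]] := valP z.
  apply/asboolP; exists (c * a * t + u * s * b), (u * s * t); split.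
  + by apply: rpredD; [rewrite mulrAC|]; apply: idealMr.
  + by rewrite !notinM.
  + by rewrite !(rmorphD, rmorphM) /=; rewrite /= in e f g; rewrite e f g; ring.
Qed.
Definition maxI : idealr (subdom locR) :=
  HB.pack maxpred (isIdealr.Build (subdom locR) maxpred maxpred_closed).

Local Notation kq := {ideal_quot maxI}.

Lemma loc_unit (o : subdom locR) : o \notin maxI -> exists o', o' * o = 1.
Proof.
move=> no; have /asboolP[a [s [ns e]]] := valP o.
have na : a \notin Q.
  by apply: contra no => aQ; apply/asboolP; exists a, s.
have a0 : val a != 0 by apply: contraNneq na => h; rewrite (_ : a = 0) ?rpred0 //; apply: val_inj.
have s0 : val s != 0 by apply: contraNneq ns => h; rewrite (_ : s = 0) ?rpred0 //; apply: val_inj.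
have h : val s / val a \in locR by apply/asboolP; exists s, a; rewrite divfK.
exists (Subdom h); apply: val_inj; rewrite rmorphM rmorph1 /=.
have -> : subdom_val o = val a / val s by rewrite e mulfK.
by rewrite mulrA divfK // divff.
Qed.

Lemma kq_inv_ex (x : kq) : exists y : kq, x != 0 -> y * x = 1.
Proof.
have [->|x0] := eqVneq x 0; first by exists 0.
have [o ox] : exists o, x = \pi_kq o by exists (repr x); rewrite reprK.
have no : o \notin maxI.
  apply: contra x0 => om; rewrite ox; apply/eqP.
  have -> : (0 : kq) = \pi_kq 0 by rewrite rmorph0.
  by apply/eqP; rewrite -Quotient.idealrBE subr0.
have [o' ho'] := loc_unit no.
by exists (\pi_kq o') => _; rewrite ox -rmorphM ho' rmorph1.
Qed.

Definition kq_invf (x : kq) : kq := projT1 (cid (kq_inv_ex x)).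
Definition kq_inv (x : kq) : kq := if x == 0 then 0 else kq_invf x.
Lemma kq_mulV (x : kq) : x != 0 -> kq_inv x * x = 1.
Proof. by move=> x0; rewrite /kq_inv (negbTE x0) /kq_invf; case: cid => y /=; apply. Qed.
Lemma kq_inv0 : kq_inv 0 = 0. Proof. by rewrite /kq_inv eqxx. Qed.

Definition kqF : fieldType :=
  HB.pack kq (GRing.ComNzRing_isField.Build kq kq_mulV kq_inv0).

(** The localization of I at a prime over pA is a valuation ring by
    [valuation_relation]. *)
Lemma place_of_prime : exists P : place, forall x : Id, forall o, pv P o = val x -> pr P o = 0 <-> x \in Q.
Proof.
pose pi : {rmorphism subdom locR -> kqF} := (\pi_kq : {rmorphism _ -> kq}).
have pi0 o : pi o = 0 <-> val o \in maxp.
  have -> : (0 : kqF) = \pi_kq 0 by rewrite rmorph0.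
  split=> [/eqP|h]; rewrite /pi /=; first by rewrite -Quotient.idealrBE subr0.
  by apply/eqP; rewrite -Quotient.idealrBE subr0.
have rep (x : Id) (o : subdom locR) : val o = val x -> pi o = 0 <-> x \in Q.
  move=> ox; rewrite pi0 ox; split.
    move=> /asboolP[y [s [yQ ns e]]].
    have : x * s \in Q by rewrite (_ : x * s = y) //; apply: val_inj; rewrite rmorphM /= -e.
    by rewrite prime_idealrM (negbTE ns) orbF.
  by move=> xQ; apply/asboolP; exists x, 1; rewrite notin1 mulr1.
unshelve eexists.
refine (@Place (subdom locR) kqF val pi val_inj _ _ _ _).
- move=> z zI; have h : z \in locR by apply/asboolP; exists (Subdom zI), 1; rewrite notin1 mulr1.
  by exists (Subdom h).
- move=> z; have [a [b [b' [na e [bI bzI b'I b'zI] _]]]] := valuation_relation B z.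
  have [b'Q|nb'] := boolP (Subdom b'I \in Q); last first.
    have h : z \in locR by apply/asboolP; exists (Subdom b'zI), (Subdom b'I); rewrite nb' /= mulrC.
    by left; exists (Subdom h).
  have nbz : Subdom bzI \notin Q.
    apply/negP => bzQ; apply: na; apply/(QA (x := Subdom b'I - Subdom bzI)) => //.
    exact: rpredB.
  have [bQ|nb] := boolP (Subdom bI \in Q); last first.
    have h : z \in locR by apply/asboolP; exists (Subdom bzI), (Subdom bI); rewrite nb /= mulrC.
    by left; exists (Subdom h).
  right.
  have bz0 : b * z != 0.
    by apply: contraNneq nbz => h; rewrite (_ : Subdom _ = 0) ?rpred0 //; apply: val_inj.
  have h : b / (b * z) \in locR by apply/asboolP; exists (Subdom bI), (Subdom bzI); rewrite nbz /= divfK.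
  exists (Subdom h); split; first by rewrite /= mulrAC divff.
  by apply/pi0; apply/asboolP; exists (Subdom bI), (Subdom bzI); rewrite nbz bQ /= divfK.
- move=> o o0; have [|o' ho'] := @loc_unit o; last by exists o'; rewrite mulrC.
  by apply: contra o0 => om; apply/eqP/pi0.
- by move=> a o oa; rewrite (rep (Subdom (int_j j a))) //; apply: QA.
- by move=> x o; apply: rep.
Qed.

End PlaceOfPrime.

End Core.

(** * Residues, and the abundance of places *)

Section Core.
Variables (p : nat) (A : idomainType) (E : closedFieldType) (j : {rmorphism A -> E}).
Hypothesis B : base_ring p j.

Local Notation dv := (@dvdby A p).
Local Notation I := (intI j).
Local Notation Id := (subdom I).
Local Notation place := (place p j).

Section PlaceCalculus.
Variable P : place.

Definition valp : {pred E} := fun z => `[< exists o, pv P o = z >].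
Lemma valp_closed : subring_closed valp.
Proof.
split; first by apply/asboolP; exists 1; rewrite rmorph1.
- by move=> x y /asboolP[a <-] /asboolP[b <-]; apply/asboolP; exists (a - b); rewrite rmorphB.
- by move=> x y /asboolP[a <-] /asboolP[b <-]; apply/asboolP; exists (a * b); rewrite rmorphM.
Qed.
Definition valO : subringClosed E := HB.pack valp (GRing.isSubringClosed.Build E valp valp_closed).

(** Elements outside the valuation ring get residue 0, so that [res P] is
    defined on E. It is additive and multiplicative on the valuation ring
    only. *)
Definition res (z : E) : pk P :=
  if pselect (exists o, pv P o = z) is left h then pr P (projT1 (cid h)) else 0.

Lemma res_pv o : res (pv P o) = pr P o.
Proof.
rewrite /res; case: pselect => [h|[]]; last by exists o.
by case: cid => o' /= /pv_inj ->.
Qed.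

Lemma valOP z : z \in valO -> exists o, pv P o = z /\ res z = pr P o.
Proof. by move=> /asboolP[o oz]; exists o; rewrite -oz res_pv. Qed.

Lemma pv_valO o : pv P o \in valO. Proof. by apply/asboolP; exists o. Qed.

Lemma resM x y : x \in valO -> y \in valO -> res (x * y) = res x * res y.
Proof. by move=> /valOP[a [<- ->]] /valOP[b [<- ->]]; rewrite -(rmorphM (pv P)) res_pv rmorphM. Qed.
Lemma resD x y : x \in valO -> y \in valO -> res (x + y) = res x + res y.
Proof. by move=> /valOP[a [<- ->]] /valOP[b [<- ->]]; rewrite -(rmorphD (pv P)) res_pv rmorphD. Qed.
Lemma resB x y : x \in valO -> y \in valO -> res (x - y) = res x - res y.
Proof. by move=> /valOP[a [<- ->]] /valOP[b [<- ->]]; rewrite -(rmorphB (pv P)) res_pv rmorphB. Qed.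
Lemma res0 : res 0 = 0. Proof. by rewrite -(rmorph0 (pv P)) res_pv rmorph0. Qed.
Lemma res1 : res 1 = 1. Proof. by rewrite -(rmorph1 (pv P)) res_pv rmorph1. Qed.
Lemma resX x n : x \in valO -> res (x ^+ n) = res x ^+ n.
Proof. by move=> /valOP[a [<- ->]]; rewrite -(rmorphXn (pv P)) res_pv rmorphXn. Qed.
Lemma res_nat n : res n%:R = n%:R.
Proof. by rewrite -(rmorph_nat (pv P)) res_pv rmorph_nat. Qed.
Lemma res_sum (T : Type) (s : seq T) (c : pred T) (f : T -> E) :
  (forall i, c i -> f i \in valO) -> res (\sum_(i <- s | c i) f i) = \sum_(i <- s | c i) res (f i).
Proof.
move=> h; elim: s => [|i s IH]; first by rewrite !big_nil res0.
rewrite !big_cons; case: ifP => // ci; rewrite resD ?IH ?h //; exact: rpred_sum.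
Qed.

Lemma valO_int z : z \in I -> z \in valO.
Proof. by move=> zI; apply/asboolP; apply: pl_int. Qed.
Lemma valO_j a : j a \in valO. Proof. exact/valO_int/int_j. Qed.

Lemma res_j a : res (j a) = 0 <-> dv a.
Proof. by have /valOP[o [oz ->]] := valO_j a; apply: pl_base. Qed.

Lemma res_p : res p%:R = 0.
Proof.
rewrite -(rmorph_nat j); apply/res_j.
by exists 1; rewrite mulr1.
Qed.

Lemma pk_p : p%:R = 0 :> pk P. Proof. by rewrite -res_nat res_p. Qed.

Lemma valO_inv z : z \in valO -> res z != 0 -> z^-1 \in valO /\ res z^-1 = (res z)^-1.
Proof.
move=> zO; have [o [oz ->]] := valOP zO => o0.
have [o' oo'] := pl_unit o0.
have e : z^-1 = pv P o'.
  have z0 : z != 0.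
    apply: contraNneq o0 => z0; apply/eqP.
    by rewrite (_ : o = 0) ?rmorph0 //; apply: (@pv_inj _ _ _ _ P); rewrite rmorph0 oz z0.
  apply: (mulfI z0); rewrite divff // -oz -rmorphM oo' rmorph1 //.
split; first by rewrite e pv_valO.
rewrite e res_pv; apply: (mulfI o0); rewrite divff // -rmorphM oo' rmorph1 //.
Qed.

Lemma valO_out z : z \notin valO -> [/\ z != 0, z^-1 \in valO & res z^-1 = 0].
Proof.
move=> zO; case: (pl_val P z) => [h|[o [oz o0]]]; first by case/asboolP: zO.
have z0 : z != 0 by apply: contraNneq zO => ->; apply: rpred0.
have e : z^-1 = pv P o by apply: (mulIf z0); rewrite mulVf.
by rewrite e pv_valO res_pv.
Qed.

Definition unitO z := z \in valO /\ res z != 0.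

Lemma unitO1 : unitO 1. Proof. by split; rewrite ?rpred1 // res1 oner_neq0. Qed.
Lemma unitOM x y : unitO x -> unitO y -> unitO (x * y).
Proof. by move=> [xO x0] [yO y0]; split; rewrite ?rpredM // resM // mulf_neq0. Qed.
Lemma unitOV x : unitO x -> unitO x^-1.
Proof. by move=> [xO x0]; have [h e] := valO_inv xO x0; split=> //; rewrite e invr_neq0. Qed.
Lemma unitOX x n : unitO x -> unitO (x ^+ n).
Proof. by move=> [xO x0]; split; rewrite ?rpredX // resX // expf_neq0. Qed.
Lemma unitO_neq0 x : unitO x -> x != 0.
Proof. by move=> [_]; apply: contraNneq => ->; rewrite res0. Qed.
Lemma unitO_j a : ~ dv a -> unitO (j a).
Proof. by move=> na; split; [apply: valO_j|apply/eqP => /res_j]. Qed.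
Lemma unitOP z : z \in valO -> res z = 0 \/ unitO z.
Proof. by move=> zO; have [|h] := eqVneq (res z) 0; [left|right]. Qed.
End PlaceCalculus.

(** A relation of a nonzero element can be divided by X as long as its
    constant coefficient vanishes. *)
Lemma const_relation (z : E) : z != 0 -> exists2 f : {poly A}, f`_0 != 0 & root (map_poly j f) z.
Proof.
move=> z0; have [f f0 fz] := br_alg B z.
elim: (size f) {-2}f (leqnn (size f)) f0 fz => [|n IH] {}f sf f0 fz.
  by rewrite leqn0 size_poly_eq0 (negbTE f0) in sf.
have [h|h] := eqVneq f`_0 0; last by exists f.
have fd : f = drop_poly 1 f * 'X.
  rewrite -[LHS](poly_take_drop 1) expr1 (size1_polyC (size_take_poly _ _)) coef_take_poly /= h.
  by rewrite add0r.
apply: (IH (drop_poly 1 f)).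
- by rewrite size_drop_poly leq_subLR add1n.
- by apply: contraNneq f0 => e; rewrite fd e mul0r.
- move: fz; rewrite {1}fd rmorphM /= map_polyX rootM => /orP[//|].
  by rewrite rootE hornerX (negbTE z0).
Qed.

(** A relation of z with nonzero constant coefficient p^k b, where p does not
    divide b, shows that b would have residue 0 if z / p^(k+1) were in the
    valuation ring. *)
Lemma p_finite (P : place) (z : E) : z != 0 -> exists k, z / p%:R ^+ k \notin valO P.
Proof.
move=> z0; have [f f0 /rootP fz] := const_relation z0.
apply: contrapT => H; have zp k : z / p%:R ^+ k \in valO P.
  by apply/negP => /negP h; apply: H; exists k.
have zO : z \in valO P by have := zp 0%N; rewrite expr0 divr1.
pose w := (drop_poly 1 (map_poly j f)).[z].
have wO : w \in valO P.
  apply: rpred_horner => //; apply/polyOverP => i; rewrite coef_drop_poly coef_map; exact: valO_j.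
have e : j f`_0 = - (w * z).
  apply/eqP; rewrite -addr_eq0; apply/eqP; rewrite -[RHS]fz -[in RHS](poly_take_drop 1 (map_poly j f)).
  rewrite hornerD hornerM hornerXn expr1; congr (_ + _).
  by rewrite (size1_polyC (size_take_poly _ _)) hornerC coef_take_poly /= coef_map.
have [k [b [fb nb]]] := br_sep B f0.
have pE0 := p_neq0 B.
apply: nb; apply/(res_j P).
have -> : j b = - (w * (z / p%:R ^+ k.+1)) * p%:R.
  have e2 : p%:R ^+ k * j b = - (w * z) by rewrite -e fb rmorphM rmorphXn rmorph_nat.
  have pk0 := expf_neq0 k pE0; apply: (mulfI pk0); rewrite e2 exprS; set pk := _ ^+ k in pk0 *.
  by field; rewrite pE0 pk0.
rewrite resM ?res_p ?mulr0 //; first by rewrite rpredN rpredM.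
by apply: valO_int; rewrite rpred_nat.
Qed.

(** The last two hypotheses force the prime given by [krull_prime] to meet A
    in pA. *)
Lemma place_exists (a s : set Id) :
  a 0 -> (forall x y, a x -> a y -> a (x + y)) -> (forall r x, a x -> a (r * x)) ->
  (forall x y, s x -> s y -> s (x * y)) -> (forall x, a x -> s x -> False) ->
  (forall x, val x = p%:R -> a x) -> (forall x b, ~ dv b -> val x = j b -> s x) ->
  exists P : place, (forall x : Id, a x -> res P (val x) = 0) /\ (forall x : Id, s x -> res P (val x) != 0).
Proof.
move=> a0 aD aM sM as0 ap sA.
have s1 : s 1 by apply: (sA 1 1); [exact: br_p1 B|rewrite !rmorph1].
have [Q [aQ sQ]] := krull_prime a0 aD aM s1 sM as0.
have QA (b : A) (x : Id) : val x = j b -> x \in Q <-> dv b.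
  move=> xb; split.
    by move=> xQ; apply: contrapT => nb; have := sQ x (sA x b nb xb); rewrite xQ.
  move=> [c bc]; have pI : p%:R \in I by rewrite rpred_nat.
  have -> : x = Subdom (int_j j c) * Subdom pI.
    by apply: val_inj; rewrite xb bc rmorphM rmorph_nat mulrC.
  by apply: idealMr; apply: aQ; apply: ap.
have [P HP] := place_of_prime B QA.
have key (x : Id) : res P (val x) = 0 <-> x \in Q.
  by have /valOP[o [oz ->]] := valO_int P (valP x); apply: HP.
exists P; split=> x h; first by apply/key; apply: aQ.
by apply/eqP => /key; apply/negP; apply: sQ.
Qed.

Lemma horner_diff (R : comNzRingType) (q : {poly R}) (x y : R) : exists t, q.[x] - q.[y] = t * (x - y).
Proof.
have : root (q - q.[y]%:P) y by rewrite rootE hornerD hornerN hornerC subrr.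
case/factor_theorem => g e; exists g.[x].
have := congr1 (fun u => u.[x]) e.
by rewrite hornerD hornerN hornerC hornerM hornerXsubC.
Qed.

Local Notation toI := (corestrict (int_j j)).

Lemma valtoI q (y : Id) : val (map_poly toI q).[y] = (map_poly j q).[val y].
Proof.
rewrite -[LHS](horner_map (val : {rmorphism Id -> E})).
by rewrite -map_poly_comp; congr (_.[_]); apply: eq_map_poly => u.
Qed.

(** Otherwise the ideal of denominators D = { d | d z integral }, enlarged by
    p, avoids all elements of A prime to p, so it vanishes at some place by
    [place_exists]. But z lies in the valuation ring of that place, and
    [valuation_relation] writes it as a fraction of integral elements whose
    denominator has a nonzero residue. *)
Lemma int_of_places (z : E) : (forall P : place, z \in valO P) -> exists2 a, ~ dv a & j a * z \in I.
Proof.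
move=> zO; apply: contrapT => H.
pose D : set Id := fun d => val d * z \in I.
have DD x y : D x -> D y -> D (x + y).
  by rewrite /D rmorphD mulrDl => h k; apply: rpredD.
have DM r x : D x -> D (r * x).
  by rewrite /D rmorphM -mulrA => h; apply: rpredM => //; apply: valP.
have nD d b : ~ dv b -> val d = j b -> ~ D d.
  by move=> nb db Dd; apply: H; exists b; rewrite -?db.
have pI : p%:R \in I by rewrite rpred_nat.
pose pp : Id := Subdom pI.
pose a : set Id := fun x => exists d b, D d /\ x = d + b * pp.
pose s : set Id := fun x => exists2 b, ~ dv b & val x = j b.
have [||||||x b nb xb|P [aP sP]] := @place_exists a s.
- by exists 0, 0; rewrite mul0r addr0 /D rmorph0 mul0r rpred0.
- move=> x y [d [b [Dd ->]]] [d' [b' [Dd' ->]]].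
  by exists (d + d'), (b + b'); split; [apply: DD|rewrite mulrDl addrACA].
- move=> r x [d [b [Dd ->]]]; exists (r * d), (r * b); split; [exact: DM|by rewrite mulrDr mulrA].
- move=> x y [b nb xb] [c nc yc]; exists (b * c); last by rewrite [RHS]rmorphM -xb -yc.
  by move/(br_pM B) => [].
- move=> x [d [b [Dd xe]]] [c nc xc].
  have /intIP[h hm hb] := valP b.
  pose k := (size h).-1.
  (* h is a monic relation of b, and hh the one of b p with coefficients
     multiplied by powers of p. So hh(c) = hh(c) - hh(b p) is a multiple of c
     - b p = d, whereas hh(c) = c^k modulo p. *)
  pose hh : {poly A} := \poly_(i < size h) (h`_i * p%:R ^+ (k - i)).
  have hs : size h = k.+1 by rewrite /k prednK // size_poly_gt0 monic_neq0.
  have hk : h`_k = 1 by move/monicP: hm.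
  have nhc : ~ dv hh.[c].
    rewrite /hh horner_poly hs big_ord_recr /= subnn expr0 mulr1 hk mul1r => hd.
    have ck : ~ dv (c ^+ k) by move/(dvX B).
    apply: ck; rewrite -[c ^+ k](addKr (\sum_(i < k) h`_i * p%:R ^+ (k - i) * c ^+ i)).
    apply: dvD => //; apply: dvN; apply: big_ind; [exact: dv0|exact: dvD|].
    move=> i _; apply: dvMl; apply: dvMr; rewrite -(subnSK (ltn_ord i)) exprS.
    by apply: dvMl; exists 1; rewrite mulr1.
  have [t ht] := horner_diff (map_poly toI hh) (toI c) (b * pp).
  have hh0 : (map_poly toI hh).[b * pp] = 0.
    apply: val_inj; rewrite valtoI rmorph0 rmorphM /=.
    have e1 : map_poly j hh = \poly_(i < size h) ((map_poly j h)`_i * p%:R ^+ (k - i)).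
      apply/polyP => i; rewrite coef_map /= !coef_poly; case: ifP => _; last by rewrite rmorph0.
      by rewrite rmorphM rmorphXn rmorph_nat.
    rewrite e1 horner_poly.
    transitivity (p%:R ^+ k * (map_poly j h).[val b]); last by rewrite (rootP hb) mulr0.
    have smh : (size (map_poly j h) <= size h)%N by rewrite size_poly.
    rewrite (horner_coef_wide _ smh) mulr_sumr; apply: eq_bigr => -[i /= lt] _.
    have -> : p%:R ^+ k = p%:R ^+ (k - i) * p%:R ^+ i :> E.
      by rewrite -exprD subnK // -ltnS -hs.
    by rewrite exprMn; ring.
  apply: (nD (map_poly toI hh).[toI c] hh.[c] nhc).
    by rewrite valtoI /= horner_map.
  rewrite -[X in D X]subr0 -[X in D (_ - X)]hh0 ht; apply: DM.
  suff -> : toI c - b * pp = d by [].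
  have -> : toI c = x by apply: val_inj; rewrite [RHS]xc.
  by rewrite xe addrK.
- move=> x xp; exists 0, 1; split; first by rewrite /D rmorph0 mul0r rpred0.
  by apply: val_inj; rewrite mul1r add0r.
- by exists b.
have [b [sb [nsb ze]]] : exists b c : Id, res P (val c) != 0 /\ val b = val c * z.
  have [a0 [b [b' [na e [bI bzI b'I b'zI] _]]]] := valuation_relation B z.
  have [h|h] := eqVneq (res P b') 0; last by exists (Subdom b'zI), (Subdom b'I).
  have bO := valO_int P bI; have bzO := valO_int P bzI; have b'O := valO_int P b'I.
  have : res P (j a0) != 0 by apply/eqP => /res_j.
  rewrite e resB // h add0r resM ?zO // oppr_eq0 mulf_eq0 negb_or => /andP[nb _].
  by exists (Subdom bzI), (Subdom bI).
have : D sb by rewrite /D -ze; apply: valP.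
move=> Dsb; have : a sb by exists sb, 0; rewrite mul0r addr0.
by move/aP/eqP; rewrite (negbTE nsb).
Qed.

End Core.

(** * Inseparable and perfect fields of characteristic p *)

Section FieldLemmas.
Variables (p : nat) (k : fieldType) (D : divringClosed k).
Hypothesis pk : p \in [pchar k].

Let pp : prime p. Proof. by case/andP: pk. Qed.

Lemma XsubC_pchar (y : k) n : ('X - y%:P) ^+ (p ^ n)%N = 'X^(p ^ n)%N - (y ^+ (p ^ n)%N)%:P.
Proof.
have pnat : [pchar {poly k}].-nat (p ^ n)%N.
  rewrite (eq_pnat _ (pchar_poly k)).
  have e : [pchar k] =i (p : nat_pred) by move=> q; rewrite (pcharf_eq pk).
  by rewrite (eq_pnat _ e) pnatX pnat_id ?orbT.
by rewrite exprDn_pchar // exprNn_pchar // polyC_exp.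
Qed.

Lemma exp_XsubC_polyOver (y : k) (m n : nat) : (n <= m)%N ->
  ('X - y%:P) ^+ m \is a polyOver D -> ('X - y%:P) ^+ n \is a polyOver D ->
  ('X - y%:P) ^+ (m - n) \is a polyOver D.
Proof.
move=> nm hm hn; have e : ('X - y%:P) ^+ (m - n) = ('X - y%:P) ^+ m %/ ('X - y%:P) ^+ n.
  by rewrite -{2}(subnK nm) exprD mulpK // expf_neq0 // polyXsubC_eq0.
by rewrite e polyOver_divp.
Qed.

Lemma monic_eqp_polyOver (D0 : divringClosed k) (g q : {poly k}) :
  g \is a polyOver D0 -> g %= q -> q \is monic -> q \is a polyOver D0.
Proof.
move=> gD /eqpP[[c1 c2] /= /andP[c10 c20] e] qm.
have e2 : g = (c2 / c1) *: q by rewrite mulrC -scalerA -e scalerA mulVf // scale1r.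
have -> : q = (lead_coef g)^-1 *: g.
  rewrite {2}e2 scalerA e2 lead_coefZ (monicP qm) mulr1 mulVf ?scale1r //.
  by rewrite mulf_neq0 // invr_neq0.
by rewrite polyOverZ // rpredV; move/polyOverP: gD; apply.
Qed.

(** The polynomial X^q - y^q, with q = p^a, is irreducible over D. A factor
    over D is a power (X - y)^m; as (X - y)^q is over D, so is (X - y)^gcd(m,
    q), where gcd(m, q) = p^b with b < a if m < q. Then y^(p^b) lies in D and
    y^q is a p-th power in D. *)
Lemma purely_insep_indep (a : nat) (y : k) (b : {poly k}) :
  y ^+ (p ^ a)%N \in D -> (forall d, d \in D -> d ^+ p != y ^+ (p ^ a)%N) ->
  b \is a polyOver D -> b != 0 -> (size b <= p ^ a)%N -> b.[y] != 0.
Proof.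
move=> yD yn bD b0 sb; apply/eqP => by0.
set q := (p ^ a)%N in yD yn sb *.
have fD : ('X - y%:P) ^+ q \is a polyOver D by rewrite XsubC_pchar polyOverXnsubC.
have gD := polyOver_gcdp bD fD.
set g := gcdp b _ in gD.
have /dvdp_exp_XsubCP[m mq gm] : g %| ('X - y%:P) ^+ q by rewrite dvdp_gcdr.
have q0 : (0 < q)%N by rewrite expn_gt0 prime_gt0.
have m0 : (0 < m)%N.
  rewrite lt0n; apply/negP => /eqP m0.
  have : root g y by rewrite root_gcd /root by0 eqxx horner_exp hornerXsubC subrr expr0n eqn0Ngt q0 /=.
  by rewrite (eqp_root gm) m0 expr0 (negbTE (root1 _)).
have mltq : (m < q)%N.
  have : (size g <= size b)%N by rewrite dvdp_leq // dvdp_gcdl.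
  by rewrite (eqp_size gm) size_exp_XsubC => h; apply: leq_trans h sb.
have mD : ('X - y%:P) ^+ m \is a polyOver D.
  by apply: monic_eqp_polyOver gD gm _; rewrite monic_exp // monicXsubC.
have mDn n : ('X - y%:P) ^+ (n * m) \is a polyOver D by rewrite mulnC exprM rpredX.
have qDn n : ('X - y%:P) ^+ (n * q) \is a polyOver D by rewrite mulnC exprM rpredX.
(* Bezout: gcd(m, q) = km m - kn q, so dividing powers of X - y over D gives
   the exponent gcd(m, q). *)
have [km kn e _] := egcdnP q m0.
have gD' : ('X - y%:P) ^+ gcdn m q \is a polyOver D.
  have -> : gcdn m q = (km * m - kn * q)%N by rewrite e addKn.
  by apply: exp_XsubC_polyOver => //; rewrite e leq_addr.
have /(dvdn_pfactor _ _ pp)[b1 b1a gb1] := dvdn_gcdr m q.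
have b1lt : (b1 < a)%N.
  rewrite -(ltn_exp2l _ _ (prime_gt1 pp)) -gb1.
  by apply: leq_ltn_trans mltq; rewrite dvdn_leq // dvdn_gcdl.
move: gD'; rewrite gb1 XsubC_pchar polyOverXnsubC => yb1.
have := yn _ (rpredX (p ^ (a - b1.+1)) yb1); rewrite -!exprM.
have -> : (p ^ b1 * (p ^ (a - b1.+1) * p) = q)%N.
  by rewrite -expnSr -expnD subnSK // subnKC // ltnW.
by rewrite eqxx.
Qed.

(** Algebraic extensions of perfect fields are perfect. A polynomial g of
    least degree over D with root c is separable, for otherwise it would be a
    p-th power of a polynomial over D. Hence the gcd of g and (X - c)^p = X^p
    - c^p is X - c; but g and X^p - c^p have coefficients in the field of p-th
    powers of elements of D'. *)
Lemma perfect_alg (D' : divringClosed k) (c : k) (h : {poly k}) :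
  {subset D <= D'} -> (forall d, d \in D -> exists2 e, e \in D & e ^+ p = d) ->
  c \in D' -> h \is a polyOver D -> h != 0 -> root h c -> exists2 e, e \in D' & e ^+ p = c.
Proof.
move=> DD' Dperf cD' hD h0 hc.
pose F1 : {pred k} := fun x => `[< exists2 e, e \in D' & e ^+ p = x >].
have F1c : divring_closed F1.
  split; first by apply/asboolP; exists 1; rewrite ?rpred1 ?expr1n.
  - move=> x y /asboolP[e eD <-] /asboolP[e' eD' <-]; apply/asboolP; exists (e - e').
      by rewrite rpredB.
    have pn : [pchar k].-nat p.
      have e0 : [pchar k] =i (p : nat_pred) by move=> q; rewrite (pcharf_eq pk).
      by rewrite (eq_pnat _ e0) pnat_id.
    by rewrite exprDn_pchar // exprNn_pchar.
  - move=> x y /asboolP[e eD <-] /asboolP[e' eD' <-]; apply/asboolP; exists (e / e').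
      by rewrite rpredM // rpredV.
    by rewrite exprMn exprVn.
pose F1d : divringClosed k := HB.pack F1 (GRing.isDivringClosed.Build k F1 F1c).
have DF1 : {subset D <= F1d}.
  by move=> d dD; have [e eD <-] := Dperf d dD; apply/asboolP; exists e => //; apply: DD'.
have [n [g [gD g0 gc sg]] nmin] : exists2 n, exists g, [/\ g \is a polyOver D, g != 0, root g c & size g = n] &
   forall g, g \is a polyOver D -> g != 0 -> root g c -> (n <= size g)%N.
  pose P n := `[< exists g, [/\ g \is a polyOver D, g != 0, root g c & size g = n] >].
  have exP : exists n, P n by exists (size h); apply/asboolP; exists h.
  case: (ex_minnP exP) => n /asboolP Pn nmin; exists n => // g gD g0 gc.
  by apply: nmin; apply/asboolP; exists g.
(* If g' vanished at c it would be 0 by minimality, and g a polynomial in X^p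
   with coefficients in D, so the p-th power of g1. *)
have g'c : g^`().[c] != 0.
  apply/negP => g'c.
  have g'0 : g^`() = 0.
    apply/eqP; apply: contraT => g'0.
    have := nmin _ (polyOver_deriv gD) g'0 g'c.
    by rewrite leqNgt -sg lt_size_deriv.
  have gcoef i : ~~ (p %| i)%N -> g`_i = 0.
    case: i => [|i]; first by rewrite dvdn0.
    move=> pi; have := congr1 (fun u : {poly k} => u`_i) g'0; rewrite coef_deriv coef0 => /eqP.
    rewrite -mulr_natr mulf_eq0 => /orP[/eqP//|].
    by rewrite -(dvdn_pcharf pk) (negbTE pi).
  have /choice[r Hr] : forall i, exists x, x \in D /\ x ^+ p = g`_i.
    by move=> i; have [x xD e] := Dperf _ (polyOverP gD i); exists x.
  pose g1 := \poly_(i < size g) r (i * p)%N.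
  have e : g1 ^+ p = g.
    have pn : [pchar {poly k}].-nat p.
      rewrite (eq_pnat _ (pchar_poly k)).
      have e0 : [pchar k] =i (p : nat_pred) by move=> q; rewrite (pcharf_eq pk).
      by rewrite (eq_pnat _ e0) pnat_id.
    have powsum (s : seq nat) (F : nat -> {poly k}) :
      (\sum_(i <- s) F i) ^+ p = \sum_(i <- s) (F i) ^+ p.
      elim: s => [|i s IH]; first by rewrite !big_nil expr0n eqn0Ngt prime_gt0.
      by rewrite !big_cons exprDn_pchar // IH.
    rewrite /g1 poly_def -(big_mkord xpredT (fun i => r (i * p)%N *: 'X^i)) powsum.
    apply/polyP => i; rewrite coef_sum.
    rewrite (eq_bigr (fun l => g`_(l * p) * ((i == l * p)%N)%:R)); last first.
      move=> l _; rewrite exprZn -exprM coefZ coefXn; congr (_ * _).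
      by case: (Hr (l * p)%N).
    have [pi|npi] := boolP (p %| i)%N; last first.
      rewrite gcoef // big1 // => l _; case: eqP => [il|_]; last by rewrite mulr0.
      by rewrite il dvdn_mull in npi.
    have [si|si] := leqP (size g) i.
      rewrite (nth_default _ si) big1 // => l _; case: eqP => [<-|_]; last by rewrite mulr0.
      by rewrite (nth_default _ si) mul0r.
    have lt : (i %/ p < size g)%N by apply: leq_ltn_trans si; rewrite leq_div.
    rewrite big_mkord (bigD1 (Ordinal lt)) //= divnK // eqxx mulr1 big1 ?addr0 // => l nl.
    case: eqP => [il|_]; last by rewrite mulr0.
    by move: nl; rewrite -(inj_eq val_inj) /= il mulnK ?prime_gt0 // eqxx.
  have g10 : g1 != 0 by apply: contraNneq g0 => g10; rewrite -e g10 expr0n eqn0Ngt prime_gt0.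
  have g1c : root g1 c.
    by move: gc; rewrite -e !rootE horner_exp expf_eq0 => /andP[].
  have g1D : g1 \is a polyOver D.
    by apply: polyOver_poly => i _; case: (Hr (i * p)%N).
  have := nmin _ g1D g10 g1c.
  have s1 : (1 < size g1)%N by rewrite (root_size_gt1 g10 g1c).
  rewrite leqNgt -sg => /negP; apply; rewrite -e.
  rewrite -(@prednK (size (g1 ^+ p)%R)) ?size_poly_gt0 ?expf_neq0 // size_exp.
  case: (size g1) s1 => [|[|s]] //= _; rewrite ltnS.
  apply: (@leq_trans (s.+1 * 2)%N); first by rewrite muln2 -addnn addSnnS leq_addl.
  by rewrite leq_mul2l prime_gt1.
have gF : g \is a polyOver F1d by apply: polyOverS gD => x; apply: DF1.
have XF : ('X - c%:P) ^+ (p ^ 1)%N \is a polyOver F1d.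
  rewrite XsubC_pchar polyOverXnsubC expn1; apply/asboolP; by exists c.
have ggF := polyOver_gcdp gF XF.
set d := gcdp g _ in ggF.
have /dvdp_exp_XsubCP[m mq dm] : d %| ('X - c%:P) ^+ (p ^ 1)%N by rewrite dvdp_gcdr.
have m0 : (0 < m)%N.
  rewrite lt0n; apply/negP => /eqP m0.
  have : root d c by rewrite root_gcd gc /root horner_exp hornerXsubC subrr expr0n expn1 eqn0Ngt prime_gt0 //= eqxx.
  by rewrite (eqp_root dm) m0 expr0 (negbTE (root1 _)).
have m1 : (m <= 1)%N.
  rewrite leqNgt; apply/negP => m2.
  have : ('X - c%:P) ^+ 2 %| g.
    apply: (@dvdp_trans _ d); last exact: dvdp_gcdl.
    by rewrite (eqp_dvdr _ dm) dvdp_exp2l.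
  case/dvdpP => u gu; move: g'c; rewrite gu derivM hornerD !hornerM deriv_exp hornerMn hornerM !horner_exp.
  by rewrite !hornerXsubC subrr expr1 !(mulr0, mul0r, mul0rn, addr0) eqxx.
have mE : m = 1%N by apply/eqP; rewrite eqn_leq m1 m0.
rewrite mE expr1 in dm.
have := monic_eqp_polyOver ggF dm (monicXsubC _).
by rewrite polyOverXsubC => /asboolP.
Qed.
End FieldLemmas.

(** * Simple extensions and uniformizers *)

Section Core.
Variables (p : nat) (A : idomainType) (E : closedFieldType) (j : {rmorphism A -> E}).
Hypothesis B : base_ring p j.

Local Notation dv := (@dvdby A p).
Local Notation I := (intI j).
Local Notation place := (place p j).

Section Adjoin.
Variable L : divringClosed E.
Hypothesis jL : forall a, j a \in L.
Variable y : E.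

Definition adjp : {pred E} := fun x => `[< exists2 c : {poly E}, c \is a polyOver L & x = c.[y] >].

Lemma adjp_sub : subring_closed adjp.
Proof.
split; first by apply/asboolP; exists 1; rewrite ?rpred1 // hornerC.
- move=> _ _ /asboolP[c cL ->] /asboolP[d dL ->]; apply/asboolP; exists (c - d).
    by rewrite rpredB.
  by rewrite hornerD hornerN.
- move=> _ _ /asboolP[c cL ->] /asboolP[d dL ->]; apply/asboolP; exists (c * d).
    by rewrite rpredM.
  by rewrite hornerM.
Qed.

Lemma adjp_L x : x \in L -> x \in adjp.
Proof. by move=> xL; apply/asboolP; exists x%:P; rewrite ?polyOverC ?hornerC. Qed.

Lemma adjp_closed : divring_closed adjp.
Proof.
have [h1 hB hM] := adjp_sub.
pose R : subringClosed E := HB.pack adjp (GRing.isSubringClosed.Build E adjp adjp_sub).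
split=> // x z xA zA; have [->|z0] := eqVneq z 0; first by rewrite invr0 mulr0 -(subrr 1) hB.
apply: (hM) => //; have [f f0 fz] := const_relation B z0.
have e : z * (drop_poly 1 (map_poly j f)).[z] = - j f`_0.
  apply/eqP; rewrite -addr_eq0 addrC; apply/eqP; rewrite -[RHS](rootP fz).
  rewrite -[in RHS](poly_take_drop 1 (map_poly j f)) hornerD hornerM hornerXn expr1 [z * _]mulrC.
  by rewrite (size1_polyC (size_take_poly _ _)) hornerC coef_take_poly /= coef_map.
have jf0 : j f`_0 != 0 by rewrite (j0 B).
have -> : z^-1 = - (j f`_0)^-1 * (drop_poly 1 (map_poly j f)).[z].
  apply: (mulfI z0); rewrite divff // mulrCA e; by field.
apply: hM; first by apply: adjp_L; rewrite rpredN rpredV.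
have : (drop_poly 1 (map_poly j f)).[z] \in R.
  apply: rpred_horner => //; apply/polyOverP => i; rewrite coef_drop_poly coef_map.
  by apply: adjp_L; apply: jL.
by [].
Qed.

Definition adj : divringClosed E := HB.pack adjp (GRing.isDivringClosed.Build E adjp adjp_closed).

Lemma sub_adj : {subset L <= adj}. Proof. exact: adjp_L. Qed.
Lemma mem_adj : y \in adj.
Proof. by apply/asboolP; exists 'X; rewrite ?polyOverX ?hornerX. Qed.
Lemma adjP x : x \in adj -> exists2 c : {poly E}, c \is a polyOver L & x = c.[y].
Proof. by move=> /asboolP. Qed.
Lemma adj_min (L' : divringClosed E) : {subset L <= L'} -> y \in L' -> {subset adj <= L'}.
Proof.
move=> LL' yL' x /adjP[c cL ->]; apply: rpred_horner => //.
by apply: polyOverS cL.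
Qed.
Lemma adj_red (f : {poly E}) x : f \is a polyOver L -> f != 0 -> f.[y] = 0 -> x \in adj ->
  exists c : {poly E}, [/\ c \is a polyOver L, (size c < size f)%N & x = c.[y]].
Proof.
move=> fL f0 fy /adjP[c cL ->]; exists (c %% f); rewrite polyOver_modp // ltn_modp f0; split=> //.
by rewrite {1}(divp_eq c f) hornerD hornerM fy mulr0 add0r.
Qed.
End Adjoin.

Section AtPlace.
Variable P : place.
Local Notation O := (valO P).
Local Notation rs := (res P).

(** The fractions come from [valuation_relation], whose terms lie in every
    subring containing A and z. *)
Lemma frac_rep (L : divringClosed E) z : (forall a, j a \in L) -> z \in L -> z \in O ->
  exists b s, [/\ b \in L, b \in I, s \in L, s \in I & rs s != 0 /\ z = b / s].
Proof.
move=> jL zL zO; have [a0 [b [b' [na e [bI bzI b'I b'zI] H]]]] := valuation_relation B z.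
have [bL b'L] := H L jL zL.
have s0 s : rs s != 0 -> s != 0 by apply: contraNneq => ->; rewrite res0.
have [h|h] := eqVneq (rs b') 0; last first.
  exists (b' * z), b'; rewrite rpredM //; split=> //; split=> //.
  by rewrite mulrAC divff ?mul1r // s0.
have bO := valO_int P bI; have bzO := valO_int P bzI; have b'O := valO_int P b'I.
have : rs (j a0) != 0 by apply/eqP => /res_j.
rewrite e resB // h add0r resM // oppr_eq0 mulf_eq0 negb_or => /andP[nb _].
exists (b * z), b; rewrite rpredM //; split=> //; split=> //.
by rewrite mulrAC divff ?mul1r // s0.
Qed.

Definition resfield_pred (L : divringClosed E) : {pred pk P} :=
  fun c => `[< exists z, [/\ z \in L, z \in O & rs z = c] >].
Lemma resfield_closed L : divring_closed (resfield_pred L).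
Proof.
split; first by apply/asboolP; exists 1; rewrite !rpred1 res1.
- move=> _ _ /asboolP[x [xL xO <-]] /asboolP[y [yL yO <-]]; apply/asboolP.
  by exists (x - y); rewrite !rpredB // resB.
- move=> _ _ /asboolP[x [xL xO <-]] /asboolP[y [yL yO <-]]; apply/asboolP.
  have [->|y0] := eqVneq (rs y) 0; first by exists 0; rewrite !rpred0 res0 invr0 mulr0.
  have [yV e] := valO_inv yO y0.
  by exists (x / y); rewrite !rpredM ?rpredV // resM // e.
Qed.
Definition resfield L : divringClosed (pk P) :=
  HB.pack (resfield_pred L) (GRing.isDivringClosed.Build (pk P) (resfield_pred L) (resfield_closed L)).

Lemma mem_resfield (L : divringClosed E) z : z \in L -> z \in O -> rs z \in resfield L.
Proof. by move=> zL zO; apply/asboolP; exists z. Qed.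
Lemma resfieldP L c : c \in resfield L -> exists z, [/\ z \in L, z \in O & rs z = c].
Proof. by move=> /asboolP. Qed.
Lemma resfieldS (L L' : divringClosed E) : {subset L <= L'} -> {subset resfield L <= resfield L'}.
Proof. by move=> LL' c /resfieldP[z [zL zO <-]]; apply: mem_resfield => //; apply: LL'. Qed.

Lemma pk_pchar : p \in [pchar (pk P)].
Proof. by rewrite inE (br_prime B) pk_p eqxx. Qed.

Lemma val_total x y : x != 0 -> y != 0 -> x / y \in O \/ y / x \in O.
Proof.
move=> x0 y0; have [|/valO_out[_ h _]] := boolP (x / y \in O); first by left.
by right; rewrite -invf_div.
Qed.

(** The values of the c_i are totally ordered. Values are compared by testing
    whether a quotient lies in the valuation ring. *)
Lemma val_min n (c : nat -> E) : (exists2 i, (i < n)%N & c i != 0) ->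
  exists i, [/\ (i < n)%N, c i != 0 & forall l, (l < n)%N -> c l / c i \in O].
Proof.
elim: n => [|n IH] [i] //; rewrite ltnS => ilen ci.
have [ex|nex] := pselect (exists2 i, (i < n)%N & c i != 0).
  have [k [kn ck Hk]] := IH ex.
  have [cn0|cn] := eqVneq (c n) 0.
    exists k; split=> // [|l]; first exact: ltnW.
    by rewrite ltnS leq_eqVlt => /orP[/eqP->|/Hk//]; rewrite cn0 mul0r rpred0.
  case: (val_total cn ck) => h.
    exists k; split=> // [|l]; first exact: ltnW.
    by rewrite ltnS leq_eqVlt => /orP[/eqP->|/Hk//].
  exists n; split=> // l; rewrite ltnS leq_eqVlt => /orP[/eqP->|/Hk cl].
    by rewrite divff // rpred1.
  have -> : c l / c n = (c l / c k) * (c k / c n) by rewrite mulrA divfK.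
  exact: rpredM.
have -> : n = i.
  apply/eqP; rewrite eqn_leq ilen andbT leqNgt; apply/negP => lt; apply: nex; by exists i.
exists i; split=> // l; rewrite ltnS leq_eqVlt => /orP[/eqP->|lt].
  by rewrite divff // rpred1.
have [->|h] := eqVneq (c l) 0; first by rewrite mul0r rpred0.
by exfalso; apply: nex; exists l => //; apply: leq_trans lt ilen.
Qed.

Definition powu (pi x : E) := exists (z : int) w, unitO P w /\ x = pi ^ z * w.

Lemma powuM pi x y : pi != 0 -> powu pi x -> powu pi y -> powu pi (x * y).
Proof.
move=> pi0 [z [w [uw ->]]] [z' [w' [uw' ->]]]; exists (z + z'), (w * w').
by split; [exact: unitOM|rewrite expfzDr // mulrACA].
Qed.
Lemma powuV pi x : powu pi x -> powu pi x^-1.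
Proof.
move=> [z [w [uw ->]]]; exists (- z), w^-1; split; first exact: unitOV.
by rewrite invfM invr_expz.
Qed.
Lemma powu_unit pi w : unitO P w -> powu pi w.
Proof. by move=> uw; exists 0, w; rewrite expr0z mul1r. Qed.

(** The values of nonzero elements of L are multiples of the value of pi,
    which is positive. The element pi may lie outside L. *)
Record unif (L : divringClosed E) (pi : E) : Prop := Unif {
  un_O : pi \in O;
  un_res : rs pi = 0;
  un_neq0 : pi != 0;
  un_pow : forall x, x \in L -> x != 0 -> powu pi x }.

Lemma unifS (L L' : divringClosed E) pi : {subset L' <= L} -> unif L pi -> unif L' pi.
Proof. by move=> LL' [h1 h2 h3 h4]; split=> // x /LL'; apply: h4. Qed.

Lemma powz_pos pi (z : int) : pi \in O -> rs pi = 0 -> pi != 0 -> (0 < z)%R ->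
  pi ^ z \in O /\ rs (pi ^ z) = 0.
Proof.
move=> piO pir pi0; case: z => // -[//|n] _.
by rewrite -exprnP rpredX // resX // pir expr0n.
Qed.

Lemma powz_sign pi (z : int) w : pi \in O -> rs pi = 0 -> pi != 0 -> unitO P w ->
  [/\ pi ^ z * w \in O <-> (0 <= z)%R, (pi ^ z * w \in O /\ rs (pi ^ z * w) = 0) <-> (0 < z)%R &
      unitO P (pi ^ z * w) <-> z = 0].
Proof.
move=> piO pir pi0 uw; have [wO w0] := uw.
have pos (n : int) v : (0 < n)%R -> unitO P v -> pi ^ n * v \in O /\ rs (pi ^ n * v) = 0.
  move=> n0 [vO v0]; have [h1 h2] := powz_pos piO pir pi0 n0.
  by rewrite rpredM // resM // h2 mul0r.
have neg (n : int) v : (n < 0)%R -> unitO P v -> pi ^ n * v \notin O.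
  move=> n0 uv; apply/negP => h.
  have n0' : (0 < - n)%R by rewrite oppr_gt0.
  have [h1 h2] := pos (- n) v^-1 n0' (unitOV uv).
  have : rs ((pi ^ n * v) * (pi ^ (- n) * v^-1)) = 0 by rewrite resM // h2 mulr0.
  rewrite mulrACA -expfzDr // subrr expr0z mul1r divff ?res1; last exact: unitO_neq0 uv.
  by move/eqP; rewrite oner_eq0.
have [zneg|zpos|->] := ltrgtP z 0.
- have nz := neg z w zneg uw; split; split; rewrite /unitO ?(negbTE nz) //; try by case.
  by move=> e; rewrite e ltxx in zneg.
- have [h1 h2] := pos z w zpos uw; split; split; rewrite /unitO ?h2 ?eqxx //; try by case.
  by move=> e; rewrite e ltxx in zpos.
- rewrite expr0z mul1r; split; split=> //.
  by move=> [_ h]; rewrite h eqxx in w0.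
Qed.

Lemma unif_div L pi x : unif L pi -> x \in L -> x \in O -> rs x = 0 -> x / pi \in O.
Proof.
move=> [piO pir pi0 H] xL xO xr; have [->|x0] := eqVneq x 0; first by rewrite mul0r rpred0.
have [z [w [uw xe]]] := H x xL x0.
have [_ h _] := powz_sign z piO pir pi0 uw.
have zpos : (0 < z)%R by apply/h; rewrite -xe.
have -> : x / pi = pi ^ (z - 1) * w by rewrite xe mulrAC expfzDr // exprN1.
have [h' _ _] := powz_sign (z - 1) piO pir pi0 uw.
by apply/h'; rewrite subr_ge0 -gtz0_ge1.
Qed.
End AtPlace.
End Core.

(** * Extensions that preserve a uniformizer *)

Section Core.
Variables (p : nat) (A : idomainType) (E : closedFieldType) (j : {rmorphism A -> E}).
Hypothesis B : base_ring p j.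

Local Notation dv := (@dvdby A p).
Local Notation I := (intI j).
Local Notation place := (place p j).

Section AtPlace.
Variable P : place.
Local Notation O := (valO P).
Local Notation rs := (res P).

Lemma map_res_pv f' : map_poly rs (map_poly (pv P) f') = map_poly (pr P) f'.
Proof. by apply/polyP => i; rewrite (coef_map_id0 _ _ (res0 P)) !coef_map /= res_pv. Qed.

(** The function [res P] is not a ring morphism on E; identities for
    reductions of polynomials are derived from those of the morphisms [pv P]
    and [pr P]. *)
Lemma polyO_lift (f : {poly E}) : f \is a polyOver O -> exists f' : {poly pO P},
  f = map_poly (pv P) f' /\ map_poly rs f = map_poly (pr P) f'.
Proof.
move=> /polyOverP fO; have /choice[o Ho] : forall i, exists o, pv P o = f`_i.
  by move=> i; have /valOP[o [oz _]] := fO i; exists o.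
have fe : f = map_poly (pv P) (\poly_(i < size f) o i).
  apply/polyP => i; rewrite coef_map /= coef_poly; case: ltnP => h; first by rewrite Ho.
  by rewrite rmorph0 nth_default.
exists (\poly_(i < size f) o i); split=> //.
by rewrite {1}fe map_res_pv.
Qed.

Lemma res_horner f y : f \is a polyOver O -> y \in O -> rs f.[y] = (map_poly rs f).[rs y].
Proof.
move=> /polyO_lift[f' [-> ->]] /valOP[o [<- ->]].
by rewrite horner_map /= res_pv horner_map.
Qed.
Lemma res_polyM f g : f \is a polyOver O -> g \is a polyOver O ->
  map_poly rs (f * g) = map_poly rs f * map_poly rs g.
Proof.
move=> /polyO_lift[f' [-> ->]] /polyO_lift[g' [-> ->]].
by rewrite -(rmorphM (map_poly (pv P))) -(rmorphM (map_poly (pr P))) map_res_pv.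
Qed.
Lemma res_deriv f : f \is a polyOver O -> map_poly rs f^`() = (map_poly rs f)^`().
Proof.
move=> /polyO_lift[f' [-> ->]]; by rewrite !deriv_map map_res_pv.
Qed.
Lemma coef_res f i : (map_poly rs f)`_i = rs f`_i.
Proof. by rewrite (coef_map_id0 _ _ (res0 P)). Qed.

Lemma polyOver_LO (L : divringClosed E) f : f \is a polyOver L -> f \is a polyOver O ->
  map_poly rs f \is a polyOver (resfield P L).
Proof.
move=> /polyOverP fL /polyOverP fO; apply/polyOverP => i; rewrite coef_res.
exact: mem_resfield.
Qed.

Lemma lift_LO (L : divringClosed E) (g : {poly pk P}) : g \is a polyOver (resfield P L) ->
  exists f, [/\ f \is a polyOver L, f \is a polyOver O & map_poly rs f = g].
Proof.
move=> /polyOverP gL; have /choice[z Hz] : forall i, exists z, [/\ z \in L, z \in O & rs z = g`_i].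
  by move=> i; apply: resfieldP.
exists (\poly_(i < size g) z i); split.
- by apply: polyOver_poly => i _; case: (Hz i).
- by apply: polyOver_poly => i _; case: (Hz i).
apply/polyP => i; rewrite coef_res coef_poly; case: ltnP => h; first by case: (Hz i).
by rewrite res0 nth_default.
Qed.

Section Ext.
Variables (L : divringClosed E) (pi y : E).
Hypothesis jL : forall a, j a \in L.
Hypothesis uL : unif P L pi.
Hypothesis yO : y \in O.

(** Divided by its coefficient of least value, c reduces to a nonzero
    polynomial of degree less than q, which does not vanish at the residue of
    y by [purely_insep_indep]. So the value of c(y) is the least value of the
    coefficients of c. *)
Lemma fierce_rep (q a : nat) (c : {poly E}) i : q = (p ^ a)%N ->
  rs y ^+ q \in resfield P L -> (forall d, d \in resfield P L -> d ^+ p != rs y ^+ q) ->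
  c \is a polyOver L -> (size c <= q)%N -> c`_i != 0 -> (forall l, c`_l / c`_i \in O) ->
  unitO P (c.[y] / c`_i).
Proof.
move=> qe yq yn cL sc ci cO.
pose c' := (c`_i)^-1 *: c.
have e : c.[y] / c`_i = c'.[y] by rewrite hornerZ mulrC.
have c'O : c' \is a polyOver O by apply/polyOverP => l; rewrite coefZ mulrC.
have c'L : c' \is a polyOver L.
  by apply/polyOverP => l; rewrite coefZ rpredM ?rpredV //; move/polyOverP: cL; apply.
rewrite e; split; first exact: rpred_horner.
rewrite res_horner //; rewrite qe in yq yn; apply: (purely_insep_indep (pk_pchar B P) yq yn).
- exact: polyOver_LO.
- apply/eqP => /(congr1 (fun u : {poly _} => u`_i)); rewrite coef_res coefZ mulVf // res1 coef0.
  by move/eqP; rewrite oner_eq0.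
- rewrite -qe; apply: leq_trans (size_poly _ _) _; apply: leq_trans sc.
  exact: size_scale_leq.
Qed.

(** The residue extension has degree q, which is also the degree of f, so that
    the value group does not change. *)
Lemma fierce_unif (q a : nat) (f : {poly E}) : q = (p ^ a)%N ->
  rs y ^+ q \in resfield P L -> (forall d, d \in resfield P L -> d ^+ p != rs y ^+ q) ->
  f \is a polyOver L -> size f = q.+1 -> f.[y] = 0 -> unif P (adj B jL y) pi.
Proof.
move=> qe yq yn fL sf fy; have [piO pir pi0 H] := uL; split=> // x xA x0.
have f0 : f != 0 by rewrite -size_poly_gt0 sf.
have [c [cL sc xe]] := adj_red fL f0 fy xA.
rewrite sf ltnS in sc.
have [|i [ilt ci cO]] := @val_min _ _ _ _ P (size c) (fun i => c`_i).
  exists (size c).-1; last first.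
    rewrite -lead_coefE lead_coef_eq0; apply: contraNneq x0 => c0.
    by rewrite xe c0 horner0.
  rewrite ltn_predL size_poly_gt0; apply: contraNneq x0 => c0.
  by rewrite xe c0 horner0.
have cO' l : c`_l / c`_i \in O.
  by case: (ltnP l (size c)) => h; [apply: cO|rewrite nth_default // mul0r rpred0].
have u := fierce_rep qe yq yn cL sc ci cO'.
have -> : x = c`_i * (c.[y] / c`_i) by rewrite xe mulrC divfK.
apply: powuM => //; last exact: powu_unit.
by apply: H => //; move/polyOverP: cL; apply.
Qed.

Hypothesis piL : pi \in L.

(** Let h be the minimal polynomial of the residue of y over the residue field
    of L. The reduction of f is h g with g nonzero at the residue of y; let G
    lift g. If c(y) has residue 0, then the reduction of c is h d for some d;
    if D lifts d, then c G - D f has coefficients of residue 0 and value c(y)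
    G(y) at y, where G(y) is a unit: so c(y) is a multiple of pi. Repeating
    this extracts powers of pi from c(y), and stops at a unit because of
    [p_finite]. *)
Lemma etale_unif (f : {poly E}) : f \is a polyOver L -> f \is a polyOver O ->
  f.[y] = 0 -> rs f^`().[y] != 0 -> unif P (adj B jL y) pi.
Proof.
move=> fL fO fy f'y; have [piO pir pi0 H] := uL.
pose K := resfield P L; pose yb := rs y.
have f'O : f^`() \is a polyOver O by apply: polyOver_deriv.
have fbK : map_poly rs f \is a polyOver K by apply: polyOver_LO.
have f'b : (map_poly rs f)^`().[yb] != 0 by rewrite -res_deriv // -res_horner.
have fb0 : map_poly rs f != 0 by apply: contraNneq f'b => ->; rewrite linear0 horner0.
have fby : (map_poly rs f).[yb] = 0 by rewrite -res_horner // fy res0.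
have [n [h [hK h0 hy sh]] nmin] : exists2 n, exists g, [/\ g \is a polyOver K, g != 0, root g yb & size g = n] &
   forall g, g \is a polyOver K -> g != 0 -> root g yb -> (n <= size g)%N.
  pose R n := `[< exists g, [/\ g \is a polyOver K, g != 0, root g yb & size g = n] >].
  have exR : exists n, R n.
    by exists (size (map_poly rs f)); apply/asboolP; exists (map_poly rs f); split=> //; apply/rootP.
  case: (ex_minnP exR) => n /asboolP Rn nmin; exists n => // g gK g0 gy.
  by apply: nmin; apply/asboolP; exists g.
have hdvd c : c \is a polyOver K -> c.[yb] = 0 -> exists2 d, d \is a polyOver K & c = h * d.
  move=> cK cy; exists (c %/ h); first by rewrite polyOver_divp.
  have e := divp_eq c h.
  suff r0 : c %% h = 0 by rewrite {1}e r0 addr0 mulrC.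
  apply/eqP; apply: contraT => r0.
  have := nmin (c %% h) (polyOver_modp cK hK) r0 _.
  rewrite leqNgt -sh ltn_modp h0; apply.
  move: (congr1 (fun u => u.[yb]) e); rewrite cy hornerD hornerM (rootP hy) mulr0 add0r => e'.
  by apply/rootP.
have [g gK fg] := hdvd _ fbK fby.
have gy : g.[yb] != 0.
  by move: f'b; rewrite fg derivM hornerD !hornerM (rootP hy) mul0r addr0 mulf_eq0 negb_or => /andP[].
have [G [GL GO Gg]] := lift_LO gK.
have uG : unitO P G.[y].
  by split; [apply: rpred_horner|rewrite res_horner // Gg].
have step c : c \is a polyOver L -> c \is a polyOver O -> rs c.[y] = 0 ->
   exists c1, [/\ c1 \is a polyOver L, c1 \is a polyOver O & c.[y] * G.[y] = pi * c1.[y]].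
  move=> cL cO cy; have [|d dK cd] := hdvd (map_poly rs c) (polyOver_LO cL cO).
    by rewrite -res_horner.
  have [D [DL DO Dd]] := lift_LO dK.
  pose t := c * G - D * f.
  have tL : t \is a polyOver L by rewrite rpredB ?rpredM.
  have tO : t \is a polyOver O by rewrite rpredB ?rpredM.
  have tr i : rs t`_i = 0.
    have h1 : (c * G)`_i \in O by move/polyOverP: (rpredM cO GO); apply.
    have h2 : (D * f)`_i \in O by move/polyOverP: (rpredM DO fO); apply.
    rewrite coefB resB // -!coef_res !res_polyM // Gg Dd cd fg.
    by rewrite (_ : h * d * g = d * (h * g)) ?subrr //; ring.
  exists (pi^-1 *: t); split.
  - by apply/polyOverP => i; rewrite coefZ rpredM ?rpredV //; move/polyOverP: tL; apply.
  - apply/polyOverP => i; rewrite coefZ mulrC; apply: (unif_div uL) => //.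
      by move/polyOverP: tL; apply.
    by move/polyOverP: tO; apply.
  - by rewrite hornerZ mulrA divff // mul1r hornerD hornerN !hornerM fy mulr0 subr0.
have main c : c \is a polyOver L -> c \is a polyOver O -> c.[y] != 0 -> powu P pi c.[y].
  move=> cL cO cy0; apply: contrapT => npow.
  (* If c(y) is not a power of pi up to a unit, it is divisible by all powers
     of pi. *)
  have iter n1 : exists c1 w, [/\ c1 \is a polyOver L, c1 \is a polyOver O, unitO P w & c.[y] * w = pi ^+ n1 * c1.[y]].
    elim: n1 => [|n0 [c1 [w [c1L c1O uw e]]]].
      by exists c, 1; split=> //; [exact: unitO1|rewrite mulr1 mul1r].
    have c1r : rs c1.[y] = 0.
      have [//|u1] : rs c1.[y] = 0 \/ unitO P c1.[y] by apply: unitOP; apply: rpred_horner.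
      exfalso; apply: npow; exists (n0 : int), (c1.[y] / w); split; first by apply: unitOM => //; apply: unitOV.
      by rewrite -exprnP mulrA -e mulfK // (unitO_neq0 uw).
    have [c2 [c2L c2O e2]] := step c1 c1L c1O c1r.
    exists c2, (w * G.[y]); split=> //; first exact: unitOM.
    by rewrite mulrA e -mulrA e2 mulrA -exprSr.
  have pL : (p%:R : E) \in L by rewrite rpred_nat.
  have [z [w [uw pe]]] := H _ pL (p_neq0 B).
  have [_ zs _] := powz_sign z piO pir pi0 uw.
  have z0 : (0 < z)%R.
    by apply/zs; rewrite -pe; split; [apply: valO_int; rewrite rpred_nat|exact: res_p].
  case: z {zs} z0 pe => [e|e] // _ pe; rewrite -exprnP in pe.
  have [k] := p_finite B P cy0; case/negP.
  have [c1 [v [c1L c1O uv ev]]] := iter (e * k)%N.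
  have -> : c.[y] / p%:R ^+ k = c1.[y] / v / w ^+ k.
    have v0 := unitO_neq0 uv; have w0 := expf_neq0 k (unitO_neq0 uw).
    have pk0 := expf_neq0 (e * k) pi0.
    rewrite pe exprMn -exprM invfM.
    have -> : c.[y] = pi ^+ (e * k) * c1.[y] / v by rewrite -ev mulfK.
    by field; rewrite v0 pk0 w0.
  apply: rpredM; last by case: (unitOV (unitOX k uw)).
  by apply: rpredM; [apply: rpred_horner|case: (unitOV uv)].
split=> // x /adjP[c cL xe] x0.
have c0 : c != 0 by apply: contraNneq x0 => c0; rewrite xe c0 horner0.
have [|i [ilt ci cO]] := @val_min _ _ _ _ P (size c) (fun i => c`_i).
  by exists (size c).-1; rewrite ?ltn_predL ?size_poly_gt0 // -lead_coefE lead_coef_eq0.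
have cO' l : c`_l / c`_i \in O.
  by case: (ltnP l (size c)) => has_lead; [apply: cO|rewrite nth_default // mul0r rpred0].
have ciL : c`_i \in L by move/polyOverP: cL; apply.
have e : x = c`_i * ((c`_i)^-1 *: c).[y] by rewrite hornerZ mulrA divff // mul1r.
rewrite e; apply: powuM => //; first exact: H.
apply: main.
- by apply/polyOverP => l; rewrite coefZ rpredM ?rpredV //; move/polyOverP: cL; apply.
- by apply/polyOverP => l; rewrite coefZ mulrC.
- by apply: contraNneq x0 => e0; rewrite e e0 mulr0.
Qed.

End Ext.

Lemma root_valO m (w z : E) : (0 < m)%N -> z ^+ m = w -> w \in O -> z \in O.
Proof.
move=> m0 zw wO; apply: contraT => /valO_out[z0 zO zr].
have : rs (w * z^-1 ^+ m) = 0 by rewrite resM ?rpredX // resX // zr expr0n eqn0Ngt m0 mulr0.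
rewrite -zw exprVn divff ?expf_neq0 // res1 => /eqP.
by rewrite oner_eq0.
Qed.

(** The terms c_i z^i with i < m have values that are distinct modulo m times
    the value of z, so the value of their sum is the least of them. *)
Lemma ram_unif (L : divringClosed E) (jL : forall a, j a \in L) (w z : E) m : (0 < m)%N ->
  unif P L w -> w \in L -> z ^+ m = w -> unif P (adj B jL z) z.
Proof.
move=> m0 [wO wr w0 H] wL zw.
have zO : z \in O by apply: root_valO zw wO.
have zr : rs z = 0.
  by apply/eqP; have := wr; rewrite -zw resX // => /eqP; rewrite expf_eq0 => /andP[].
have z0 : z != 0 by apply: contraNneq w0 => h; rewrite -zw h expr0n eqn0Ngt m0.
split=> // x xA x0.
pose f : {poly E} := 'X^m - w%:P.
have fL : f \is a polyOver L by rewrite polyOverXnsubC.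
have sf : size f = m.+1 by rewrite size_XnsubC.
have f0 : f != 0 by rewrite -size_poly_gt0 sf.
have fz : f.[z] = 0 by rewrite !hornerE zw subrr.
have [c [cL sc xe]] := adj_red fL f0 fz xA.
rewrite sf ltnS in sc.
pose t i := c`_i * z ^+ i.
have xt : x = \sum_(i < m) t i by rewrite xe (horner_coef_wide _ sc).
have tpow i : t i != 0 -> exists (k : int) u, unitO P u /\ t i = z ^ (k * m%:Z + i%:Z) * u.
  move=> ti0; have ci0 : c`_i != 0 by apply: contraNneq ti0 => h; rewrite /t h mul0r.
  have [k [u [uu e]]] := H _ (polyOverP cL i) ci0.
  exists k, u; split=> //.
  by rewrite /t e -zw (exprnP z m) exprz_exp expfzDr // -exprnP [k * _]mulrC mulrAC.
have [|i [im ti tO]] := @val_min _ _ _ _ P m t.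
  apply: contrapT => H'; case/eqP: x0; rewrite xt big1 // => i _; apply/eqP; apply: contraT => ti.
  by exfalso; apply: H'; exists i.
have tr l : (l < m)%N -> l != i -> t l / t i \in O /\ rs (t l / t i) = 0.
  move=> lm li; have h := tO l lm; split=> //.
  have [tl0|tl0] := eqVneq (t l) 0; first by rewrite tl0 mul0r res0.
  have [k [u [uu e]]] := tpow l tl0; have [k' [u' [uu' e']]] := tpow i ti.
  have e2 : t l / t i = z ^ ((k - k') * m%:Z + (l%:Z - i%:Z)) * (u / u').
    have -> : (k - k') * m%:Z + (l%:Z - i%:Z) = (k * m%:Z + l%:Z) + - (k' * m%:Z + i%:Z) by ring.
    rewrite expfzDr // -invr_expz e e' invfM mulrACA //.
  have uuu : unitO P (u / u') by apply: unitOM => //; apply: unitOV.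
  have [h1 h2 _] := powz_sign ((k - k') * m%:Z + (l%:Z - i%:Z)) zO zr z0 uuu.
  rewrite e2; suff : (0 < (k - k') * m%:Z + (l%:Z - i%:Z))%R by move/h2 => [].
  rewrite lt_def; apply/andP; split; last by apply/h1; rewrite -e2.
  apply/eqP => e0; case/negP: li.
  have e1 : l%:Z = i%:Z - (k - k') * m%:Z by rewrite -[LHS]subr0 -e0; ring.
  have := congr1 (fun u => (u %% m%:Z)%Z) e1.
  rewrite -mulNr addrC modzMDl !modz_nat !modn_small // => -[->]; exact: eqxx.
have u1 : unitO P (x / t i).
  rewrite xt mulr_suml (bigD1 (Ordinal im)) //= divff //.
  have h (l : 'I_m) : l != Ordinal im -> t l / t i \in O /\ rs (t l / t i) = 0.
    by move=> nl; apply: tr.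
  have hO : \sum_(l < m | l != Ordinal im) t l / t i \in O.
    by apply: rpred_sum => l nl; case: (h l nl).
  split; first by rewrite rpredD ?rpred1.
  rewrite resD ?rpred1 // res1 res_sum; last by move=> l nl; case: (h l nl).
  by rewrite big1 ?addr0 ?oner_neq0 // => l nl; case: (h l nl).
have -> : x = t i * (x / t i) by rewrite mulrC divfK.
apply: powuM => //; last exact: powu_unit.
by have [k [u [uu e]]] := tpow i ti; exists (k * m%:Z + i%:Z), u.
Qed.

Lemma unif_scale (L : divringClosed E) (pi u : E) : unif P L pi -> unitO P u -> unif P L (pi * u).
Proof.
move=> [piO pir pi0 H] uu; have [uO u0] := uu.
split; first exact: rpredM.
- by rewrite resM // pir mul0r.
- by rewrite mulf_neq0 // (unitO_neq0 uu).
move=> x xL x0; have [z [w [uw ->]]] := H x xL x0.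
exists z, (w * u ^ (- z)); split.
  apply: unitOM => //; case: (- z) => n; rewrite ?NegzE -?exprnP.
    exact: unitOX.
  by rewrite -invr_expz; apply: unitOV; apply: unitOX.
rewrite expfzMl mulrACA -invr_expz [u ^ z * _]divff ?mulr1 //.
by rewrite expfz_neq0 // (unitO_neq0 uu).
Qed.

End AtPlace.
End Core.

(** * Fields of finite degree have finitely many places *)

Section FractionRep.
Local Open Scope quotient_scope.
Lemma fraction_rep (A : idomainType) (z : {fraction A}) :
  exists n d : A, d != 0 /\ z * FracField.tofrac d = FracField.tofrac n.
Proof.
rewrite -[z]reprK; move: (repr z) => r; exists (frac r).1, (frac r).2.
split; first exact: denom_ratioP.
have d0 := denom_ratioP r.
unlock FracField.tofrac.
rewrite -[LHS]FracField.pi_mul; apply/eqP; rewrite FracField.equivf_def.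
rewrite /FracField.mulf /= !numden_Ratio ?mulr1 ?oner_neq0 ?mulf_neq0 //.
by rewrite mulrC.
Qed.
End FractionRep.

(** Over the fraction field there are more unknowns than equations, and
    denominators can be cleared. *)
Lemma left_kernel (A : idomainType) (m n : nat) (C : nat -> nat -> A) : (n < m)%N ->
  exists c : nat -> A, (exists2 i, (i < m)%N & c i != 0) /\
    forall k, (k < n)%N -> \sum_(i < m) c i * C i k = 0.
Proof.
move=> nm.
pose M : 'M[{fraction A}]_(m, n) := \matrix_(i, k) FracField.tofrac (C i k).
have : kermx M != 0.
  rewrite -mxrank_eq0 mxrank_ker -lt0n subn_gt0.
  by apply: leq_ltn_trans nm; exact: rank_leq_col.
case/rowV0Pn => v /sub_kermxP vM v0.
have /fin_all_exists[nu Hnu] : forall i : 'I_m, exists nu : A * A, nu.2 != 0 /\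
     v 0 i * FracField.tofrac nu.2 = FracField.tofrac nu.1.
  by move=> i; have [a [d [d0 e]]] := fraction_rep (v 0 i); exists (a, d).
pose D := \prod_i (nu i).2.
have D0 : D != 0 by apply/prodf_neq0 => i _; case: (Hnu i).
pose c0 (i : 'I_m) := (nu i).1 * \prod_(l | l != i) (nu l).2.
have c0e i : v 0 i * FracField.tofrac D = FracField.tofrac (c0 i).
  rewrite /D (bigD1 i) //= !tofracM mulrA; case: (Hnu i) => _ ->; by [].
pose c i := if insub i is Some i' then c0 i' else 0.
have cE (i : 'I_m) : c i = c0 i by rewrite /c valK.
exists c; split.
  have [i vi] : exists i, v 0 i != 0.
    apply: contrapT => H; case/eqP: v0; apply/rowP => i; rewrite mxE; apply/eqP.
    by apply: contraT => h; exfalso; apply: H; exists i.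
  exists i => //; rewrite cE -(tofrac_eq0) -c0e mulf_neq0 // tofrac_eq0 //.
move=> k kn; apply/eqP; rewrite -tofrac_eq0 rmorph_sum /=; apply/eqP.
transitivity ((v *m M) 0 (Ordinal kn) * FracField.tofrac D); last by rewrite vM mxE mul0r.
rewrite mxE mulr_suml; apply: eq_bigr => i _.
by rewrite mxE rmorphM /= cE -c0e mulrAC.
Qed.

Section Core.
Variables (p : nat) (A : idomainType) (E : closedFieldType) (j : {rmorphism A -> E}).
Hypothesis B : base_ring p j.

Local Notation dv := (@dvdby A p).
Local Notation I := (intI j).
Local Notation place := (place p j).

(** Linear span over the fraction field of A, with a common denominator
    cleared. *)
Definition Span (s : seq E) (x : E) := exists d (c : nat -> A), d != 0 /\ j d * x = \sum_(i < size s) j (c i) * s`_i.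

Lemma span0 s : Span s 0.
Proof.
exists 1, (fun=> 0); rewrite oner_neq0 mulr0 big1 // => i _.
by rewrite rmorph0 mul0r.
Qed.
Lemma spanD s x y : Span s x -> Span s y -> Span s (x + y).
Proof.
move=> [d [c [d0 e]]] [d' [c' [d0' e']]]; exists (d * d'), (fun i => d' * c i + d * c' i).
split; first by rewrite mulf_neq0.
rewrite rmorphM mulrDr mulrAC e -mulrA e' mulr_suml mulr_sumr -big_split /=.
by apply: eq_bigr => i _; rewrite rmorphD !rmorphM; ring.
Qed.
Lemma spanZ s a x : Span s x -> Span s (j a * x).
Proof.
move=> [d [c [d0 e]]]; exists d, (fun i => a * c i); split=> //.
by rewrite mulrCA e mulr_sumr; apply: eq_bigr => i _; rewrite rmorphM mulrA.
Qed.
Lemma span_div s a x : a != 0 -> Span s (j a * x) -> Span s x.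
Proof.
move=> a0 [d [c [d0 e]]]; exists (d * a), c; rewrite mulf_neq0 //; split=> //.
by rewrite rmorphM -mulrA.
Qed.
Lemma span_mem s x : x \in s -> Span s x.
Proof.
move=> xs; exists 1, (fun i => (i == index x s)%:R); rewrite oner_neq0 rmorph1 mul1r; split=> //.
have lt : (index x s < size s)%N by rewrite index_mem.
rewrite (bigD1 (Ordinal lt)) //= eqxx rmorph1 mul1r nth_index // big1 ?addr0 // => i.
by rewrite -(inj_eq val_inj) /= => /negbTE ->; rewrite rmorph0 mul0r.
Qed.
Lemma span_sum s (T : Type) (r : seq T) (P : pred T) F :
  (forall i, P i -> Span s (F i)) -> Span s (\sum_(i <- r | P i) F i).
Proof. by move=> H; apply: big_ind => //; [exact: span0|exact: spanD]. Qed.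

Definition finite_over (M : {pred E}) := exists s, forall x, x \in M -> Span s x.

(** The relation given by [left_kernel] is made primitive by [min_split]. *)
Lemma span_dep s (x : nat -> E) m : (size s < m)%N -> (forall i, (i < m)%N -> Span s (x i)) ->
  exists c : nat -> A, (exists2 i, (i < m)%N & ~ dv (c i)) /\ \sum_(i < m) j (c i) * x i = 0.
Proof.
move=> sm xs.
have /choice[dc Hdc] : forall i, exists dc : A * (nat -> A), (i < m)%N -> dc.1 != 0 /\
   j dc.1 * x i = \sum_(k < size s) j (dc.2 k) * s`_k.
  move=> i; have [lt|] := boolP (i < m)%N; last by exists (1, fun=> 0).
  by have [d [c H]] := xs i lt; exists (d, c).
have [c [[i im ci] Hc]] := left_kernel (fun i k => (dc i).2 k) sm.
pose c1 i := c i * (dc i).1.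
have [|k [c2 [H1 [l lm nl]]]] := @min_split _ _ _ _ B m c1.
  by exists i => //; rewrite mulf_neq0 //; case: (Hdc i im).
exists c2; split; first by exists l.
have pk0 : j (p%:R ^+ k) != 0 by rewrite (j0 B) expf_neq0 // (br_p0 B).
apply: (mulfI pk0); rewrite mulr0 mulr_sumr.
transitivity (\sum_(i < m) j (c i) * (j (dc i).1 * x i)).
  by apply: eq_bigr => h _; rewrite [LHS]mulrA -[in LHS]rmorphM -(H1 h) // [RHS]mulrA -rmorphM.
transitivity (\sum_(i < m) \sum_(h < size s) j (c i * (dc i).2 h) * s`_h).
  apply: eq_bigr => h _; case: (Hdc h (ltn_ord h)) => _ ->; rewrite mulr_sumr.
  by apply: eq_bigr => g _; rewrite mulrA rmorphM.
rewrite exchange_big big1 //= => h _.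
by rewrite -mulr_suml -rmorph_sum Hc // rmorph0 mul0r.
Qed.

Lemma finite_over_adj (M : divringClosed E) (jM : forall a, j a \in M) (y : E) : finite_over M -> finite_over (adj B jM y).
Proof.
move=> [s Hs]; have [f f0 fy] := br_alg B y.
pose s' := [seq b * y ^+ l | b <- s, l <- iota 0 (size f)].
exists s' => x xA.
have fM : map_poly j f \is a polyOver M by apply/polyOverP => i; rewrite coef_map; apply: jM.
have mf0 : map_poly j f != 0 by rewrite (map_poly_eq0_id0) // (j0 B) lead_coef_eq0.
have [c [cM sc ->]] := adj_red fM mf0 (rootP fy) xA.
rewrite horner_coef; apply: span_sum => l _.
have ll : (l < size f)%N.
  by apply: leq_trans (ltn_ord l) _; apply: ltnW; apply: leq_trans sc _; exact: size_poly.
have [d [a [d0 e]]] := Hs _ (polyOverP cM l).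
apply: (span_div d0); rewrite mulrA e mulr_suml; apply: span_sum => k _.
rewrite -mulrA; apply: spanZ; apply: span_mem; apply/allpairsP.
by exists (s`_k, l : nat); rewrite mem_nth // mem_iota add0n ll.
Qed.

Definition center_sub (M : {pred E}) (P P' : place) := forall x, x \in M -> x \in I -> res P x = 0 -> res P' x = 0.
(** P and P' induce the same prime on the ring of integral elements of M. *)
Definition same_center (M : {pred E}) (P P' : place) := forall x, x \in M -> x \in I -> res P x = 0 <-> res P' x = 0.

Lemma same_center_sym M P P' : same_center M P P' -> same_center M P' P.
Proof. by move=> h x xM xI; have [h1 h2] := h x xM xI; split. Qed.
Lemma same_center_trans M P P' P'' : same_center M P P' -> same_center M P' P'' -> same_center M P P''.
Proof.
by move=> h h' x xM xI; have [h1 h2] := h x xM xI; have [h3 h4] := h' x xM xI; split=> [/h1/h3|/h4/h2].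
Qed.

(** There is no inclusion between distinct primes over pA. If x has residue 0
    at P' but not at P, consider a polynomial f with f(x) of residue 0 at P,
    hence at P'. Then its constant coefficient is divisible by p, and as x is
    a unit at P the quotient (f - f_0) / X also takes at x a value of residue
    0 at P. So all the coefficients of f are divisible by p, which is absurd
    for a monic relation of x. *)
Lemma center_sub_same (M : subringClosed E) (jM : forall a, j a \in M) P P' : center_sub M P P' -> same_center M P P'.
Proof.
move=> le x xM xI; split; first exact: le.
move=> x'0; apply/eqP; apply: contraT => x0.
have /intIP[f fm fx] := xI.
have nf : exists i, ~ dv f`_i.
  by exists (size f).-1; rewrite -lead_coefE (monicP fm); exact: (br_p1 B).
have {fx} : res P (map_poly j f).[x] = 0 by rewrite (rootP fx) res0.
elim: (size f) {-2}f (leqnn (size f)) nf => [|n IH] {fm}{}f sf [i ni] fx.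
  by case: ni; rewrite nth_default; [exact: dv0|apply: leq_trans sf _].
pose g := drop_poly 1 f.
have fe : (map_poly j f).[x] = j f`_0 + (map_poly j g).[x] * x.
  rewrite -[in LHS](poly_take_drop 1 f) rmorphD rmorphM /= map_polyXn hornerD hornerM hornerXn expr1.
  by rewrite (size1_polyC (size_take_poly _ _)) map_polyC hornerC coef_take_poly.
have mI (h : {poly A}) : (map_poly j h).[x] \in I.
  by apply: rpred_horner => //; apply/polyOverP => l; rewrite coef_map int_j.
have mM (h : {poly A}) : (map_poly j h).[x] \in M.
  by apply: rpred_horner => //; apply/polyOverP => l; rewrite coef_map jM.
have mO (Q : place) (h : {poly A}) : (map_poly j h).[x] \in valO Q by apply: valO_int; apply: mI.
have xO (Q : place) : x \in valO Q by apply: valO_int.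
have f'x := le _ (mM f) (mI f) fx.
have f0' : dv f`_0.
  apply/(res_j P'); move: f'x; rewrite fe resD ?valO_j //; last by apply: rpredM; [exact: mO|exact: xO].
  rewrite resM; [|exact: mO|exact: xO]; rewrite x'0 mulr0 addr0.
  by [].
have gx : res P (map_poly j g).[x] = 0.
  move: fx; rewrite fe resD ?valO_j //; last by apply: rpredM; [exact: mO|exact: xO].
  rewrite resM; [|exact: mO|exact: xO].
  have -> : res P (j f`_0) = 0 by apply/res_j.
  by rewrite add0r => /eqP; rewrite mulf_eq0 (negbTE x0) orbF => /eqP.
apply: (IH g _ _ gx).
  by rewrite size_drop_poly leq_subLR add1n.
case: i ni => [|i] ni; first by [].
by exists i; rewrite coef_drop_poly addn1.
Qed.

Lemma centers_separated (M : subringClosed E) (jM : forall a, j a \in M) P P' : ~ same_center M P P' ->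
  exists x, [/\ x \in M, x \in I, res P x = 0 & res P' x != 0].
Proof.
move=> ne; apply: contrapT => H; apply: ne; apply: center_sub_same => // x xM xI xP.
by apply/eqP; apply: contraT => h; exfalso; apply: H; exists x.
Qed.

Section Compare.
Variables (M : divringClosed E) (P P' : place).
Hypotheses (jM : forall a, j a \in M) (PP' : same_center M P P').

Lemma same_center_unit z : z \in M -> unitO P z -> unitO P' z.
Proof.
move=> zM [zO z0]; have [b [s [bM bI sM sI [s0 ze]]]] := frac_rep B jM zM zO.
have sO := valO_int P sI; have bO := valO_int P bI.
have s'0 : res P' s != 0 by apply: contraNneq s0 => h; apply/eqP/PP'.
have b0 : res P b != 0.
  have sn : s != 0 by apply: contraNneq s0 => ->; rewrite res0.
  by rewrite (_ : b = z * s) ?resM ?mulf_neq0 // ze divfK.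
have b'0 : res P' b != 0 by apply: contraNneq b0 => h; apply/eqP/PP'.
rewrite ze; apply: unitOM; first by split=> //; apply: valO_int.
by apply: unitOV; split=> //; apply: valO_int.
Qed.

Lemma same_center_valO z : z \in M -> z \in valO P -> z \in valO P'.
Proof.
move=> zM zO; have [b [s [bM bI sM sI [s0 ze]]]] := frac_rep B jM zM zO.
rewrite ze; apply: rpredM; first exact: valO_int.
have s'0 : res P' s != 0 by apply: contraNneq s0 => h; apply/eqP/PP'.
by case: (valO_inv (valO_int P' sI) s'0).
Qed.
End Compare.

(** Otherwise [int_of_places] applies to 1 / p, and normality contradicts the
    primality of p. *)
Lemma place_inh : exists P : place, True.
Proof.
apply: contrapT => H; have [|a na aI] := @int_of_places _ _ _ _ B (p%:R)^-1.
  by move=> P; exfalso; apply: H; exists P.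
apply: na; have [|x xe] := @br_nor _ _ _ _ B p%:R a (br_p0 B); last by exists x.
by rewrite rmorph_nat; apply/(intIP j).
Qed.

(** The element q_i is a product over the other places P_l of elements that
    vanish at P_l but not at P_i. *)
Lemma places_separated (M : subringClosed E) (jM : forall a, j a \in M) n (Ps : nat -> place) :
  (forall i l, (i < n)%N -> (l < n)%N -> i != l -> ~ same_center M (Ps i) (Ps l)) ->
  exists q : nat -> E, forall i, (i < n)%N -> [/\ q i \in M, q i \in I, res (Ps i) (q i) != 0 &
     forall l, (l < n)%N -> l != i -> res (Ps l) (q i) = 0].
Proof.
move=> ne.
have /choice[x Hx] : forall il : nat * nat, exists x, (il.1 < n)%N -> (il.2 < n)%N -> il.2 != il.1 ->
   [/\ x \in M, x \in I, res (Ps il.2) x = 0 & res (Ps il.1) x != 0].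
  move=> [i l] /=; have [h|h] := pselect [/\ (i < n)%N, (l < n)%N & l != i]; last first.
    by exists 0 => h1 h2 h3; exfalso; apply: h.
  by case: h => h1 h2 h3; have [x hx] := centers_separated jM (ne l i h2 h1 h3); exists x.
exists (fun i => \prod_(l < n | (l : nat) != i) x (i, l : nat)) => i lt.
have H (l : 'I_n) : (l : nat) != i -> [/\ x (i, l : nat) \in M, x (i, l : nat) \in I,
   res (Ps l) (x (i, l : nat)) = 0 & res (Ps i) (x (i, l : nat)) != 0] by move=> h; exact: (Hx (i, l : nat) lt (ltn_ord l) h).
have inI : \prod_(l < n | (l : nat) != i) x (i, l : nat) \in I.
  by apply: rpred_prod => l /H[].
split=> //.
- by apply: rpred_prod => l /H[].
- have : unitO (Ps i) (\prod_(l < n | (l : nat) != i) x (i, l : nat)).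
    apply: (big_ind (unitO (Ps i))); [exact: unitO1|exact: unitOM|move=> l /H[_ xI _ x0]].
    by split=> //; apply: valO_int.
  by case.
- move=> l ln li; rewrite (bigD1 (Ordinal ln)) //= resM.
  + by case: (H (Ordinal ln) li) => _ _ -> _; rewrite mul0r.
  + by apply: valO_int; case: (H (Ordinal ln) li).
  + by apply: valO_int; apply: rpred_prod => h /andP[/H[]].
Qed.

(** The separating elements q_i are linearly independent over A: in a
    primitive relation, the residue at P_i of the relation gives a coefficient
    c_i divisible by p for each i. *)
Lemma places_bounded (M : subringClosed E) (jM : forall a, j a \in M) s n (Ps : nat -> place) :
  (forall x, x \in M -> Span s x) ->
  (forall i l, (i < n)%N -> (l < n)%N -> i != l -> ~ same_center M (Ps i) (Ps l)) -> (n <= size s)%N.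
Proof.
move=> Ms ne; rewrite leqNgt; apply/negP => sn.
have [q Hq] := places_separated jM ne.
have [|c [[i im ni] e]] := @span_dep s q n sn.
  by move=> i lt; apply: Ms; case: (Hq i lt).
have : res (Ps i) (\sum_(l < n) j (c l) * q l) = 0 by rewrite e res0.
have qO (l : 'I_n) : q l \in valO (Ps i) by apply: valO_int; case: (Hq l (ltn_ord l)).
rewrite res_sum; last by move=> l _; rewrite rpredM ?valO_j.
rewrite (bigD1 (Ordinal im)) //= big1 ?addr0; last first.
  move=> l li; rewrite resM ?valO_j //.
  case: (Hq l (ltn_ord l)) => _ _ _ H; rewrite H ?mulr0 // eq_sym.
  by move: li; rewrite -(inj_eq val_inj).
rewrite resM ?valO_j //; last exact: (qO (Ordinal im)).
move/eqP; rewrite mulf_eq0; case: (Hq i im) => _ _ /negbTE -> _; rewrite orbF => /eqP.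
by move/res_j.
Qed.

Lemma places_finite (M : subringClosed E) (jM : forall a, j a \in M) : finite_over M ->
  exists n (Ps : nat -> place),
   (forall i l, (i < n)%N -> (l < n)%N -> i != l -> ~ same_center M (Ps i) (Ps l)) /\
   forall P, exists2 i, (i < n)%N & same_center M P (Ps i).
Proof.
move=> [s Ms]; apply: contrapT => H.
have [P0 _] := place_inh.
have : forall n, exists Ps : nat -> place,
   forall i l, (i < n)%N -> (l < n)%N -> i != l -> ~ same_center M (Ps i) (Ps l).
  elim=> [|n [Ps HPs]]; first by exists (fun=> P0).
  have [P HP] : exists P, forall i, (i < n)%N -> ~ same_center M P (Ps i).
    apply: contrapT => H'; apply: H; exists n, Ps; split=> // P.
    apply: contrapT => nP; apply: H'; exists P => i lt h; apply: nP; by exists i.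
  exists (fun i => if i == n then P else Ps i) => i l; rewrite !ltnS (leq_eqVlt i n) (leq_eqVlt l n).
  have [->|ni] := eqVneq i n; have [->|nl] := eqVneq l n => //=.
  - by move=> _ lt _; apply: HP.
  - by move=> lt _ _ h; apply: (HP _ lt); apply: same_center_sym.
  - by move=> h1 h2 h3; apply: HPs.
move=> /(_ (size s).+1)[Ps HPs].
by have := places_bounded jM Ms HPs; rewrite ltnn.
Qed.

End Core.

(** * Fields of finite degree: uniformizers, residue fields, units *)

Lemma pchar_sub_pow (p : nat) (k : fieldType) (pk : p \in [pchar k]) (x y : k) n :
  (x - y) ^+ (p ^ n) = x ^+ (p ^ n) - y ^+ (p ^ n).
Proof.
have pp : prime p by case/andP: pk.
have pn : [pchar k].-nat (p ^ n)%N.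
  have e0 : [pchar k] =i (p : nat_pred) by move=> q; rewrite (pcharf_eq pk).
  by rewrite (eq_pnat _ e0) pnatX pnat_id ?orbT.
by rewrite exprDn_pchar // exprNn_pchar.
Qed.

Lemma pchar_sum_pow (p : nat) (k : fieldType) (pk : p \in [pchar k]) n m (F : nat -> k) :
  (\sum_(i < m) F i) ^+ (p ^ n) = \sum_(i < m) F i ^+ (p ^ n).
Proof.
have pp : prime p by case/andP: pk.
have pn : [pchar k].-nat (p ^ n)%N.
  have e0 : [pchar k] =i (p : nat_pred) by move=> q; rewrite (pcharf_eq pk).
  by rewrite (eq_pnat _ e0) pnatX pnat_id ?orbT.
elim: m => [|m IH]; first by rewrite !big_ord0 expr0n eqn0Ngt expn_gt0 prime_gt0.
by rewrite !big_ord_recr /= exprDn_pchar // IH.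
Qed.

Section Core.
Variables (p : nat) (A : idomainType) (E : closedFieldType) (j : {rmorphism A -> E}).
Hypothesis B : base_ring p j.

Local Notation dv := (@dvdby A p).
Local Notation I := (intI j).
Local Notation place := (place p j).

Lemma nth_root (w : E) n : (0 < n)%N -> exists z, z ^+ n = w.
Proof.
move=> n0; have [|z] := @closed_rootP E ('X^n - w%:P) _.
  by rewrite size_XnsubC // eqSS -lt0n.
by rewrite rootE !hornerE subr_eq0 => /eqP e; exists z.
Qed.

Section Uniformizer.
Variables (M : divringClosed E) (s : seq E) (P : place).
Hypotheses (jM : forall a, j a \in M) (Ms : forall x, x \in M -> Span j s x).
Local Notation O := (valO P).

(** If w^k divides p, then the powers 1, w, ..., w^(k-1) are linearly
    independent over A: in a primitive relation, the first coefficient prime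
    to p would have positive value, since the preceding terms are divisible by
    p and the following ones by a higher power of w. *)
Lemma unif_bound w k : w \in M -> w \in O -> res P w = 0 -> w != 0 -> p%:R / w ^+ k \in O -> (k <= size s)%N.
Proof.
move=> wM wO wr w0 pk; rewrite leqNgt; apply/negP => sk.
have [|c [[i0 i0k ni0] e]] := @span_dep _ _ _ _ B s (fun i => w ^+ i) k sk.
  by move=> i _; apply: Ms; rewrite rpredX.
have exi : exists i, (i < k)%N && `[< ~ dv (c i) >] by exists i0; rewrite i0k; apply/asboolP.
case: (ex_minnP exi) => i /andP[ik /asboolP ni] imin.
apply: ni; apply/(res_j P).
have wi0 := expf_neq0 i w0.
have ce : j (c i) = - \sum_(l < k | (l : nat) != i) j (c l) * (w ^+ l / w ^+ i).
  apply/eqP; rewrite -addr_eq0; apply/eqP; apply: (mulIf wi0); rewrite mul0r -[RHS]e.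
  rewrite [RHS](bigD1 (Ordinal ik)) //= mulrDl mulr_suml; congr (_ + _).
  by apply: eq_bigr => l _; rewrite -mulrA divfK.
have main (l : 'I_k) : (l : nat) != i -> j (c l) * (w ^+ l / w ^+ i) \in O /\ res P (j (c l) * (w ^+ l / w ^+ i)) = 0.
  move=> li; have [lt|gt|eq] := ltngtP l i; last by rewrite eq eqxx in li.
  - have [d cd] : dv (c l).
      apply: contrapT => nd; have := imin l; rewrite ltn_ord leqNgt lt /=.
      by move=> h; apply: notF; apply: h; apply/asboolP.
    have -> : j (c l) * (w ^+ l / w ^+ i) = j d * (p%:R / w ^+ k) * w ^+ (k - i) * w ^+ l.
      rewrite cd rmorphM rmorph_nat -{2}(subnK (ltnW ik)) exprD.
      have h1 := expf_neq0 (k - i) w0; field; by rewrite h1 wi0.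
    have hO : j d * (p%:R / w ^+ k) \in O by rewrite rpredM ?valO_j.
    have h1O : j d * (p%:R / w ^+ k) * w ^+ (k - i) \in O by rewrite rpredM ?rpredX.
    rewrite rpredM ?rpredX //; split=> //.
    rewrite resM ?rpredX // (resM hO) ?rpredX // [res P (w ^+ (k - i))]resX // wr expr0n.
    by rewrite subn_eq0 leqNgt ik /= mulr0 mul0r.
  - have -> : w ^+ l / w ^+ i = w ^+ (l - i).
      by rewrite -{1}(subnK (ltnW gt)) exprD mulfK.
    rewrite rpredM ?valO_j ?rpredX // resM ?valO_j ?rpredX // resX // wr expr0n.
    by rewrite subn_eq0 leqNgt gt mulr0.
rewrite ce -sub0r resB ?rpred0 //; last by apply: rpred_sum => l /main[].
rewrite res0 res_sum; last by move=> l /main[].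
by rewrite big1 ?subrr // => l /main[].
Qed.

(** Choose w in M of positive value and e such that w^e divides p, with e as
    large as possible. If x in M had positive value less than that of w, then
    x or w / x would have a square dividing w, and the exponent 2e would be
    possible. So w has the least positive value. *)
Lemma uniformizer : exists w e v, [/\ w \in M, unif P M w, (0 < e <= size s)%N, unitO P v & p%:R = w ^+ e * v].
Proof.
have pO : (p%:R : E) \in O by apply: valO_int; rewrite rpred_nat.
have pM : (p%:R : E) \in M by rewrite rpred_nat.
pose Q k := `[< exists w, [/\ w \in M, w \in O, res P w = 0, w != 0 & p%:R / w ^+ k \in O] >].
have Q1 : Q 1%N.
  apply/asboolP; exists p%:R; split=> //; [exact: res_p|exact: p_neq0 B|].
  by rewrite expr1 divff ?rpred1 // (p_neq0 B).
have Qb k : Q k -> (k <= size s)%N by move=> /asboolP[w [wM wO wr w0 pk]]; apply: (unif_bound wM).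
have exQ : exists k, Q k by exists 1%N.
case: (ex_maxnP exQ Qb) => e Qe emax.
have /asboolP[w [wM wO wr w0 pe]] := Qe.
have e0 : (0 < e)%N by apply: emax.
have we0 := expf_neq0 e w0.
have wdiv x : x \in M -> x \in O -> res P x = 0 -> x != 0 -> x / w \in O.
  move=> xM xO xr x0; apply: contraT => /valO_out[_]; rewrite invf_div => tO tr.
  set t := w / x in tO tr.
  have tM : t \in M by rewrite rpredM ?rpredV.
  have t0 : t != 0 by rewrite mulf_neq0 ?invr_neq0.
  have wxt : w = x * t by rewrite /t mulrC divfK.
  have key z : z \in M -> z \in O -> res P z = 0 -> z != 0 -> w / z ^+ 2 \in O -> false.
    move=> zM zO zr z0 wz.
    have : (2 * e <= e)%N.
      apply: emax; apply/asboolP; exists z; split=> //.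
      have -> : p%:R / z ^+ (2 * e) = (p%:R / w ^+ e) * (w / z ^+ 2) ^+ e.
        rewrite expr_div_n exprM; have h := expf_neq0 e (expf_neq0 2 z0).
        by field; rewrite we0 h.
      by rewrite rpredM ?rpredX.
    by rewrite leqNgt ltn_Pmull.
  have [h|h] := val_total P x0 t0.
    apply: (key t) => //; have -> // : w / t ^+ 2 = x / t.
    by rewrite wxt; field.
  apply: (key x) => //; have -> // : w / x ^+ 2 = t / x.
  by rewrite wxt; field.
have pwe : p%:R = w ^+ e * (p%:R / w ^+ e) by rewrite mulrC divfK.
have uv : unitO P (p%:R / w ^+ e).
  have [vr|//] := unitOP pe.
  have v0 : p%:R / w ^+ e != 0 by rewrite mulf_neq0 ?invr_neq0 ?(p_neq0 B).
  have vM : p%:R / w ^+ e \in M by rewrite rpredM ?rpredV ?rpredX.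
  have h := wdiv _ vM pe vr v0.
  have : (e.+1 <= e)%N.
    apply: emax; apply/asboolP; exists w; split=> //.
    by rewrite exprSr invfM mulrA.
  by rewrite ltnn.
exists w, e, (p%:R / w ^+ e); split=> //; last by rewrite e0 Qb.
(* By [p_finite] x is divisible by finitely many powers of w; the last
   quotient is a unit. *)
have pow x : x \in M -> x != 0 -> x \in O -> powu P w x.
  move=> xM x0 xO; have [k Hk] := p_finite B P x0.
  have exk : exists k, x / w ^+ k \notin O.
    apply: contrapT => H; case/negP: Hk.
    have h : x / w ^+ (e * k) \in O by apply/negPn/negP => h; apply: H; exists (e * k)%N.
    have -> : x / p%:R ^+ k = x / w ^+ (e * k) * (p%:R / w ^+ e)^-1 ^+ k.
      rewrite invf_div expr_div_n -exprM.
      have h1 := expf_neq0 (e * k) w0; have h2 := expf_neq0 k (p_neq0 B).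
      by field; rewrite h1 h2.
    by rewrite rpredM ?rpredX //; case: (unitOV uv).
  case: (ex_minnP exk) => -[|n] nO nmin; first by rewrite expr0 divr1 xO in nO.
  have xn : x / w ^+ n \in O by apply: contraT => h; have := nmin n h; rewrite ltnn.
  have wn0 := expf_neq0 n w0.
  have [xr|u] := unitOP xn.
    case/negP: nO; rewrite exprSr invfM mulrA; apply: wdiv => //.
      by rewrite rpredM ?rpredV ?rpredX.
    by rewrite mulf_neq0 ?invr_neq0.
  by exists n%:Z, (x / w ^+ n); split=> //; rewrite -exprnP mulrC divfK.
split=> // x xM x0; have [xO|/valO_out[_ xO _]] := boolP (x \in O); first exact: pow.
by rewrite -[x]invrK; apply: powuV; apply: pow; rewrite ?rpredV ?invr_neq0.
Qed.
End Uniformizer.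

Section Transfer.
Variables (M : divringClosed E) (P P' : place).
Hypotheses (jM : forall a, j a \in M) (PP' : same_center M P P').

Lemma same_center_res0 z : z \in M -> z \in valO P -> res P z = 0 -> res P' z = 0.
Proof.
move=> zM zO zr; have zO' := same_center_valO B jM PP' zM zO.
have [//|u] := unitOP zO'.
have [_] := same_center_unit B jM (same_center_sym PP') zM u.
by rewrite zr eqxx.
Qed.

Lemma same_center_unif w : w \in M -> unif P M w -> unif P' M w.
Proof.
move=> wM [wO wr w0 H]; split=> //; [exact: same_center_valO wO|exact: same_center_res0|].
move=> x xM x0; have [z [u [uu xe]]] := H x xM x0; exists z, u; split=> //.
apply: (same_center_unit B jM PP') => //.
have wz0 : w ^ z != 0 by rewrite expfz_neq0.
have -> : u = w ^ (- z) * x by rewrite xe mulrA -expfzDr // addNr expr0z mul1r.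
rewrite rpredM //; case: (- z) => n; first by rewrite -exprnP rpredX.
by rewrite NegzE -invr_expz -exprnP rpredV rpredX.
Qed.

Lemma same_center_nonpow v : v \in M -> v \in valO P -> (forall d, d \in resfield P M -> d ^+ p != res P v) ->
  forall d, d \in resfield P' M -> d ^+ p != res P' v.
Proof.
move=> vM vO H d /resfieldP[z [zM zO <-]].
have zO' := same_center_valO B jM (same_center_sym PP') zM zO.
have vO' := same_center_valO B jM PP' vM vO.
apply/eqP => e; have := H (res P z) (mem_resfield zM zO').
rewrite -resX // -subr_eq0 -resB ?rpredX //; case/eqP.
have h : res P' (z ^+ p - v) = 0 by rewrite resB ?rpredX // resX // e subrr.
have [//|u] : res P (z ^+ p - v) = 0 \/ unitO P (z ^+ p - v) by apply: unitOP; rewrite rpredB ?rpredX.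
have hM : z ^+ p - v \in M by rewrite rpredB ?rpredX.
by have [_] := same_center_unit B jM PP' hM u; rewrite h eqxx.
Qed.
End Transfer.

(** For all q = p^h, the powers 1, x, ..., x^(q-1) are linearly independent
    modulo p over the q-th powers. For the first variable of a power series
    ring this holds because the orders in x of the terms c_i^q x^i are
    distinct modulo q. *)
Definition frob_indep (x : A) := forall h (c : nat -> A),
  dv (\sum_(i < p ^ h) c i ^+ (p ^ h) * x ^+ i) -> forall i, (i < p ^ h)%N -> dv (c i).

Lemma frob_indep_ndv x : frob_indep x -> ~ dv x.
Proof.
move=> X dx; have p1 := prime_gt1 (br_prime B).
have := X 1%N (fun i => (i == 1%N)%:R).
rewrite expn1 => /(_ _ 1%N p1) H; apply: (br_p1 B); apply: H.
rewrite (bigD1 (Ordinal p1)) //= expr1n mul1r expr1 big1 ?addr0 // => i.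
rewrite -(inj_eq val_inj) /= => /negbTE ->.
by rewrite expr0n eqn0Ngt prime_gt0 ?mul0r // (br_prime B).
Qed.

(** If all elements of the residue field of M were p-th powers, then x would
    have there a q-th root for q = p^h; let z in M lift it. If q exceeds the
    degree of M, there is a primitive relation between the powers of z; its
    q-th power, reduced at P, contradicts [frob_indep]. *)
Lemma imperfect (M : divringClosed E) (jM : forall a, j a \in M) s (P : place) x : frob_indep x ->
  (forall z, z \in M -> Span j s z) ->
  exists b, [/\ b \in M, b \in I & forall d, d \in resfield P M -> d ^+ p != res P b].
Proof.
move=> X Ms; apply: contrapT => H.
have p0 : (0 < p)%N by rewrite prime_gt0 // (br_prime B).
have perf c : c \in resfield P M -> exists2 d, d \in resfield P M & d ^+ p = c.
  move=> /resfieldP[z [zM zO zc]]; have [b [t [bM bI tM tI [t0 ze]]]] := frac_rep B jM zM zO.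
  have bO := valO_int P bI; have tO := valO_int P tI.
  have [d dK de] : exists2 d, d \in resfield P M & d ^+ p = res P (b * t ^+ p.-1).
    apply: contrapT => nd; apply: H; exists (b * t ^+ p.-1).
    rewrite !rpredM ?rpredX //; split=> // d dK; apply/eqP => e; apply: nd; by exists d.
  have tn0 : t != 0 by apply: contraNneq t0 => ->; rewrite res0.
  exists (d / res P t); first by rewrite rpredM // rpredV mem_resfield.
  rewrite expr_div_n de resM ?rpredX // resX // -zc.
  have -> : res P b = res P z * res P t by rewrite -resM // ze divfK.
  have tp : res P t ^+ p = res P t * res P t ^+ p.-1 by rewrite -exprS prednK.
  rewrite tp; have h := expf_neq0 p.-1 t0.
  by field; rewrite t0 h.
have perfn n c : c \in resfield P M -> exists2 d, d \in resfield P M & d ^+ (p ^ n) = c.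
  elim: n c => [|n IH] c cK; first by exists c.
  have [d dK <-] := IH c cK; have [f fK <-] := perf d dK; exists f => //.
  by rewrite expnS exprM.
pose h := size s.
have ltq : (size s < p ^ h)%N by apply: ltn_expl; apply: prime_gt1; apply: br_prime B.
have [t tK tx] := perfn h _ (mem_resfield (jM x) (valO_j P x)).
have [z [zM zO zt]] := resfieldP tK.
have [|c [[i im ni] e]] := @span_dep _ _ _ _ B s (fun i => z ^+ i) (size s).+1 (ltnSn _).
  by move=> i _; apply: Ms; rewrite rpredX.
(* The relation has size s + 1 terms, and is padded to q terms. *)
pose c' i := if (i < (size s).+1)%N then c i else 0.
apply: ni; suff H1 : dv (\sum_(i < p ^ h) c' i ^+ (p ^ h) * x ^+ i).
  by have := X h c' H1 i (leq_trans im ltq); rewrite /c' im.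
apply/(res_j P).
have pk := pk_pchar B P.
have : res P (\sum_(l < (size s).+1) j (c l) * z ^+ l) = 0 by rewrite e res0.
rewrite res_sum; last by move=> l _; rewrite rpredM ?valO_j ?rpredX.
move=> /(congr1 (fun u => u ^+ (p ^ h))).
rewrite (pchar_sum_pow pk h _ (fun l => res P (j (c l) * z ^+ l))) expr0n eqn0Ngt expn_gt0 p0 /= => e2.
rewrite rmorph_sum res_sum; last by move=> l _; apply: valO_j.
rewrite -[RHS]e2 (big_ord_widen _ (fun l => res P (j (c l) * z ^+ l) ^+ (p ^ h)) ltq) [RHS]big_mkcond /=.
apply: eq_bigr => l _; rewrite /c'; case: ifP => _; last first.
  by rewrite expr0n eqn0Ngt expn_gt0 p0 /= mul0r rmorph0 res0.
rewrite rmorphM !rmorphXn resM ?rpredX ?valO_j // !resX ?valO_j // resM ?valO_j ?rpredX // exprMn resX //.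
by rewrite zt -tx -!exprM mulnC.
Qed.

Local Notation toI := (corestrict (int_j j)).

(** The element y = 1 + x b is a root of a monic polynomial over A with
    constant coefficient 1 + x a up to sign, which is a unit. *)
Lemma one_add_unit (x : A) b : (forall a, exists b, (1 + x * a) * b = 1) -> b \in I ->
  1 + j x * b != 0 /\ (1 + j x * b)^-1 \in I.
Proof.
move=> Ux /intIP[f fm fb].
set y := 1 + j x * b.
pose k := (size f).-1.
have sf : size f = k.+1 by rewrite /k prednK // size_poly_gt0 monic_neq0.
have fk : f`_k = 1 by move/monicP: fm.
(* From the monic relation f of b, multiplied by x^k: a monic relation g of x
   b = y - 1, whose coefficients below the leading one are divisible by x. *)
pose g : {poly A} := \poly_(i < k.+1) (f`_i * x ^+ (k - i)).
have gy : (map_poly j g).[y - 1] = 0.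
  have -> : map_poly j g = \poly_(i < k.+1) (j f`_i * j x ^+ (k - i)).
    apply/polyP => i; rewrite coef_map /= !coef_poly; case: ifP => _; last by rewrite rmorph0.
    by rewrite rmorphM rmorphXn.
  rewrite horner_poly /y addrC addKr.
  transitivity (j x ^+ k * (map_poly j f).[b]); last by rewrite (rootP fb) mulr0.
  have smf : (size (map_poly j f) <= k.+1)%N by rewrite -sf size_poly.
  rewrite (horner_coef_wide _ smf) mulr_sumr; apply: eq_bigr => -[i /= lt] _.
  have -> : j x ^+ k = j x ^+ (k - i) * j x ^+ i by rewrite -exprD subnK.
  by rewrite coef_map exprMn; ring.
pose bI : subdom I := Subdom (introT (intIP j b) (ex_intro2 _ _ f fm fb)).
pose yI : subdom I := 1 + toI x * bI.
have [t ht] := horner_diff (map_poly (toI) g) (yI - 1) (- 1).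
have gyI : (map_poly (toI) g).[yI - 1] = 0.
  by apply: val_inj; rewrite valtoI rmorph0 -[RHS]gy.
have [a ga] : exists a, g.[-1] = (-1) ^+ k * (1 + x * a).
  exists ((-1) ^+ k * \sum_(i < k) f`_i * x ^+ (k - i.+1) * (-1) ^+ i).
  rewrite /g horner_poly big_ord_recr /= subnn expr0 mulr1 fk mul1r addrC.
  rewrite mulrDr mulr1 mulrCA [_ ^+ k * (_ * _)]mulrA -expr2 -exprM mulnC exprM sqrrN !expr1n mul1r.
  congr (_ + _); rewrite mulr_sumr; apply: eq_bigr => i _.
  by rewrite -(subnSK (ltn_ord i)) exprS; ring.
have [w aw] := Ux a.
have e : y * (- val t * (-1) ^+ k * j w) = 1.
  have e1 : - val (map_poly (toI) g).[-1] = val t * y.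
    have := congr1 val ht; rewrite gyI sub0r opprK subrK rmorphN => ->.
    by rewrite rmorphM; congr (_ * _); rewrite /yI rmorphD rmorph1 rmorphM.
  have e2 : val (map_poly (toI) g).[-1] = j g.[-1].
    by rewrite valtoI rmorphN rmorph1 -(rmorph1 j) -(rmorphN j) horner_map.
  have e3 : y * - val t = j g.[-1] by rewrite mulrN mulrC -e1 opprK e2.
  have sg : (-1) ^+ k * (-1) ^+ k = 1 :> E by rewrite -exprMn mulrNN mulr1 expr1n.
  rewrite !mulrA e3 ga rmorphM rmorphXn rmorphN rmorph1.
  transitivity (((-1) ^+ k * (-1) ^+ k) * j ((1 + x * a) * w)); first by rewrite rmorphM; ring.
  by rewrite sg aw rmorph1 mulr1.
have y0 : y != 0 by apply: contra_eq_neq e => ->; rewrite mul0r eq_sym oner_eq0.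
split=> //; have -> : y^-1 = - val t * (-1) ^+ k * j w by apply: (mulfI y0); rewrite divff.
by rewrite !rpredM ?rpredN ?rpredX ?rpredN ?rpred1 ?int_j //; apply: valP.
Qed.
End Core.

(** * A common uniformizer for all places *)

Section Core.
Variables (p : nat) (A : idomainType) (E : closedFieldType) (j : {rmorphism A -> E}).
Hypothesis B : base_ring p j.

Local Notation dv := (@dvdby A p).
Local Notation I := (intI j).
Local Notation place := (place p j).

(** At the i-th place p = w_i^e_i v_i. If the residue of v_i is a p-th power
    take for b_i an element whose residue is not, and otherwise b_i = 0. Let y
    be the sum of the q_l^p b_l, where the q_l separate the places, and u = 1
    + x^p y. At the i-th place v_i u has the residue of v_i (1 + (x q_i)^p
    b_i), which is not a p-th power. *)
Lemma choose_unit (M : divringClosed E) (jM : forall a, j a \in M) s (x : A) :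
  frob_indep p x -> (forall a, exists b, (1 + x * a) * b = 1) ->
  (forall z, z \in M -> Span j s z) ->
  exists u, [/\ u \in M, u \in I, u^-1 \in I & forall P : place, exists w e v,
   [/\ w \in M, unif P M w, (0 < e <= size s)%N, unitO P v & p%:R * u = w ^+ e * v /\
      forall d, d \in resfield P M -> d ^+ p != res P v]].
Proof.
move=> X Ux Ms.
have [n [Ps [ne Hcov]]] : exists n (Ps : nat -> place),
   (forall i l, (i < n)%N -> (l < n)%N -> i != l -> ~ same_center M (Ps i) (Ps l)) /\
   forall P : place, exists2 i, (i < n)%N & same_center M P (Ps i) by apply: (places_finite B) => //; exists s.
have [q Hq] := places_separated B jM ne.
have p0 : (0 < p)%N by rewrite prime_gt0 // (br_prime B).
have /choice[d Hd] : forall i, exists d : E * nat * E, [/\ d.1.1 \in M, unif (Ps i) M d.1.1, (0 < d.1.2 <= size s)%N,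
    unitO (Ps i) d.2 & p%:R = d.1.1 ^+ d.1.2 * d.2].
  by move=> i; have [w [e [v H]]] := uniformizer B (Ps i) Ms; exists (w, e, v).
have xu (P : place) : unitO P (j x) by apply: unitO_j; apply: frob_indep_ndv B _ X.
have /choice[b Hb] : forall i, exists b, [/\ b \in M, b \in I &
    forall c, c \in resfield (Ps i) M -> c != 0 -> forall f, f \in resfield (Ps i) M ->
     f ^+ p != res (Ps i) (d i).2 * (1 + c ^+ p * res (Ps i) b)].
  move=> i; case: (Hd i) => _ _ _ [vO v0] _.
  have pk := pk_pchar B (Ps i).
  have [[g gK ge]|ng] := pselect (exists2 g, g \in resfield (Ps i) M & g ^+ p = res (Ps i) (d i).2); last first.
    exists 0; rewrite !rpred0; split=> // c cK c0 f fK; rewrite res0 mulr0 addr0 mulr1.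
    by apply/eqP => fe; apply: ng; exists f.
  have [b [bM bI Hb]] := imperfect B jM (Ps i) X Ms.
  exists b; split=> // c cK c0 f fK; apply/eqP => fe.
  have g0 : g != 0 by apply: contraNneq v0 => h; rewrite -ge h expr0n eqn0Ngt p0.
  have := Hb ((f / g - 1) / c); rewrite rpredM ?rpredV ?rpredB ?rpred1 ?rpredM ?rpredV // => /(_ isT)/eqP; apply.
  have cp0 := expf_neq0 p c0; have gp0 := expf_neq0 p g0.
  have := pchar_sub_pow pk (f / g) 1 1; rewrite expn1 => h.
  rewrite expr_div_n h expr1n expr_div_n fe -ge.
  by field; rewrite cp0 gp0.
pose y := \sum_(i < n) q i ^+ p * b i.
have qP (i : 'I_n) := Hq i (ltn_ord i).
have yM : y \in M by apply: rpred_sum => i _; case: (qP i) => h _ _ _; case: (Hb i) => h' _ _; rewrite rpredM ?rpredX.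
have yI : y \in I by apply: rpred_sum => i _; case: (qP i) => _ h _ _; case: (Hb i) => _ h' _; rewrite rpredM ?rpredX.
have yr (i : 'I_n) : res (Ps i) y = res (Ps i) (q i) ^+ p * res (Ps i) (b i).
  have qO l : q (l : 'I_n) \in valO (Ps i) by apply: valO_int; case: (qP l).
  have bO l : b l \in valO (Ps i) by apply: valO_int; case: (Hb l).
  rewrite /y res_sum; last by move=> l _; rewrite rpredM ?rpredX.
  rewrite (bigD1 i) //= big1 ?addr0; last first.
    move=> l li; case: (qP l) => _ _ _ H; rewrite resM ?rpredX // resX // H ?ltn_ord //.
      by rewrite expr0n eqn0Ngt p0 mul0r.
    by rewrite eq_sym; move: li; rewrite -(inj_eq val_inj).
  by rewrite resM ?rpredX // resX.
have Ux' a : exists b, (1 + x ^+ p * a) * b = 1.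
  by rewrite -(prednK p0) exprS -mulrA; apply: Ux.
pose u := 1 + j (x ^+ p) * y.
have uI : u \in I by rewrite rpredD ?rpred1 // rpredM ?int_j.
have uM : u \in M by rewrite rpredD ?rpred1 // rpredM.
have [u0 uVI] := one_add_unit Ux' yI.
have uU (P : place) : unitO P u.
  split; first exact: valO_int.
  have : res P (u * u^-1) = 1 by rewrite divff // res1.
  rewrite resM ?valO_int // => h; apply/eqP => h0; move: h; rewrite h0 mul0r => /esym/eqP.
  by rewrite oner_eq0.
exists u; split=> // P; have [i lt PPi] := Hcov P.
case: (Hd i) => wM wu eb vu pe; case: (Hb i) => bM bI Hbi; case: (Hq i lt) => qM qI q0 _.
have PiP := same_center_sym PPi.
have w0 := un_neq0 wu.
have vM : (d i).2 \in M.
  have -> : (d i).2 = p%:R / (d i).1.1 ^+ (d i).1.2 by rewrite pe mulrAC divff ?mul1r // expf_neq0.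
  by rewrite rpredM ?rpredV ?rpredX // rpred_nat.
exists (d i).1.1, (d i).1.2, ((d i).2 * u); split=> //.
- exact: same_center_unif PiP _ wM wu.
- by apply: unitOM => //; apply: (same_center_unit B jM PiP).
split; first by rewrite mulrA -pe.
apply: (same_center_nonpow B jM PiP); first by rewrite rpredM.
  by rewrite rpredM //; [case: vu|case: (uU (Ps i))].
move=> f fK; case: vu => vO v0; case: (uU (Ps i)) => uO _.
rewrite resM // (_ : res (Ps i) u = 1 + (res (Ps i) (j x) * res (Ps i) (q i)) ^+ p * res (Ps i) (b i)).
  apply: Hbi => //.
    by rewrite rpredM ?mem_resfield ?valO_j ?valO_int.
  by rewrite mulf_neq0 //; case: (xu (Ps i)).
rewrite /u resD ?rpred1 ?rpredM ?valO_j ?valO_int // res1 resM ?valO_j ?valO_int //.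
by rewrite (yr (Ordinal lt)) rmorphXn resX ?valO_j // exprMn mulrA.
Qed.

(** Let N = m e and y = z^m / w, so that y^e = v, and write e = e' p^a with e'
    prime to p. Adjoin in succession y^e', a root of X^(p^a) - v, which is
    inseparable on residues since v is not a p-th power; then y, a root of
    X^e' - y^e', which is etale; then z, an m-th root of the uniformizer w
    y. *)
Lemma root_unif (M : divringClosed E) (jM : forall a, j a \in M) (P : place) w e v N z t :
  w \in M -> unif P M w -> (0 < e)%N -> unitO P v -> t = w ^+ e * v -> t \in M ->
  (forall d, d \in resfield P M -> d ^+ p != res P v) -> (e %| N)%N -> (0 < N)%N -> z ^+ N = t ->
  unif P (adj B jM z) z.
Proof.
move=> wM wu e0 vu te tM vn /dvdnP[m Nm] N0 zN.
have pp := br_prime B.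
have [wO wr w0 _] := wu.
have we0 := expf_neq0 e w0.
have vM : v \in M.
  have -> : v = t / w ^+ e by rewrite te mulrAC divff // mul1r.
  by rewrite rpredM ?rpredV ?rpredX.
have m0 : (0 < m)%N by move: N0; rewrite Nm muln_gt0 => /andP[].
pose y := z ^+ m / w.
have ye : y ^+ e = v.
  by rewrite expr_div_n -exprM -Nm zN te mulrAC divff // mul1r.
have vO : v \in valO P by case: vu.
have yO : y \in valO P by apply: root_valO ye vO.
have y0 : res P y != 0.
  case: vu => _; rewrite -ye resX // expf_eq0 negb_and e0 //.
have [e' [pe' ee]] : exists e', ~~ (p %| e')%N /\ e = (e' * p ^ logn p e)%N.
  have [e' pe' ee] := pfactor_coprime pp e0.
  by exists e'; rewrite -prime_coprime.
have e'0 : (0 < e')%N by case: e' pe' {ee} => //; rewrite dvdn0.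
set a := logn p e in ee.
pose y1 := y ^+ e'.
have y1O : y1 \in valO P by rewrite rpredX.
have y1e : y1 ^+ (p ^ a) = v by rewrite -exprM -ee.
have q0 : (0 < p ^ a)%N by rewrite expn_gt0 prime_gt0.
have u1 : unif P (adj B jM y1) w.
  have ry : res P y1 ^+ (p ^ a) = res P v by rewrite -resX // y1e.
  apply: (@fierce_unif _ _ _ _ B P M w y1 jM wu y1O (p ^ a) a ('X^(p ^ a) - v%:P)) => //.
  - by rewrite ry mem_resfield.
  - by rewrite ry.
  - by rewrite polyOverXnsubC.
  - by rewrite size_XnsubC.
  - by rewrite !hornerE y1e subrr.
have jM1 c : j c \in adj B jM y1 by apply: sub_adj.
have u2 : unif P (adj B jM1 y) w.
  apply: (@etale_unif _ _ _ _ B P _ w y jM1 u1 yO _ ('X^e' - y1%:P)).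
  - by apply: sub_adj.
  - by rewrite polyOverXnsubC mem_adj.
  - by rewrite polyOverXnsubC.
  - by rewrite !hornerE subrr.
  - rewrite derivB derivC subr0 derivXn hornerMn hornerXn -mulr_natl resM ?rpredX ?rpred_nat //.
    rewrite res_nat resX // mulf_neq0 ?expf_neq0 //.
    by rewrite -(dvdn_pcharf (pk_pchar B P)).
have jM2 c : j c \in adj B jM1 y by apply: sub_adj.
have wM2 : w \in adj B jM1 y by apply: sub_adj; apply: sub_adj.
have yM2 : y \in adj B jM1 y by apply: mem_adj.
have zm : z ^+ m = w * y by rewrite mulrC divfK.
have u3 : unif P (adj B jM1 y) (w * y) by apply: unif_scale u2 _; split.
have u4 : unif P (adj B jM2 z) z by apply: ram_unif m0 u3 _ zm; rewrite rpredM.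
apply: unifS u4; apply: adj_min; last exact: mem_adj.
by move=> c cM; do 3!apply: sub_adj.
Qed.

(** The two cases are those of dimension one and of higher dimension of A. In
    the first, a uniformizer at all places is obtained from uniformizers w_i
    at the finitely many places as the sum of the q_i^2 w_i, where the q_i
    separate the places; p / pi is integral because the denominators allowed
    by [int_of_places] are units. In the second, pi is an N-th root of p u,
    with u from [choose_unit] and N divisible by all e. *)
Lemma uniform_extension (M : divringClosed E) (jM : forall a, j a \in M) : finite_over j M ->
  (forall a : A, ~ dv a -> exists b, a * b = 1) \/
  (exists2 x : A, frob_indep p x & forall a, exists b, (1 + x * a) * b = 1) ->
  exists (M0 : divringClosed E) pi, [/\ {subset M <= M0}, finite_over j M0,
     pi \in M0 /\ pi \in I, p%:R / pi \in I & forall P : place, unif P M0 pi].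
Proof.
move=> [s Ms] [D1|[x X Ux]].
- have [n [Ps [ne Hcov]]] : exists n (Ps : nat -> place),
     (forall i l, (i < n)%N -> (l < n)%N -> i != l -> ~ same_center M (Ps i) (Ps l)) /\
     forall P : place, exists2 i, (i < n)%N & same_center M P (Ps i) by apply: (places_finite B) => //; exists s.
  have [q Hq] := places_separated B jM ne.
  have /choice[w Hw] : forall i, exists w, [/\ w \in M, w \in I & unif (Ps i) M w].
    move=> i; have [w [e [v [wM wu _ _ _]]]] := uniformizer B (Ps i) Ms.
    have [b [t [bM bI tM tI [t0 wbt]]]] := frac_rep B jM wM (un_O wu).
    have tu : unitO (Ps i) t by split=> //; apply: valO_int.
    exists b; split=> //; have -> : b = w * t by rewrite wbt divfK // (unitO_neq0 tu).
    exact: unif_scale.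
  pose pi := \sum_(i < n) q i ^+ 2 * w i.
  have qP (i : 'I_n) := Hq i (ltn_ord i).
  have piM : pi \in M by apply: rpred_sum => i _; case: (qP i) => h _ _ _; case: (Hw i) => h' _ _; rewrite rpredM ?rpredX.
  have piI : pi \in I by apply: rpred_sum => i _; case: (qP i) => _ h _ _; case: (Hw i) => _ h' _; rewrite rpredM ?rpredX.
  have uPs i : (i < n)%N -> unif (Ps i) M pi.
    move=> lt; case: (Hw i) => wM wI wu; have [wO wr w0 _] := wu.
    have qO l : q (l : 'I_n) \in valO (Ps i) by apply: valO_int; case: (qP l).
    have wlO l : w l \in valO (Ps i) by apply: valO_int; case: (Hw l).
    have -> : pi = w i * (q i ^+ 2 + \sum_(l < n | l != Ordinal lt) q l * (q l / w i) * w l).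
      rewrite /pi (bigD1 (Ordinal lt)) //= mulrDr mulr_sumr mulrC; congr (_ + _).
      by apply: eq_bigr => l _; field.
    have qi0 : unitO (Ps i) (q i) by case: (Hq i lt) => _ qI q0 _; split=> //; apply: valO_int.
    have main (l : 'I_n) : l != Ordinal lt -> q l * (q l / w i) * w l \in valO (Ps i) /\
       res (Ps i) (q l * (q l / w i) * w l) = 0.
      move=> li; case: (qP l) => qM qI _ H.
      have ql0 : res (Ps i) (q l) = 0 by apply: H => //; rewrite eq_sym; move: li; rewrite -(inj_eq val_inj).
      have qwO : q l / w i \in valO (Ps i) by apply: (unif_div wu).
      have o2 : q l * (q l / w i) \in valO (Ps i) by apply: rpredM; first exact: qO.
      split; first by apply: rpredM; [exact: o2|exact: (wlO l)].
      rewrite resM; [|exact: o2|exact: (wlO l)].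
      by rewrite resM ?ql0 ?mul0r //; exact: (qO l).
    have sO : \sum_(l < n | l != Ordinal lt) q l * (q l / w i) * w l \in valO (Ps i).
      by apply: rpred_sum => l /main[].
    case: (unitOX 2 qi0) => q2O q20.
    apply: unif_scale => //; split; first by rewrite rpredD.
    rewrite resD // res_sum; last by move=> l /main[].
    by rewrite [X in _ + X]big1 ?addr0 // => l /main[].
  have uP (P : place) : unif P M pi.
    have [i lt PPi] := Hcov P.
    exact: (same_center_unif B jM (same_center_sym PPi) piM (uPs i lt)).
  exists M, pi; split=> //; first by exists s.
  have [|a na aI] := @int_of_places _ _ _ _ B (p%:R / pi).
    move=> P; apply: (unif_div (uP P)); rewrite ?rpred_nat //.
    exact: res_p.
  have [b ab] := D1 a na.
  have -> : p%:R / pi = j b * (j a * (p%:R / pi)) by rewrite mulrA -rmorphM [b * a]mulrC ab rmorph1 mul1r.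
  by rewrite rpredM ?int_j.
- have [u [uM uI uVI Hu]] := choose_unit jM X Ux Ms.
  pose N := (size s)`!.
  have N0 : (0 < N)%N by apply: fact_gt0.
  have [pi piN] := nth_root (p%:R * u) N0.
  have puM : p%:R * u \in M by rewrite rpredM ?rpred_nat.
  have [P0 _] := place_inh B.
  have piI : pi \in I.
    apply: (@int_root_monic _ _ _ ('X^N - (p%:R * u)%:P)).
    - exact: monicXnsubC.
    - by rewrite polyOverXnsubC rpredM ?rpred_nat.
    - by rewrite rootE !hornerE piN subrr.
  have uP (P : place) : unif P (adj B jM pi) pi.
    have [w [e [v [wM wu /andP[e0 es] vu [te vn]]]]] := Hu P.
    by apply: (root_unif jM wM wu e0 vu te puM vn _ N0 piN); rewrite dvdn_fact // e0 es.
  have pi0 := un_neq0 (uP P0).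
  have u0 : u != 0.
    apply/eqP => u0; move: piN; rewrite u0 mulr0 => /eqP; rewrite expf_eq0 => /andP[_].
    by rewrite (negbTE pi0).
  exists (adj B jM pi), pi; split=> //.
  + exact: sub_adj.
  + by apply: finite_over_adj; exists s.
  + by split=> //; apply: mem_adj.
  + have -> : p%:R / pi = pi ^+ N.-1 * u^-1.
      apply: (mulIf pi0); apply: (mulIf u0); rewrite divfK // -piN -(prednK N0) exprSr /=.
      by field.
    by rewrite rpredM ?rpredX.
Qed.

End Core.

(** * A maximal extension with perfect residue fields *)

Section Core.
Variables (p : nat) (A : idomainType) (E : closedFieldType) (j : {rmorphism A -> E}).
Hypothesis B : base_ring p j.

Local Notation dv := (@dvdby A p).
Local Notation I := (intI j).
Local Notation place := (place p j).

Let pp : prime p := br_prime B.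
Let p0 : (0 < p)%N := prime_gt0 pp.

Definition perfect_at (P : place) (L : divringClosed E) :=
  forall c, c \in resfield P L -> exists2 d, d \in resfield P L & d ^+ p = c.

(** Integral elements of L' are algebraic over L, so [perfect_alg] applies to
    residues. *)
Lemma perfect_at_ext (P : place) (L L' : divringClosed E) : (forall a, j a \in L) -> {subset L <= L'} ->
  perfect_at P L -> perfect_at P L'.
Proof.
move=> jL LL' pL c /resfieldP[z [zL zO zc]].
have jL' a : j a \in L' by apply: LL'.
have key b : b \in L' -> b \in I -> exists2 d, d \in resfield P L' & d ^+ p = res P b.
  move=> bL /[dup] bI /intIP[f fm fb].
  have mfL : map_poly j f \is a polyOver L by apply/polyOverP => i; rewrite coef_map jL.
  have mfO : map_poly j f \is a polyOver (valO P) by apply/polyOverP => i; rewrite coef_map valO_j.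
  have bO := valO_int P bI.
  apply: (perfect_alg (pk_pchar B P) (resfieldS LL') pL (mem_resfield bL bO) (polyOver_LO mfL mfO)).
    apply/eqP => /(congr1 (fun u : {poly _} => u`_((size f).-1))).
    by rewrite coef_res coef_map /= -lead_coefE (monicP fm) rmorph1 res1 coef0 => /eqP; rewrite oner_eq0.
  by rewrite /root -res_horner // (rootP fb) res0.
have [b [t [bL bI tL tI [t0 ze]]]] := frac_rep B jL' zL zO.
have [d dK de] := key b bL bI; have [f fK fe] := key t tL tI.
exists (d / f); first by rewrite rpredM ?rpredV.
rewrite expr_div_n de fe -zc ze.
have [tVO e] := valO_inv (valO_int P tI) t0.
by rewrite resM ?e // valO_int.
Qed.

Lemma not_perfect_at (P : place) (L : divringClosed E) : (forall a, j a \in L) -> ~ perfect_at P L ->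
  exists b, [/\ b \in L, b \in I & forall d, d \in resfield P L -> d ^+ p != res P b].
Proof.
move=> jL np; apply: contrapT => H; apply: np => c /resfieldP[z [zL zO zc]].
have key b : b \in L -> b \in I -> exists2 d, d \in resfield P L & d ^+ p = res P b.
  move=> bL bI; apply: contrapT => nd; apply: H; exists b; split=> // d dK.
  by apply/eqP => e; apply: nd; exists d.
have [b [t [bL bI tL tI [t0 ze]]]] := frac_rep B jL zL zO.
have [d dK de] := key b bL bI; have [f fK fe] := key t tL tI.
exists (d / f); first by rewrite rpredM ?rpredV.
rewrite expr_div_n de fe -zc ze.
have [tVO e] := valO_inv (valO_int P tI) t0.
by rewrite resM ?e // valO_int.
Qed.

(** Where r is a unit this polynomial is separable, where r has residue 0 it
    reduces to X^p - a. So adjoining one root is an etale extension at some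
    places and extracts a p-th root on residues at others. *)
Definition asp (r a : E) : {poly E} := 'X^p + (r *: 'X - a%:P).
Lemma asp_size r a : size (asp r a) = p.+1.
Proof.
rewrite /asp size_addl ?size_polyXn // ltnS.
apply: leq_trans (size_add _ _) _; rewrite geq_max size_opp.
apply/andP; split.
  by apply: leq_trans (size_scale_leq _ _) _; rewrite size_polyX prime_gt1.
by apply: leq_trans (size_polyC_leq1 _) _.
Qed.
Lemma asp_monic r a : asp r a \is monic.
Proof.
rewrite monicE lead_coefE asp_size /= /asp coefD coefXn eqxx coefB coefZ coefX coefC.
by rewrite gtn_eqF ?prime_gt1 // gtn_eqF // mulr0 subrr addr0.
Qed.
Lemma asp_over (S : subringClosed E) r a : r \in S -> a \in S -> asp r a \is a polyOver S.
Proof. by move=> rS aS; rewrite /asp rpredD ?polyOverXn // rpredB ?polyOverC // polyOverZ ?polyOverX. Qed.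
Lemma asp_horner r a y : (asp r a).[y] = y ^+ p + r * y - a.
Proof. by rewrite /asp hornerD hornerXn hornerD hornerN hornerC hornerZ hornerX addrA. Qed.
Lemma asp_deriv r a y : (asp r a)^`().[y] = p%:R * y ^+ p.-1 + r.
Proof.
by rewrite /asp derivD derivB derivC subr0 derivXn derivZ derivX !hornerE mulr_natl hornerMn hornerXn.
Qed.
Lemma asp_int r a y : r \in I -> a \in I -> root (asp r a) y -> y \in I.
Proof. by move=> rI aI; apply: int_root_monic; [exact: asp_monic|exact: asp_over]. Qed.

Lemma asp_etale (P : place) (L : divringClosed E) (jL : forall a, j a \in L) pi r a y :
  pi \in L -> unif P L pi -> r \in L -> r \in I -> a \in L -> a \in I -> root (asp r a) y ->
  res P r != 0 -> unif P (adj B jL y) pi.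
Proof.
move=> piL uL rL rI aL aI ry r0; have yI := asp_int rI aI ry.
have rO := valO_int P rI; have yO := valO_int P yI.
apply: (@etale_unif _ _ _ _ B P L pi y jL uL yO piL (asp r a)).
- exact: asp_over.
- by apply: asp_over => //; apply: valO_int.
- exact/rootP.
- rewrite asp_deriv resD ?rpredM ?rpred_nat ?rpredX // resM ?rpred_nat ?rpredX //.
  by rewrite res_p mul0r add0r.
Qed.

Lemma asp_res (P : place) r a y : r \in I -> a \in I -> root (asp r a) y -> res P r = 0 ->
  res P y ^+ p = res P a.
Proof.
move=> rI aI ry r0; have yI := asp_int rI aI ry.
have rO := valO_int P rI; have yO := valO_int P yI; have aO := valO_int P aI.
move: ry; rewrite rootE asp_horner subr_eq0 => /eqP <-.
by rewrite resD ?rpredM ?rpredX // resM // r0 mul0r addr0 resX.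
Qed.

Lemma asp_fierce (P : place) (L : divringClosed E) (jL : forall a, j a \in L) pi r a y :
  unif P L pi -> r \in L -> r \in I -> a \in L -> a \in I -> root (asp r a) y ->
  res P r = 0 -> (forall d, d \in resfield P L -> d ^+ p != res P a) -> unif P (adj B jL y) pi.
Proof.
move=> uL rL rI aL aI ry r0 na; have yI := asp_int rI aI ry; have ya := asp_res rI aI ry r0.
apply: (@fierce_unif _ _ _ _ B P L pi y jL uL (valO_int P yI) p 1 (asp r a)).
- by rewrite expn1.
- by rewrite ya mem_resfield // valO_int.
- by move=> d dK; rewrite ya; apply: na.
- exact: asp_over.
- exact: asp_size.
- exact/rootP.
Qed.

(** An extension that is inseparable of full degree on residues has a single
    place above each place. By [fierce_rep], an element of the extension has,
    at P and at P', the value of the same coefficient, an element of L. *)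
Lemma asp_fierce_eq (P P' : place) (L : divringClosed E) (jL : forall a, j a \in L) pi r a y :
  unif P L pi -> unif P' L pi ->
  r \in L -> r \in I -> a \in L -> a \in I -> root (asp r a) y ->
  res P r = 0 -> (forall d, d \in resfield P L -> d ^+ p != res P a) ->
  res P' r = 0 -> (forall d, d \in resfield P' L -> d ^+ p != res P' a) ->
  same_center L P P' -> center_sub (adj B jL y) P P'.
Proof.
move=> uL uL' rL rI aL aI ry r0 na r0' na' PP' x xA xI xr.
have yI := asp_int rI aI ry; have ya := asp_res rI aI ry r0; have ya' := asp_res rI aI ry r0'.
have [->|x0] := eqVneq x 0; first exact: res0.
have f0 : asp r a != 0 by rewrite -size_poly_gt0 asp_size.
have [c [cL sc xe]] := adj_red (asp_over rL aL) f0 (rootP ry) xA.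
rewrite asp_size ltnS in sc.
have c0 : c != 0 by apply: contraNneq x0 => c0; rewrite xe c0 horner0.
have [|i [ilt ci cO]] := @val_min _ _ _ _ P (size c) (fun i => c`_i).
  by exists (size c).-1; rewrite ?ltn_predL ?size_poly_gt0 // -lead_coefE lead_coef_eq0.
have cO1 l : c`_l / c`_i \in valO P.
  by case: (ltnP l (size c)) => h; [apply: cO|rewrite nth_default // mul0r rpred0].
have cL' l : c`_l \in L by move/polyOverP: cL; apply.
have cO2 l : c`_l / c`_i \in valO P'.
  by apply: (same_center_valO B jL PP') => //; rewrite rpredM ?rpredV.
have pe : p = (p ^ 1)%N by rewrite expn1.
have u : unitO P (c.[y] / c`_i).
  apply: (fierce_rep B (valO_int P yI) pe _ _ cL sc ci cO1).
    by rewrite ya mem_resfield // valO_int.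
  by move=> d dK; rewrite ya; apply: na.
have u' : unitO P' (c.[y] / c`_i).
  apply: (fierce_rep B (valO_int P' yI) pe _ _ cL sc ci cO2).
    by rewrite ya' mem_resfield // valO_int.
  by move=> d dK; rewrite ya'; apply: na'.
rewrite -xe in u u'.
have [uVO uV0] := unitOV u; have [uO _] := u'.
have cie : c`_i = x * (x / c`_i)^-1 by rewrite invf_div mulrC divfK.
have xO := valO_int P xI.
have ciO : c`_i \in valO P by rewrite cie rpredM.
have cir : res P c`_i = 0 by rewrite cie resM // xr mul0r.
have ciO' := same_center_valO B jL PP' (cL' i) ciO.
have cir' := same_center_res0 B jL PP' (cL' i) ciO cir.
have -> : x = c`_i * (x / c`_i) by rewrite mulrC divfK.
by rewrite resM // cir' mul0r.
Qed.

Section Maximal.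
Variables (M : divringClosed E) (jM : forall a, j a \in M) (finM : finite_over j M) (pi : E).
Hypotheses (piM : pi \in M) (piI : pi \in I) (p_pi : p%:R / pi \in I) (uM : forall P : place, unif P M pi).

(** The last clause keeps the places under control, of which L may have
    infinitely many: over a class of places with the same centre on M, either
    all residue fields are perfect and need no further attention, or there is
    still a single class on L, and one element of L is enough to see that its
    residue field is not perfect. *)
Definition admissible (L : divringClosed E) := [/\ {subset M <= L}, forall P : place, unif P L pi &
  forall P0 : place, (forall P, same_center M P P0 -> perfect_at P L) \/ (forall P, same_center M P P0 -> same_center L P P0)].

Lemma admissible_M : admissible M.
Proof. by split=> // P0; right. Qed.

(** If no member of the chain has perfect residue fields over the class of P0,
    then the class splits in no member, hence not in the union. *)
Lemma union_field (F : set (set E)) : F !=set0%classic -> total_on F subset ->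
  (forall X, F X -> exists2 L : divringClosed E, admissible L & X = [set x | x \in L]%classic) ->
  exists2 L : divringClosed E, admissible L & (\bigcup_(X in F) X)%classic = [set x | x \in L]%classic.
Proof.
move=> [X0 FX0] Ftot FX.
pose U : {pred E} := fun x => `[< (\bigcup_(X in F) X)%classic x >].
have two x y : x \in U -> y \in U -> exists L : divringClosed E, [/\ admissible L, x \in L, y \in L & F [set x | x \in L]%classic].
  move=> /asboolP[X FXX Xx] /asboolP[Y FYY Yy].
  have [L Lad XL] := FX X FXX; have [L' Lad' YL'] := FX Y FYY.
  have [XY|YX] := Ftot _ _ FXX FYY.
    exists L'; split=> //; [|by move: Yy; rewrite YL'|by rewrite -YL'].
    by have := XY _ Xx; rewrite YL'.
  exists L; split=> //; [by move: Xx; rewrite XL| |by rewrite -XL].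
  by have := YX _ Yy; rewrite XL.
have inU (L : divringClosed E) x : F [set x | x \in L]%classic -> x \in L -> x \in U.
  by move=> FL xL; apply/asboolP; exists [set x | x \in L]%classic.
have [L0 L0ad X0L] := FX X0 FX0; rewrite X0L in FX0.
have Uc : divring_closed U.
  split.
  - by apply: inU FX0 _; rewrite rpred1.
  - by move=> x y xU yU; have [L [_ xL yL FL]] := two x y xU yU; apply: inU FL _; rewrite rpredB.
  - by move=> x y xU yU; have [L [_ xL yL FL]] := two x y xU yU; apply: inU FL _; rewrite rpredM ?rpredV.
pose UL : divringClosed E := HB.pack U (GRing.isDivringClosed.Build E U Uc).
have UP x : x \in UL -> exists L : divringClosed E, [/\ admissible L, x \in L & F [set x | x \in L]%classic].
  by move=> xU; have [L [h1 h2 _ h3]] := two x x xU xU; exists L.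
exists UL; last first.
  apply/seteqP; split=> x; first by move=> h; apply/asboolP.
  by move/asboolP.
have MU : {subset M <= UL} by case: L0ad => ML _ _ x xM; apply: inU FX0 _; apply: ML.
split=> //.
- move=> P; have [piO pir pi0 _] := uM P; split=> // x /UP[L [[_ uL _] xL _]] x0.
  by case: (uL P) => _ _ _; apply.
- move=> P0.
  have [[L [Lad FL pL]]|none] := pselect (exists L : divringClosed E, [/\ admissible L,
      F [set x | x \in L]%classic & forall P, same_center M P P0 -> perfect_at P L]).
    left=> P PP0; apply: perfect_at_ext (pL P PP0).
      by case: Lad => ML _ _ a; apply: ML.
    by move=> x xL; apply: inU FL xL.
  right=> P PP0 x /UP[L [Lad xL FL]] xI.
  case: (Lad) => ML uL /(_ P0)[pL|/(_ P PP0)]; first by exfalso; apply: none; exists L.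
  by move=> h; apply: h.
Qed.

Lemma maximal_admissible : exists2 L : divringClosed E, admissible L &
  forall L' : divringClosed E, admissible L' -> {subset L <= L'} -> {subset L' <= L}.
Proof.
pose PP (X : set E) := X = set0 \/ exists2 L : divringClosed E, admissible L & X = [set x | x \in L]%classic.
have [|X [PX Xmax]] := @Zorn_bigcup E PP.
  move=> F FP Ftot.
  have [[X FX X0]|none] := pselect (exists2 X, F X & X !=set0)%classic; last first.
    apply: or_introl; apply/seteqP; split=> // x [X FX Xx]; apply: none; exists X => //; by exists x.
  apply: or_intror.
  pose F' : set (set E) := fun Y => F Y /\ Y !=set0%classic.
  have -> : (\bigcup_(X in F) X = \bigcup_(X in F') X)%classic.
    apply/seteqP; split=> x [Y]; first by move=> FY Yx; exists Y => //; split=> //; exists x.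
    by move=> [FY _] Yx; exists Y.
  apply: union_field.
  - by exists X; split.
  - by move=> Y Z [FY _] [FZ _]; apply: Ftot.
  - by move=> Y [FY [y Yy]]; case: (FP _ FY) => // Y0; rewrite Y0 in Yy.
have Mset : PP [set x | x \in M]%classic by apply: or_intror; exists M => //; apply: admissible_M.
case: PX => [X0|[L Lad XL]].
  exfalso; apply: (Xmax [set x | x \in M]%classic) => //; rewrite X0; split=> // /(_ 0).
  by apply; rewrite /= rpred0.
exists L => // L' Lad' LL' x xL'; apply: contrapT => nx.
apply: (Xmax [set x | x \in L']%classic); last by apply: or_intror; exists L'.
rewrite XL; split; first by move=> y /= yL; apply: LL'.
by move=> /(_ x xL').
Qed.

Variable L : divringClosed E.
Hypothesis Lad : admissible L.
Hypothesis Lmax : forall L' : divringClosed E, admissible L' -> {subset L <= L'} -> {subset L' <= L}.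

Let ML : {subset M <= L}. Proof. by case: Lad. Qed.
Let jL a : j a \in L. Proof. exact: ML. Qed.
Let uL (P : place) : unif P L pi. Proof. by case: Lad. Qed.

Lemma exists_root r a : exists y, root (asp r a) y.
Proof.
have [|y] := @closed_rootP E (asp r a) _; last by exists y.
by rewrite asp_size eqSS -lt0n.
Qed.

(** Let J be the set of classes of places of M over which L has perfect
    residue fields. For i not in J choose b_i in L whose residue is not a p-th
    power. With separating elements q_i of M, put a = sum q_i^p b_i and let r
    be the sum of the q_i for i in J. A root y of X^p + r X - a generates an
    etale extension over the classes in J and a p-th root of a non-power on
    residues over the others. So L(y) is admissible and y lies in L by
    maximality. But then over the classes outside J the residue of a is a p-th
    power. *)
Lemma all_perfect (P : place) : perfect_at P L.
Proof.
apply: contrapT => nP.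
have [n [Ps [ne Hcov]]] := places_finite B jM finM.
have [q Hq] := places_separated B jM ne.
pose J i := `[< forall P', same_center M P' (Ps i) -> perfect_at P' L >].
have Juniq i P' : ~~ J i -> same_center M P' (Ps i) -> same_center L P' (Ps i).
  move=> /asboolP nJ; case: Lad => _ _ /(_ (Ps i))[//|]; by apply.
have /choice[b Hb] : forall i, exists b, [/\ b \in L, b \in I, J i -> b = 0 & ~~ J i ->
    forall P', same_center M P' (Ps i) -> forall d, d \in resfield P' L -> d ^+ p != res P' b].
  move=> i; have [Ji|nJ] := boolP (J i); first by exists 0; rewrite !rpred0.
  have [P1 P1i nP1] : exists2 P1, same_center M P1 (Ps i) & ~ perfect_at P1 L.
    apply: contrapT => H; move/asboolP: nJ; apply=> P1 P1i; apply: contrapT => h; apply: H; by exists P1.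
  have [b [bL bI bn]] := not_perfect_at jL nP1.
  exists b; split=> // _ P' P'i d dK.
  have e1 := Juniq i P1 nJ P1i; have e2 := Juniq i P' nJ P'i.
  have e3 := same_center_trans e1 (same_center_sym e2).
  by apply: (same_center_nonpow B jL e3) dK => //; apply: valO_int.
pose a := \sum_(i < n) q i ^+ p * b i.
pose r := \sum_(i < n | J i) q i.
have qP (i : 'I_n) := Hq i (ltn_ord i).
have aL : a \in L by apply: rpred_sum => i _; case: (qP i) => h _ _ _; case: (Hb i) => h' _ _ _; rewrite rpredM ?rpredX // ML.
have aI : a \in I by apply: rpred_sum => i _; case: (qP i) => _ h _ _; case: (Hb i) => _ h' _ _; rewrite rpredM ?rpredX.
have rL : r \in L by apply: rpred_sum => i _; case: (qP i) => h _ _ _; rewrite ML.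
have rI : r \in I by apply: rpred_sum => i _; case: (qP i).
have qr (P' : place) i l : (i < n)%N -> (l < n)%N -> same_center M P' (Ps i) -> l != i -> res P' (q l) = 0.
  move=> iltn lltn Pi li; case: (Hq l lltn) => qM qI _ H; apply/(Pi _ qM qI).
  by apply: H => //; rewrite eq_sym.
have qr0 (P' : place) i : (i < n)%N -> same_center M P' (Ps i) -> res P' (q i) != 0.
  by move=> iltn Pi; case: (Hq i iltn) => qM qI h _; apply: contraNneq h => h; apply/eqP/Pi.
have qO (P' : place) (i : 'I_n) : q i \in valO P' by apply: valO_int; case: (qP i).
have bO (P' : place) i : b i \in valO P' by apply: valO_int; case: (Hb i).
have resr (P' : place) i : (i < n)%N -> same_center M P' (Ps i) -> res P' r = if J i then res P' (q i) else 0.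
  move=> iltn Pi; rewrite /r res_sum; last by move=> l _; apply: qO.
  case: ifP => Ji.
    rewrite (bigD1 (Ordinal iltn)) //= big1 ?addr0 // => l /andP[_ li].
    by apply: (qr _ i) => //; move: li; rewrite -(inj_eq val_inj).
  rewrite big1 // => l Jl; apply: (qr _ i) => //.
  by apply: contraFneq Ji => <-.
have resa (P' : place) i : (i < n)%N -> same_center M P' (Ps i) -> res P' a = res P' (q i) ^+ p * res P' (b i).
  move=> iltn Pi; rewrite /a res_sum; last by move=> l _; apply: rpredM; [apply: rpredX; exact: qO|exact: bO].
  rewrite (bigD1 (Ordinal iltn)) //= big1 ?addr0; last first.
    move=> l li; rewrite resM ?rpredX ?qO ?bO // resX ?qO // (qr _ i) //; first by rewrite expr0n eqn0Ngt p0 mul0r.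
  have qiO := qO P' (Ordinal iltn); rewrite /= in qiO.
  by rewrite resM ?rpredX ?bO // resX.
have na (P' : place) i : (i < n)%N -> same_center M P' (Ps i) -> ~~ J i -> forall d, d \in resfield P' L -> d ^+ p != res P' a.
  move=> iltn Pi nJ d dK; rewrite (resa _ i) //.
  have q0 := qr0 P' i iltn Pi.
  case: (Hb i) => _ _ _ /(_ nJ P' Pi (d / res P' (q i))) H.
  have qK : res P' (q i) \in resfield P' L.
    by apply: mem_resfield; rewrite ?(qO _ (Ordinal iltn)) // ML //; case: (Hq i iltn).
  have dqK : d / res P' (q i) \in resfield P' L by rewrite rpredM ?rpredV.
  apply: contraNneq (H dqK) => e.
  by rewrite expr_div_n e mulrC mulKf // expf_neq0.
have [y ry] := exists_root r a.
pose L' := adj B jL y.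
have L'ad : admissible L'.
  split; first by move=> x xM; apply: sub_adj; apply: ML.
  - move=> P'; have [i iltn Pi] := Hcov P'; have rr := resr P' i iltn Pi.
    have [Ji|nJ] := boolP (J i).
      apply: asp_etale (ML piM) (uL P') rL rI aL aI ry _.
      by rewrite rr Ji qr0.
    apply: asp_fierce (uL P') rL rI aL aI ry _ _; first by rewrite rr (negbTE nJ).
    exact: (na P' i).
  move=> P0; have [i iltn Pi] := Hcov P0.
  have [Ji|nJ] := boolP (J i).
    left=> P' P'P0; apply: (perfect_at_ext jL); first exact: sub_adj.
    by move/asboolP: Ji; apply; apply: same_center_trans P'P0 Pi.
  right=> P' P'P0.
  have P'i := same_center_trans P'P0 Pi.
  have e1 := Juniq i P' nJ P'i; have e2 := Juniq i P0 nJ Pi.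
  have r1 := resr P' i iltn P'i; have r2 := resr P0 i iltn Pi; rewrite (negbTE nJ) in r1 r2.
  have n1 := na P' i iltn P'i nJ; have n2 := na P0 i iltn Pi nJ.
  have e3 : same_center L P' P0 := same_center_trans e1 (same_center_sym e2).
  move=> x xL' xI; split.
    exact: (asp_fierce_eq (uL P') (uL P0) rL rI aL aI ry r1 n1 r2 n2 e3 xL' xI).
  exact: (asp_fierce_eq (uL P0) (uL P') rL rI aL aI ry r2 n2 r1 n1 (same_center_sym e3) xL' xI).
have yL : y \in L by apply: (Lmax L'ad); [exact: sub_adj|exact: mem_adj].
have [i iltn Pi] := Hcov P.
have nJ : ~~ J i by apply/negP => /asboolP h; apply: nP; apply: h.
have := na P i iltn Pi nJ (res P y) (mem_resfield yL (valO_int P (asp_int rI aI ry))).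
by rewrite (asp_res rI aI ry) ?eqxx // (resr P i) // (negbTE nJ).
Qed.

(** Such an extension is etale at all places, and the residue fields stay
    perfect. *)
Lemma etale_closed r a y : r \in L -> r \in I -> a \in L -> a \in I -> root (asp r a) y ->
  (forall P : place, res P r != 0) -> y \in L.
Proof.
move=> rL rI aL aI ry r0; suff h : admissible (adj B jL y).
  by apply: (Lmax h); [exact: sub_adj|exact: mem_adj].
split; first by move=> x xM; apply: sub_adj; apply: ML.
- by move=> P; apply: asp_etale (ML piM) (uL P) rL rI aL aI ry _.
by move=> P0; left=> P _; apply: (perfect_at_ext jL); [exact: sub_adj|exact: all_perfect].
Qed.

(** By [all_perfect] some z in L satisfies z^p = a on residues; write z = e /
    t with e, t integral. Let M2 = M(e, t), of finite degree, and let q_i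
    separate its places, the class of P being i0. Take r = q_i0 t + (sum of
    the other q_i), which is a unit at all places, and e' = q_i0 e. On
    residues at P, z is a root of X^p + r X - (a + e'), because r z = e'
    there. As this polynomial splits in L by [etale_closed], with integral
    roots, z is congruent to one of them. *)
Lemma frobenius_surj (P : place) a : a \in L -> a \in I ->
  exists c, [/\ c \in L, c \in I & res P (c ^+ p - a) = 0].
Proof.
move=> aL aI; have aO := valO_int P aI.
have [d /resfieldP[z [zL zO zd]] da] := all_perfect (mem_resfield aL aO).
have [e [t [eL eI tL tI [t0 ze]]]] := frac_rep B jL zL zO.
pose M1 := adj B jM e.
have jM1 c : j c \in M1 by apply: sub_adj.
pose M2 := adj B jM1 t.
have jM2 c : j c \in M2 by apply: sub_adj.
have finM2 : finite_over j M2 by do 2!apply: finite_over_adj.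
have M2L : {subset M2 <= L} by apply: adj_min => //; apply: adj_min.
have [n [Ps [ne Hcov]]] := places_finite B jM2 finM2.
have [q Hq] := places_separated B jM2 ne.
have qP (i : 'I_n) := Hq i (ltn_ord i).
have [i0 i0n Pi0] := Hcov P.
have [qiM qiI _ _] := Hq i0 i0n.
pose r := q i0 * t + \sum_(l < n | (l : nat) != i0) q l.
pose e' := q i0 * e.
have sI : \sum_(l < n | (l : nat) != i0) q l \in I by apply: rpred_sum => l _; case: (qP l).
have sL : \sum_(l < n | (l : nat) != i0) q l \in L by apply: rpred_sum => l _; apply: M2L; case: (qP l).
have rI : r \in I by rewrite rpredD ?rpredM.
have rL : r \in L by rewrite rpredD ?rpredM // M2L.
have e'I : e' \in I by rewrite rpredM.
have e'L : e' \in L by rewrite rpredM // M2L.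
have qr (P' : place) i l : (i < n)%N -> (l < n)%N -> same_center M2 P' (Ps i) -> l != i -> res P' (q l) = 0.
  move=> iltn lltn Pi li; case: (Hq l lltn) => qM qI _ H; apply/(Pi _ qM qI).
  by apply: H => //; rewrite eq_sym.
have qr0 (P' : place) i : (i < n)%N -> same_center M2 P' (Ps i) -> res P' (q i) != 0.
  by move=> iltn Pi; case: (Hq i iltn) => qM qI h _; apply: contraNneq h => h; apply/eqP/Pi.
have qO (P' : place) (i : 'I_n) : q i \in valO P' by apply: valO_int; case: (qP i).
have resr (P' : place) : res P' r = res P' (q i0) * res P' t + \sum_(l < n | (l : nat) != i0) res P' (q l).
  by rewrite /r resD ?rpredM ?valO_int // resM ?valO_int // res_sum.
have r0 (P' : place) : res P' r != 0.
  have [i iltn Pi] := Hcov P'; rewrite resr.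
  have [ii0|ii0] := eqVneq i i0.
    rewrite ii0 in Pi iltn; rewrite big1 ?addr0; last by move=> l li; apply: (qr _ i0).
    rewrite mulf_neq0 ?qr0 //.
    have := same_center_trans Pi0 (same_center_sym Pi) => h; apply: contraNneq t0 => h'.
    by apply/eqP/(h t) => //; apply: mem_adj.
  rewrite (qr _ i i0) ?mul0r ?add0r //; last by rewrite eq_sym.
  rewrite (bigD1 (Ordinal iltn)) //= big1 ?addr0 ?qr0 // => l /andP[_ li].
  by apply: (qr _ i) => //; move: li; rewrite -(inj_eq val_inj).
have aeL : a + e' \in L by rewrite rpredD.
have aeI : a + e' \in I by rewrite rpredD.
have [rs fe] := closed_field_poly_normal (asp r (a + e')).
rewrite (monicP (asp_monic _ _)) scale1r in fe.
have rsL y : y \in rs -> y \in L /\ y \in I.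
  move=> yrs; have ry : root (asp r (a + e')) y by rewrite fe root_prod_XsubC.
  by split; [apply: etale_closed rL rI aeL aeI ry r0|apply: asp_int rI aeI ry].
have tn0 : t != 0 by apply: contraNneq t0 => ->; rewrite res0.
have fz : res P (asp r (a + e')).[z] = 0.
  have rr : res P r = res P (q i0) * res P t.
    by rewrite resr big1 ?addr0 // => l li; apply: (qr _ i0).
  have rO := valO_int P rI; have e'O := valO_int P e'I; have tO := valO_int P tI; have eO := valO_int P eI.
  have qO' := valO_int P qiI.
  rewrite asp_horner resB ?rpredD ?rpredM ?rpredX // resD ?rpredM ?rpredX // resX // zd da.
  rewrite resM // rr resD // /e' resM //.
  have -> : res P e = res P z * res P t by rewrite -resM // ze divfK.
  by ring.
have [y yrs zy] : exists2 y, y \in rs & res P (z - y) = 0.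
  move: fz; rewrite fe horner_prod; elim: rs rsL {fe} => [|y rs IH] rsL.
    by rewrite big_nil res1 => /eqP; rewrite oner_eq0.
  have [_ yI] := rsL y (mem_head _ _).
  have tO : \prod_(l <- rs) ('X - l%:P).[z] \in valO P.
    rewrite big_seq; apply: rpred_prod => l lrs; have lrs' : l \in y :: rs by rewrite in_cons lrs orbT.
    by have [_ lI] := rsL l lrs'; rewrite hornerXsubC; apply: rpredB => //; exact: valO_int.
  have zyO : z - y \in valO P by apply: rpredB => //; exact: valO_int.
  rewrite big_cons hornerXsubC resM //.
  move/eqP; rewrite mulf_eq0 => /orP[/eqP h|/eqP h]; first by exists y; rewrite ?mem_head.
  have [|y' y'rs hy'] := IH _ h; last by exists y'; rewrite // inE y'rs orbT.
  by move=> l lrs; apply: rsL; rewrite inE lrs orbT.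
have [yL yI] := rsL y yrs; exists y; split=> //.
have yO := valO_int P yI.
have yz : res P y = res P z by apply/eqP; rewrite eq_sym -subr_eq0 -resB // zy.
by rewrite resB ?rpredX // resX // yz zd da subrr.
Qed.

Definition integers_of_pred : {pred E} := fun x => (x \in L) && (x \in I).
Lemma integers_of_closed : subring_closed integers_of_pred.
Proof.
split; first by rewrite unfold_in !rpred1.
- by move=> x y /andP[xL xI] /andP[yL yI]; apply/andP; rewrite !rpredB.
- by move=> x y /andP[xL xI] /andP[yL yI]; apply/andP; rewrite !rpredM.
Qed.
Definition integers_of : subringClosed E := HB.pack integers_of_pred (GRing.isSubringClosed.Build E integers_of_pred integers_of_closed).

Let pi0 : pi != 0. Proof. by have [P _] := place_inh B; case: (uM P). Qed.

Lemma pi_nonunit : pi^-1 \notin I.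
Proof.
have [P _] := place_inh B; case: (uM P) => piO pir _ _; apply/negP => h.
have : res P (pi * pi^-1) = 1 by rewrite divff // res1.
by rewrite resM ?valO_int // pir mul0r => /esym/eqP; rewrite oner_eq0.
Qed.

(** If pi divides x^n then x has positive value at all places, and x / pi has
    no pole because pi is a uniformizer of L. As p (x / pi) is integral, x /
    pi is integral. *)
Lemma reduced_mod_pi x n : x \in L -> x \in I -> x ^+ n / pi \in I -> x / pi \in I.
Proof.
move=> xL xI xn.
have n0 : (0 < n)%N.
  by rewrite lt0n; apply: contraL xn => /eqP ->; rewrite expr0 mul1r pi_nonunit.
have [|a na aI] := @int_of_places _ _ _ _ B (x / pi).
  move=> P; apply: (unif_div (uL P)) => //; first exact: valO_int.
  case: (uM P) => piO pir _ _.
  have : res P (x ^+ n / pi * pi) = 0 by rewrite resM ?valO_int // pir mulr0.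
  by rewrite divfK // resX ?valO_int // => /eqP; rewrite expf_eq0 => /andP[_ /eqP].
apply: (int_of_coprime B na aI).
by rewrite mulrCA mulrC rpredM.
Qed.

(** Apply [place_exists] to the multiples of pi and to the products c t with c
    in A prime to p and t outside Q. These are disjoint: if pi divides c t
    then, as it divides p, it divides t by [int_of_coprime], and t lies in
    Q. *)
Lemma place_below (Q : prime_idealr (subdom integers_of)) (pi' : subdom integers_of) : val pi' = pi -> pi' \in Q ->
  exists P : place, forall x : subdom integers_of, res P (val x) = 0 -> x \in Q.
Proof.
move=> pi'E pi'Q.
pose Id := subdom I.
pose a : set Id := fun x => val x / pi \in I.
pose s : set Id := fun x => exists c (t : subdom integers_of), [/\ ~ dv c, t \notin Q & val x = j c * val t].
have s1 c (x : Id) : ~ dv c -> val x = j c -> s x.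
  by move=> nc xc; exists c, 1; rewrite idealr1 rmorph1 mulr1.
have [|x y|r x|x y|x|x xp|x b nb xb|P [_ sP]] := @place_exists _ _ _ _ B a s.
- by rewrite /a rmorph0 mul0r rpred0.
- by rewrite /a => h k; rewrite rmorphD mulrDl; apply: rpredD.
- by rewrite /a => h; rewrite rmorphM -mulrA; apply: rpredM => //; apply: valP.
- move=> [c [t [nc nt xe]]] [c' [t' [nc' nt' ye]]]; exists (c * c'), (t * t'); split.
  + by move/(br_pM B) => [].
  + by rewrite prime_idealrM negb_or nt nt'.
  + by rewrite !rmorphM /=; rewrite /= in xe ye; rewrite xe ye mulrACA.
- rewrite /a => ax [c [t [nc nt xe]]].
  case/negP: nt.
  have tLI := valP t; case/andP: (tLI : integers_of_pred (val t)) => tL tI.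
  have tpi : val t / pi \in I.
    apply: (int_of_coprime B nc); first by rewrite mulrA -xe.
    by rewrite mulrCA mulrC rpredM.
  have h : val t / pi \in integers_of by apply/andP; rewrite rpredM ?rpredV // ML.
  have -> : t = Subdom h * pi' by apply: val_inj; rewrite rmorphM /= [subdom_val pi']pi'E divfK.
  exact: idealMr.
- by rewrite /a xp.
- exact: s1 nb xb.
exists P => x xr; apply: contraT => nx.
have xLI := valP x; case/andP: (xLI : integers_of_pred (val x)) => xL xI.
have := sP (Subdom xI) _; rewrite /= xr eqxx; apply.
by exists 1, x; rewrite rmorph1 mul1r; split=> //; exact: br_p1 B.
Qed.
End Maximal.
End Core.

(** * Primes in a Noetherian local ring *)

Section Noetherian.
Variable R : comNzRingType.
Hypothesis noeth : noetherian R.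

Lemma ideal_acc (f : nat -> idealr R) : (forall n, {subset f n <= f n.+1}) ->
  exists n, {subset f n.+1 <= f n}.
Proof.
move=> finc.
have fle n k : (n <= k)%N -> {subset f n <= f k}.
  elim: k => [|k IH]; first by rewrite leqn0 => /eqP ->.
  rewrite leq_eqVlt => /orP[/eqP->//|]; rewrite ltnS => /IH h x /h; exact: finc.
pose U : {pred R} := fun x => `[< exists n, x \in f n >].
have Uc : idealr_closed U.
  split; first by apply/asboolP; exists 0%N; rewrite rpred0.
  - by apply/asboolP => -[n]; rewrite idealr1.
  - move=> a x y /asboolP[n xn] /asboolP[k yk]; apply/asboolP; exists (maxn n k).
    by rewrite rpredD ?idealMr //; [apply: (fle n)|apply: (fle k)]; rewrite ?leq_maxl ?leq_maxr.
pose UI : idealr R := HB.pack U (isIdealr.Build R U Uc).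
have [s Hs] := noeth UI.
have sU i : (i < size s)%N -> exists n, s`_i \in f n.
  move=> lt; have : s`_i \in UI.
    apply/Hs; exists (fun l => ((l : nat) == i)%:R).
    rewrite (bigD1 (Ordinal lt)) //= eqxx mul1r big1 ?addr0 // => l.
    by rewrite -(inj_eq val_inj) /= => /negbTE ->; rewrite mul0r.
  by move/asboolP.
have [N HN] : exists N, forall i, (i < size s)%N -> s`_i \in f N.
  elim: (size s) sU => [|n IH] sU; first by exists 0%N.
  have [|N HN] := IH; first by move=> i lt; apply: sU; apply: ltnW.
  have [k Hk] := sU n (ltnSn n); exists (maxn N k) => i; rewrite ltnS leq_eqVlt => /orP[/eqP->|lt].
    by apply: (fle k); rewrite ?leq_maxr.
  by apply: (fle N); rewrite ?leq_maxl ?HN.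
exists N => x xN; have : x \in UI by apply/asboolP; exists N.+1.
case/Hs => c ->; apply: rpred_sum => i _; apply: idealMr; exact: HN.
Qed.

(** Terms of type [idealr R] are proper ideals, and so the unit ideal takes no
    part in the induction. *)
Lemma noetherian_ind (Q : idealr R -> Prop) :
  (forall I : idealr R, (forall J : idealr R, {subset I <= J} -> ~ {subset J <= I} -> Q J) -> Q I) -> forall I, Q I.
Proof.
move=> H I0; apply: contrapT => nQ.
have step : forall I : {I : idealr R | ~ Q I}, exists J : {J : idealr R | ~ Q J},
   {subset sval I <= sval J} /\ ~ {subset sval J <= sval I}.
  move=> [I nI]; apply: contrapT => nJ; apply: (nI); apply: (H) => J IJ nJI; apply: contrapT => nQJ.
  by apply: nJ; exists (exist _ J nQJ).
have [g Hg] := choice step.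
pose f n := iter n g (exist _ I0 nQ).
have [|n fn] := @ideal_acc (fun n => sval (f n)).
  by move=> n; case: (Hg (f n)).
by case: (Hg (f n)) => _; apply.
Qed.

Definition addp (I : idealr R) (x : R) : {pred R} := fun z => `[< exists i r, i \in I /\ z = i + r * x >].
Lemma addp_sub (I : idealr R) x z : z \in I -> z \in addp I x.
Proof. by move=> zI; apply/asboolP; exists z, 0; rewrite mul0r addr0. Qed.
Lemma addp_mem (I : idealr R) x : x \in addp I x.
Proof. by apply/asboolP; exists 0, 1; rewrite mul1r add0r rpred0. Qed.

Lemma addp_ideal (I : idealr R) x : 1 \notin addp I x -> exists J : idealr R, forall z, z \in J <-> z \in addp I x.
Proof.
move=> n1; have c : idealr_closed (addp I x).
  split=> //; first by apply: addp_sub; rewrite rpred0.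
  move=> a u v /asboolP[i [r [iI ->]]] /asboolP[i' [r' [iI' ->]]]; apply/asboolP.
  exists (a * i + i'), (a * r + r'); rewrite rpredD ?idealMr //; split=> //; ring.
pose J : idealr R := HB.pack (addp I x) (isIdealr.Build R (addp I x) c).
by exists J.
Qed.

(** If a b lies in I but a and b do not, concatenate the lists of primes
    obtained for I + (a) and I + (b). Both ideals are proper because their
    product lies in I. *)
Lemma prime_product (I : idealr R) : exists n (Qs : nat -> prime_idealr R),
  (forall i, (i < n)%N -> {subset I <= Qs i}) /\
  forall t : nat -> R, (forall i, (i < n)%N -> t i \in Qs i) -> \prod_(i < n) t i \in I.
Proof.
elim/noetherian_ind: I => I IH.
have [pI|npI] := pselect (prime_idealr_closed I).
  pose Ic : idealr_closed I := And3 (rpred0 _) (negbT (idealr1 _))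
     (fun a x y xI yI => rpredD (idealMr a xI) yI).
  pose Q : prime_idealr R := HB.pack (I : {pred R}) (isIdealr.Build R I Ic) (isPrimeIdealrClosed.Build R I pI).
  exists 1%N, (fun=> Q); split; first by move=> i _ z.
  move=> t H; rewrite big_ord1; exact: (H 0%N).
have [a [b [abI aI bI]]] : exists a b, [/\ a * b \in I, a \notin I & b \notin I].
  apply: contrapT => H; apply: npI => a b abI; apply: contraT; rewrite negb_or => /andP[na nb].
  by exfalso; apply: H; exists a, b.
have proper x y : x * y \in I -> y \notin I -> 1 \notin addp I x.
  move=> xyI yI; apply: contra yI => /asboolP[i [r [iI e]]].
  rewrite -[y]mul1r e mulrDl; apply: rpredD; first by rewrite mulrC idealMr.
  by rewrite -mulrA idealMr.
have [Ja HJa] := addp_ideal (proper a b abI bI).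
have [Jb HJb] : exists J : idealr R, forall z, z \in J <-> z \in addp I b.
  by apply: addp_ideal; apply: (proper b a) => //; rewrite mulrC.
have [n [Qa [Qa1 Qa2]]] : exists n (Qs : nat -> prime_idealr R),
  (forall i, (i < n)%N -> {subset Ja <= Qs i}) /\
  forall t : nat -> R, (forall i, (i < n)%N -> t i \in Qs i) -> \prod_(i < n) t i \in Ja.
  apply: IH; first by move=> z zI; apply/HJa/addp_sub.
  by move=> h; case/negP: aI; apply: h; apply/HJa/addp_mem.
have [k [Qb [Qb1 Qb2]]] : exists n (Qs : nat -> prime_idealr R),
  (forall i, (i < n)%N -> {subset Jb <= Qs i}) /\
  forall t : nat -> R, (forall i, (i < n)%N -> t i \in Qs i) -> \prod_(i < n) t i \in Jb.
  apply: IH; first by move=> z zI; apply/HJb/addp_sub.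
  by move=> h; case/negP: bI; apply: h; apply/HJb/addp_mem.
exists (n + k)%N, (fun i => if (i < n)%N then Qa i else Qb (i - n)%N); split.
  move=> i lt z zI; case: ltnP => h; first by apply: Qa1 => //; apply/HJa/addp_sub.
  by apply: Qb1; [rewrite ltn_subLR|apply/HJb/addp_sub].
move=> t Ht; rewrite big_split_ord /=.
have ta : \prod_(i < n) t i \in Ja.
  by apply: Qa2 => i lt; have := Ht i (ltn_addr _ lt); rewrite lt.
have tb : \prod_(i < k) t (n + i)%N \in Jb.
  apply: (Qb2 (fun i => t (n + i)%N)) => i lt; have := Ht (n + i)%N; rewrite ltn_add2l => /(_ lt).
  by rewrite ltnNge leq_addr /= addKn.
have /asboolP[i1 [r1 [i1I ->]]] := (HJa _).1 ta.
have /asboolP[i2 [r2 [i2I ->]]] := (HJb _).1 tb.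
rewrite (_ : _ * _ = (i2 + r2 * b) * i1 + ((r1 * a) * i2 + (r1 * r2) * (a * b))); last by ring.
by apply: rpredD; [exact: idealMr|apply: rpredD; exact: idealMr].
Qed.

Lemma prime_avoid (m : idealr R) n (Qs : nat -> prime_idealr R) :
  (forall i, (i < n)%N -> exists2 z, z \in m & z \notin Qs i) -> exists2 z, z \in m & forall i, (i < n)%N -> z \notin Qs i.
Proof.
elim: n Qs => [|n IH] Qs H; first by exists 0; rewrite ?rpred0.
have [|z zm zQ] := IH Qs; first by move=> i lt; apply: H; apply: ltnW.
have [zn|zn] := boolP (z \in Qs n); last first.
  by exists z => // i; rewrite ltnS leq_eqVlt => /orP[/eqP->|/zQ].
have [w wm wn] := H n (ltnSn n).
have [[i [ilt Qin]]|nsub] := pselect (exists i, (i < n)%N /\ {subset Qs i <= Qs n}).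
  have [|v vm vQ] := IH (fun l => if l == i then Qs n else Qs l).
    by move=> l lt; case: eqP => _; apply: H => //; apply: ltnW.
  exists v => // l; rewrite ltnS leq_eqVlt => /orP[/eqP->|lt].
    by have := vQ i ilt; rewrite eqxx.
  have := vQ l lt; case: eqP => // -> h.
  by apply: contra h; apply: Qin.
have /choice[v Hv] : forall i, exists v, (i < n)%N -> v \in Qs i /\ v \notin Qs n.
  move=> i; have [lt|] := boolP (i < n)%N; last by exists 0.
  apply: contrapT => h; apply: nsub; exists i; split=> // x xi; apply: contraT => xn.
  by exfalso; apply: h; exists x.
exists (z + w * \prod_(i < n) v i); first by rewrite rpredD // mulrC idealMr.
move=> i; rewrite ltnS leq_eqVlt => /orP[/eqP->|lt].
  rewrite (rpredDl _ zn) prime_idealrM negb_or wn /=.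
  apply: (big_ind (fun x => x \notin Qs n)).
  - by rewrite idealr1.
  - by move=> x y hx hy; rewrite prime_idealrM negb_or hx.
  - by move=> l _; case: (Hv l (ltn_ord l)).
have vi : w * \prod_(l < n) v l \in Qs i.
  apply: idealMr; rewrite (bigD1 (Ordinal lt)) //= mulrC idealMr //.
  by case: (Hv i lt).
by rewrite (rpredDr _ vi) zQ.
Qed.

Section Local.
Variable m : idealr R.
Hypothesis mloc : local_ring m.

Lemma ideal_sub_max (I : idealr R) : {subset I <= m}.
Proof.
have [_ mmax muniq] := mloc.
elim/noetherian_ind: I => I IH.
have [Imax|nI] := pselect (maximal_ideal I).
  by move=> x xI; rewrite -(muniq I Imax).
have [J IJ nJI] : exists2 J : idealr R, {subset I <= J} & ~ {subset J <= I}.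
  apply: contrapT => H; apply: nI => J IJ; apply: contrapT => nJI; apply: H; by exists J.
by move=> x /IJ; apply: IH IJ nJI x.
Qed.

Lemma max_prime : prime_idealr_closed m.
Proof.
have [_ mmax _] := mloc => a b abm; apply: contraT; rewrite negb_or => /andP[na nb].
have [h|h] := boolP (1 \in addp m a).
  case/asboolP: h => i [r [im e]]; case/negP: nb.
  rewrite -[b]mul1r e mulrDl; apply: rpredD; first by rewrite mulrC idealMr.
  by rewrite -mulrA idealMr.
have [J HJ] := addp_ideal h; case/negP: na.
by apply: (mmax J) => [z zm|]; apply/HJ; [exact: addp_sub|exact: addp_mem].
Qed.

Lemma notin_max_unit a : a \notin m -> exists b, b * a = 1.
Proof.
pose z : {pred R} := pred1 0.
have zc : idealr_closed z.
  split; rewrite ?inE ?eqxx ?oner_eq0 //.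
  by move=> r x y; rewrite !inE => /eqP-> /eqP->; rewrite mulr0 addr0.
pose zI : idealr R := HB.pack z (isIdealr.Build R z zc).
move=> na; have [/asboolP[i [r [i0 e]]]|h] := boolP (1 \in addp zI a).
  by exists r; rewrite e (eqP i0) add0r.
have [J HJ] := addp_ideal h; case/negP: na.
by apply: (ideal_sub_max (I := J)); apply/HJ/addp_mem.
Qed.

(** A strictly increasing chain of primes from P to m, the elements xs being
    witnesses of strictness. *)
Fixpoint chain (xs : seq R) (P : prime_idealr R) : Prop :=
  if xs is x :: ys then x \notin P /\ exists P' : prime_idealr R, [/\ {subset P <= P'}, x \in P' & chain ys P']
  else forall z, z \in P = (z \in m).

Definition gen_over (I : {pred R}) (xs : seq R) z :=
  exists i (c : nat -> R), i \in I /\ z = i + \sum_(k < size xs) c k * xs`_k.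

(** Choose x in m outside the primes, other than m, of [prime_product] for I,
    and apply the induction hypothesis to I + (x). The prime P' that comes
    with it contains one of the primes of the product, and this one can be put
    in front of the chain. *)
Lemma system_of_parameters (I : idealr R) : exists xs : seq R,
  [/\ all (fun x => x \in m) xs,
      exists c, forall z, ideal_power m c z -> gen_over I xs z &
      exists P : prime_idealr R, {subset I <= P} /\ chain xs P].
Proof.
elim/noetherian_ind: I => I IH.
have [n [Qs [Q1 Q2]]] := prime_product I.
have [[i [ilt nmi]]|allm] := pselect (exists i, (i < n)%N /\ ~ {subset m <= Qs i}); last first.
  exists [::]; split=> //.
    exists n => z [s [sm ->]]; exists (\sum_(u <- s) u.1 * \prod_(y <- u.2) y), (fun=> 0).
    rewrite big_ord0 addr0; split=> //; rewrite big_seq; apply: rpred_sum => u us.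
    apply: idealMr; rewrite big_tuple.
    rewrite (eq_bigr (fun i : 'I_n => nth 0 u.2 i)); last by move=> i _; rewrite (tnth_nth 0).
    apply: (Q2 (nth 0 u.2)) => i ilt; have h : {subset m <= Qs i} by apply: contrapT => h; apply: allm; exists i.
    by apply: h; apply: (sm u us); rewrite mem_nth // size_tuple.
  have mc : idealr_closed m := And3 (rpred0 _) (negbT (idealr1 _))
     (fun a x y xI yI => rpredD (idealMr a xI) yI).
  pose P : prime_idealr R := HB.pack (m : {pred R}) (isIdealr.Build R m mc) (isPrimeIdealrClosed.Build R m max_prime).
  by exists P; split=> //; apply: ideal_sub_max.
pose Qs' l := if pselect ((l < n)%N /\ ~ {subset m <= Qs l}) then Qs l else Qs i.
have [|x xm xQ] := @prime_avoid m n Qs'.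
  move=> l _; have h : ~ {subset m <= Qs' l} by rewrite /Qs'; case: pselect => [[]|].
  apply: contrapT => h'; apply: h => z zm; apply: contraT => zn; exfalso; apply: h'; by exists z.
have xQs l : (l < n)%N -> ~ {subset m <= Qs l} -> x \notin Qs l.
  by move=> ln nl; have := xQ l ln; rewrite /Qs'; case: pselect => // -[].
have n1 : 1 \notin addp I x.
  apply/asboolP => -[i0 [r [iI e]]]; have : 1 \in m.
    by rewrite e; apply: rpredD; [exact: (ideal_sub_max iI)|exact: idealMr].
  by rewrite idealr1.
have [J HJ] := addp_ideal n1.
have [|h|ys [ysm [c Hc] [P' [JP' ch]]]] := IH J.
- by move=> z zI; apply/HJ/addp_sub.
- have xi := xQs i ilt nmi; case/negP: xi; apply: (Q1 i ilt); apply: h; apply/HJ/addp_mem.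
have IP' : {subset I <= P'} by move=> z zI; apply: JP'; apply/HJ/addp_sub.
have xP' : x \in P' by apply: JP'; apply/HJ/addp_mem.
exists (x :: ys); split; first by rewrite /= xm.
  exists c => z /Hc[z1 [d [/HJ/asboolP[i0 [r [iI ->]]] ->]]].
  exists i0, (fun k => if k is k'.+1 then d k' else r); split=> //.
  by rewrite big_ord_recl /= addrA.
have [l [ln nml QP]] : exists l, [/\ (l < n)%N, ~ {subset m <= Qs l} & {subset Qs l <= P'}].
  have [mP'|nmP'] := pselect {subset m <= P'}.
    exists i; split=> // z zQ; apply: mP'; exact: (ideal_sub_max (I := Qs i)).
  have [l [ln Ql]] : exists l, (l < n)%N /\ {subset Qs l <= P'}.
    apply: contrapT => H.
    have /choice[t Ht] : forall l, exists t, (l < n)%N -> t \in Qs l /\ t \notin P'.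
      move=> l; have [lt|] := boolP (l < n)%N; last by exists 0.
      apply: contrapT => h; apply: H; exists l; split=> // z zl; apply: contraT => zn.
      by exfalso; apply: h; exists z.
    have : \prod_(l < n) t l \in P' by apply: IP'; apply: Q2 => l ln; case: (Ht l ln).
    apply/negP; apply: (big_ind (fun x => x \notin P')).
    - by rewrite idealr1.
    - by move=> u v hu hv; rewrite prime_idealrM negb_or hu.
    - by move=> l _; case: (Ht l (ltn_ord l)).
  by exists l; split=> // h; apply: nmP' => z /h; apply: Ql.
exists (Qs l); split; first exact: Q1.
by split; [exact: xQs|exists P'].
Qed.
End Local.
End Noetherian.

(** * Power series in a complete ring *)

Section PowerSeries.
Variable R : idomainType.
Variable m : idealr R.
Hypothesis complete : adically_complete m.

Local Notation mp := (ideal_power m).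

Lemma mpD n x y : mp n x -> mp n y -> mp n (x + y).
Proof.
move=> [s [sm ->]] [t [tm ->]]; exists (s ++ t); rewrite big_cat; split=> // u.
by rewrite mem_cat => /orP[/sm|/tm].
Qed.
Lemma mpM n r x : mp n x -> mp n (r * x).
Proof.
move=> [s [sm ->]]; exists [seq (r * u.1, u.2) | u <- s]; split.
  by move=> v /mapP[u us ->] /=; apply: sm.
by rewrite big_map mulr_sumr; apply: eq_bigr => u _; rewrite mulrA.
Qed.
Lemma mpN n x : mp n x -> mp n (- x).
Proof. by rewrite -mulN1r; apply: mpM. Qed.
Lemma mpB n x y : mp n x -> mp n y -> mp n (x - y).
Proof. by move=> hx hy; apply: mpD => //; apply: mpN. Qed.
Lemma mp_0 n : mp n 0.
Proof. by exists [::]; rewrite big_nil. Qed.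
Lemma mp0 x : mp 0 x.
Proof.
exists [:: (x, [tuple])]; split; last by rewrite big_seq1 /= big_nil mulr1.
by move=> u; rewrite inE => /eqP -> y; rewrite in_nil.
Qed.
Lemma mp_sum n (T : Type) (s : seq T) (P : pred T) F :
  (forall i, P i -> mp n (F i)) -> mp n (\sum_(i <- s | P i) F i).
Proof. by move=> h; apply: big_ind => //; [exact: mp_0|exact: mpD]. Qed.

Lemma mp_mulS n x y : y \in m -> mp n x -> mp n.+1 (y * x).
Proof.
move=> ym [s [sm ->]]; exists [seq (u.1, cons_tuple y u.2) | u <- s]; split.
  move=> v /mapP[u us ->] z /=; rewrite inE => /orP[/eqP->//|]; exact: sm.
rewrite big_map mulr_sumr; apply: eq_bigr => u _ /=.
by rewrite big_cons mulrCA.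
Qed.
Lemma mp_decr n x : mp n.+1 x -> mp n x.
Proof.
move=> [s [sm ->]]; exists [seq (u.1 * thead u.2, behead_tuple u.2) | u <- s]; split.
  by move=> v /mapP[u us ->] z /= zu; apply: (sm u us); apply: mem_behead zu.
rewrite big_map; apply: eq_bigr => -[r t] _ /=.
by rewrite [t in LHS]tuple_eta /= big_cons mulrA.
Qed.
Lemma mp_le n k x : (n <= k)%N -> mp k x -> mp n x.
Proof.
elim: k => [|k IH]; first by rewrite leqn0 => /eqP ->.
by rewrite leq_eqVlt => /orP[/eqP->//|]; rewrite ltnS => /IH h /mp_decr.
Qed.
Lemma mp_pow n y x : y \in m -> mp n (y ^+ n * x).
Proof.
move=> ym; elim: n => [|n IH]; first exact: mp0.
by rewrite exprS -mulrA; apply: mp_mulS.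
Qed.

Lemma haus x : (forall n, mp n x) -> x = 0.
Proof. by case: complete => h _; apply: h. Qed.

Lemma limit_ex (u : nat -> R) : (forall k, mp k (u k.+1 - u k)) -> exists l, forall k, mp k (u k - l).
Proof.
move=> du.
have dle k i : (k <= i)%N -> mp k (u i - u k).
  elim: i => [|i IH]; first by rewrite leqn0 => /eqP ->; rewrite subrr; apply: mp_0.
  rewrite leq_eqVlt => /orP[/eqP->|]; first by rewrite subrr; apply: mp_0.
  rewrite ltnS => ki; rewrite -(subrK (u i) (u i.+1)) -addrA; apply: mpD; last exact: IH.
  exact: mp_le ki (du i).
case: complete => _ /(_ u)[|l Hl].
  move=> n; exists n => i l ni nl; rewrite -(subrK (u n) (u i)) -addrA; apply: mpD; first exact: dle.
  by rewrite -opprB; apply: mpN; apply: dle.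
exists l => k; have [N HN] := Hl k.
have h1 := HN (maxn N k) (leq_maxl _ _); have h2 := dle k (maxn N k) (leq_maxr _ _).
rewrite (_ : u k - l = (u (maxn N k) - l) - (u (maxn N k) - u k)); last by ring.
exact: mpB.
Qed.

(** The series b_0 + b_1 y + b_2 y^2 + ... converges to l. *)
Definition sums (y : R) (b : nat -> R) (l : R) := forall k, mp k (\sum_(n < k) b n * y ^+ n - l).

Lemma sums_ex y b : y \in m -> exists l, sums y b l.
Proof.
move=> ym; apply: limit_ex => k; rewrite big_ord_recr /= [X in mp k X](_ : _ = y ^+ k * b k); last by ring.
exact: mp_pow.
Qed.
Lemma sums_uniq y b l l' : sums y b l -> sums y b l' -> l = l'.
Proof.
move=> h h'; apply/eqP; rewrite -subr_eq0; apply/eqP/haus => n.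
rewrite (_ : l - l' = (\sum_(i < n) b i * y ^+ i - l') - (\sum_(i < n) b i * y ^+ i - l)); last by ring.
exact: mpB.
Qed.
Lemma sumsB y b b' l l' : sums y b l -> sums y b' l' -> sums y (fun n => b n - b' n) (l - l').
Proof.
move=> h h' k; rewrite (eq_bigr (fun i : 'I_k => b i * y ^+ i - b' i * y ^+ i)); last first.
  by move=> i _; rewrite mulrBl.
rewrite sumrB; move: (mpB (h k) (h' k)); congr (mp k _); ring.
Qed.
Lemma sumsZ y b l r : sums y b l -> sums y (fun n => r * b n) (r * l).
Proof.
move=> h k; rewrite (eq_bigr (fun i : 'I_k => r * (b i * y ^+ i))); last first.
  by move=> i _; rewrite mulrA.
by rewrite -mulr_sumr -mulrBr; apply: mpM.
Qed.
Lemma sums_ext y b b' l : (forall n, b n = b' n) -> sums y b l -> sums y b' l.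
Proof.
move=> e h k; rewrite (eq_bigr (fun i : 'I_k => b i * y ^+ i)); first exact: h.
by move=> i _; rewrite e.
Qed.
Lemma sums_const y c : sums y (fun n => if n == 0%N then c else 0) c.
Proof.
case=> [|k]; first exact: mp0.
rewrite big_ord_recl /= expr0 mulr1 big1 ?addr0 ?subrr; first exact: mp_0.
by move=> i _; rewrite mul0r.
Qed.
Lemma sums_shift y b l' : sums y (fun n => b n.+1) l' -> y \in m -> sums y b (b 0%N + y * l').
Proof.
move=> h ym [|k]; first exact: mp0.
rewrite big_ord_recl expr0 mulr1.
rewrite (eq_bigr (fun i : 'I_k => y * (b i.+1 * y ^+ i))); last by move=> i _; rewrite exprS mulrCA.
rewrite -mulr_sumr (_ : _ - _ = y * (\sum_(i < k) b i.+1 * y ^+ i - l')); last by ring.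
exact: mp_mulS.
Qed.

Lemma sumsM y b b' l l' : y \in m -> sums y b l -> sums y b' l' ->
  sums y (fun n => \sum_(i < n.+1) b i * b' (n - i)%N) (l * l').
Proof.
move=> ym h h' k.
pose P := \poly_(i < k) b i; pose Q := \poly_(i < k) b' i.
have PE : P.[y] = \sum_(i < k) b i * y ^+ i by rewrite horner_poly.
have QE : Q.[y] = \sum_(i < k) b' i * y ^+ i by rewrite horner_poly.
have e : \sum_(n < k) (\sum_(i < n.+1) b i * b' (n - i)%N) * y ^+ n = (take_poly k (P * Q)).[y].
  rewrite (horner_coef_wide _ (size_take_poly _ _)); apply: eq_bigr => n _.
  rewrite coef_take_poly ltn_ord coefM; congr (_ * _); apply: eq_bigr => i _.
  have lt1 : (i < k)%N by apply: leq_trans (ltn_ord i) (ltn_ord n).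
  have lt2 : (n - i < k)%N by apply: leq_ltn_trans (leq_subr _ _) (ltn_ord n).
  by rewrite !coef_poly lt1 lt2.
rewrite e.
have e2 : (take_poly k (P * Q)).[y] = P.[y] * Q.[y] - y ^+ k * (drop_poly k (P * Q)).[y].
  by rewrite -hornerM -[in X in _ = X - _](poly_take_drop k (P * Q)) hornerD [X in _ + X - _]hornerM hornerXn mulrC; ring.
rewrite e2 PE QE.
set u := \sum_(i < k) _; set v := \sum_(i < k) _.
rewrite (_ : _ - _ = v * (u - l) + l * (v - l') - y ^+ k * (drop_poly k (P * Q)).[y]); last by ring.
apply: mpB; last exact: mp_pow.
by apply: mpD; apply: mpM; [exact: h|exact: h'].
Qed.

Section PS.
Variables (B : subringClosed R) (y : R).
Hypothesis ym : y \in m.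

Definition pseries_pred : {pred R} := fun l => `[< exists b, (forall n, b n \in B) /\ sums y b l >].
Lemma pseries_closed : subring_closed pseries_pred.
Proof.
split.
- apply/asboolP; exists (fun n => if n == 0%N then 1 else 0); split; last exact: sums_const.
  by case=> [|n] /=; rewrite ?rpred1 ?rpred0.
- move=> l l' /asboolP[b [bB h]] /asboolP[b' [bB' h']]; apply/asboolP.
  by exists (fun n => b n - b' n); split=> [n|]; [rewrite rpredB|exact: sumsB].
- move=> l l' /asboolP[b [bB h]] /asboolP[b' [bB' h']]; apply/asboolP.
  exists (fun n => \sum_(i < n.+1) b i * b' (n - i)%N); split; last exact: sumsM.
  by move=> n; apply: rpred_sum => i _; rewrite rpredM.
Qed.
(** The image of the formal power series ring B[[Y]] in R under Y -> y. *)
Definition pseries : subringClosed R := HB.pack pseries_pred (GRing.isSubringClosed.Build R pseries_pred pseries_closed).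

Lemma pseriesP l : l \in pseries <-> exists b, (forall n, b n \in B) /\ sums y b l.
Proof. by split; [move/asboolP|move=> h; apply/asboolP]. Qed.
Lemma pseries_const b : b \in B -> b \in pseries.
Proof.
move=> bB; apply/pseriesP; exists (fun n => if n == 0%N then b else 0); split; last exact: sums_const.
by case=> [|n] /=; rewrite ?rpred0.
Qed.

Lemma sums_tails b l : (forall n, b n \in B) -> sums y b l -> exists t : nat -> R,
  [/\ t 0%N = l, forall n, t n \in pseries, forall n, t n = b n + y * t n.+1 &
      forall n, sums y (fun i => b (n + i)%N) (t n)].
Proof.
move=> bB h; have /choice[t Ht] : forall n, exists t, sums y (fun i => b (n + i)%N) t.
  by move=> n; apply: sums_ex.
exists t; split=> //.
- by apply: (sums_uniq (Ht 0%N)).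
- by move=> n; apply/pseriesP; exists (fun i => b (n + i)%N).
- move=> n; apply: (sums_uniq (Ht n)).
  have := @sums_shift y (fun i => b (n + i)%N) (t n.+1); rewrite addn0; apply=> //.
  by apply: sums_ext (Ht n.+1) => i; rewrite addSnnS.
Qed.
Lemma tails_expand (b t : nat -> R) k : (forall n, t n = b n + y * t n.+1) ->
  t 0%N = \sum_(n < k) b n * y ^+ n + y ^+ k * t k.
Proof.
move=> h; elim: k => [|k IH]; first by rewrite big_ord0 add0r mul1r.
by rewrite IH big_ord_recr /= {1}h exprS; ring.
Qed.

Lemma pseries_split l : l \in pseries -> exists b l', [/\ b \in B, l' \in pseries & l = b + y * l'].
Proof.
move=> /pseriesP[b [bB h]]; have [t [t0 tps tE _]] := sums_tails bB h.
by exists (b 0%N), (t 1%N); rewrite -t0.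
Qed.
Lemma pseries_y : y \in pseries.
Proof.
apply/pseriesP; exists (fun n => (n == 1%N)%:R); split; first by move=> n; rewrite rpred_nat.
have := @sums_shift y (fun n => (n == 1%N)%:R) 1.
rewrite add0r mulr1; apply=> //.
apply: sums_ext (sums_const y 1) => n; by rewrite eqSS; case: eqP.
Qed.

(** Division with remainder in y: if every f in Phi is g b + y f1 with b in B
    and f1 in Phi again, the successive b are the coefficients of a series z
    with f = g z. *)
Lemma pseries_approx (Phi : set R) g :
  (forall f, Phi f -> exists b f1, [/\ b \in B, Phi f1 & f = g * b + y * f1]) ->
  forall f, Phi f -> exists2 z, z \in pseries & f = g * z.
Proof.
move=> step f0 Pf0.
have /choice[s Hs] : forall f : {f | Phi f}, exists bf : R * {f | Phi f}, bf.1 \in B /\ sval f = g * bf.1 + y * sval bf.2.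
  by move=> [f Pf]; have [b [f1 [bB P1 e]]] := step f Pf; exists (b, exist _ f1 P1).
pose F n := iter n (fun f => (s f).2) (exist _ f0 Pf0).
pose b n := (s (F n)).1.
have FE n : sval (F n) = g * b n + y * sval (F n.+1) by case: (Hs (F n)).
have [z Hz] := sums_ex b ym.
exists z; first by apply/pseriesP; exists b; split=> // n; case: (Hs (F n)).
apply/eqP; rewrite -subr_eq0; apply/eqP/haus => k.
have : f0 = \sum_(n < k) g * b n * y ^+ n + y ^+ k * sval (F k).
  exact: (@tails_expand (fun n => g * b n) (fun n => sval (F n)) k FE).
move=> ->; rewrite (eq_bigr (fun i : 'I_k => g * (b i * y ^+ i))); last by move=> i _; rewrite mulrA.
rewrite -mulr_sumr (_ : _ - _ = g * (\sum_(i < k) b i * y ^+ i - z) + y ^+ k * sval (F k)); last by ring.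
by apply: mpD; [apply: mpM|exact: mp_pow].
Qed.
End PS.
End PowerSeries.

(** * The ring Z_p[[x_1, ..., x_r]] inside a complete local ring *)

Section Coefficient.
Variable R : idomainType.
Variable m : idealr R.
Hypothesis complete : adically_complete m.
Variable p : nat.
Hypotheses (pp : prime p) (p0 : p%:R != 0 :> R) (pm : p%:R \in m).

Local Notation mp := (ideal_power m).
Local Notation sums := (sums m).

Definition int_pred : {pred R} := fun z => `[< exists k : int, z = k%:~R >].
Lemma int_pred_closed : subring_closed int_pred.
Proof.
split; first by apply/asboolP; exists 1.
- by move=> _ _ /asboolP[k ->] /asboolP[l ->]; apply/asboolP; exists (k - l); rewrite rmorphB.
- by move=> _ _ /asboolP[k ->] /asboolP[l ->]; apply/asboolP; exists (k * l); rewrite rmorphM.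
Qed.
Definition int_ring : subringClosed R := HB.pack int_pred (GRing.isSubringClosed.Build R int_pred int_pred_closed).

Definition max_elt := {y : R | y \in m}.

(** The image of Z_p[[x_r]]...[[x_1]], where Z_p is generated by the series in
    p with integer coefficients. *)
Fixpoint coef_ring (xs : seq max_elt) : subringClosed R :=
  if xs is x :: ys then pseries (coef_ring ys) (svalP x) else pseries int_ring pm.

Arguments coef_ring : simpl never.

Lemma int_in_max (k : int) : k%:~R \in m -> exists l : int, k = p%:Z * l.
Proof.
move=> km; have [/dvdzP[l ->]|nd] := boolP (p%:Z %| k)%Z; first by exists l; rewrite mulrC.
have cop : coprimez p k by rewrite coprimezE /= prime_coprime.
have [[u v] /= e] := coprimezP _ _ cop.
have : 1 \in m.
  rewrite -[1]/(1%:~R) -e rmorphD !rmorphM /=; apply: rpredD; exact: idealMr.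
by rewrite idealr1.
Qed.

Section Step.
Variables (x : max_elt) (ys : seq max_elt).
Local Notation X := (sval x).
Variables (P P' : prime_idealr R).
Hypotheses (pP : p%:R \in P) (xP : X \notin P) (PP' : {subset P <= P'}) (xP' : X \in P').
Hypothesis IH : forall a, a \in coef_ring ys -> a \in P' -> exists2 b, b \in coef_ring ys & a = p%:R * b.

(** If the series lies in P, its constant coefficient lies in P', hence is
    divisible by p and lies in P. Dividing by x, which is not in P, the same
    holds for the following coefficients. *)
Lemma step_coef a f : (forall n, a n \in coef_ring ys) -> sums X a f -> f \in P ->
  forall n, exists2 b, b \in coef_ring ys & a n = p%:R * b.
Proof.
move=> aC h fP; have [t [t0 tps tE _]] := sums_tails complete (svalP x) aC h.
have main n : (forall i, (i < n)%N -> a i \in P) -> t n \in P.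
  move=> aP; have : t 0%N \in P by rewrite t0.
  rewrite (tails_expand n tE) => hh.
  have sP : \sum_(i < n) a i * X ^+ i \in P.
    by apply: rpred_sum => i _; rewrite mulrC idealMr // aP.
  have : X ^+ n * t n \in P by rewrite -(rpredDl _ sP).
  have nX k : X ^+ k \notin P.
    elim: k => [|k IHk]; first by rewrite expr0 idealr1.
    by rewrite exprS prime_idealrM negb_or xP.
  by rewrite prime_idealrM (negbTE (nX n)).
have aP' n : t n \in P -> exists2 b, b \in coef_ring ys & a n = p%:R * b.
  move=> tP; apply: IH => //.
  have : t n - X * t n.+1 \in P' by apply: rpredB; [exact: PP'|rewrite mulrC idealMr].
  by rewrite {1}tE addrK.
move=> n; apply: (aP'); apply: (main).
elim: n => [//|n IHn] i; rewrite ltnS leq_eqVlt => /orP[/eqP->|]; last exact: IHn.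
have [b bC ->] := aP' n (main n IHn); by rewrite mulrC idealMr.
Qed.

Lemma step_prime f : f \in coef_ring (x :: ys) -> f \in P -> exists2 b, b \in coef_ring (x :: ys) & f = p%:R * b.
Proof.
move=> /pseriesP[a [aC h]] fP.
have /choice[b Hb] : forall n, exists b, b \in coef_ring ys /\ a n = p%:R * b.
  by move=> n; have [b bC e] := step_coef aC h fP n; exists b.
have [l has_lead] := sums_ex complete b (svalP x).
exists l; first by apply/pseriesP; exists b; split=> // n; case: (Hb n).
apply: (sums_uniq complete h).
by apply: sums_ext (sumsZ p%:R has_lead) => n; case: (Hb n).
Qed.

(** By [step_coef] the coefficients of a vanishing series are divisible by p,
    and after division by p the series still vanishes. So they are divisible
    by all powers of p. *)
Lemma step_zero a : (forall n, a n \in coef_ring ys) -> sums X a 0 -> forall n, a n = 0.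
Proof.
move=> aC h n; apply: (haus complete) => k.
elim: k a aC h n => [|k IHk] a aC h n; first exact: mp0.
have /choice[b Hb] : forall n, exists b, b \in coef_ring ys /\ a n = p%:R * b.
  by move=> i; have [b bC e] := step_coef aC h (rpred0 _) i; exists b.
have [l has_lead] := sums_ex complete b (svalP x).
have l0 : l = 0.
  apply: (mulfI p0); rewrite mulr0; apply: (sums_uniq complete (sumsZ p%:R has_lead)).
  by apply: sums_ext h => i; case: (Hb i).
case: (Hb n) => _ ->; apply: mp_mulS => //; apply: IHk; last by rewrite -l0.
by move=> i; case: (Hb i).
Qed.

Lemma step_lead b l : b \in coef_ring ys -> l \in coef_ring (x :: ys) -> b + X * l = 0 -> b = 0.
Proof.
move=> bC /pseriesP[a [aC h]] e.
have := @step_zero (fun n => if n is i.+1 then a i else b).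
move=> /(_ _ _ 0%N); apply; first by case.
by rewrite -e; exact: (sums_shift (b := fun n => if n is i.+1 then a i else b) h (svalP x)).
Qed.

(** Modulo P, a series starts at its first coefficient outside P'. *)
Lemma step_normal_form f : f \in coef_ring (x :: ys) -> f \notin P -> exists k d,
  [/\ d \in coef_ring (x :: ys), d \notin P' & f - X ^+ k * d \in P].
Proof.
move=> /[dup] fC /pseriesP[a [aC h]] fP.
have [t [t0 tps tE _]] := sums_tails complete (svalP x) aC h.
have [n0 an0] : exists n, a n \notin P'.
  apply: contrapT => H; case/negP: fP.
  have /choice[b Hb] : forall n, exists b, b \in coef_ring ys /\ a n = p%:R * b.
    move=> n; have [|b bC e] := IH (aC n); last by exists b.
    by apply: contraT => hn; exfalso; apply: H; exists n.
  have [l has_lead] := sums_ex complete b (svalP x).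
  have -> : f = p%:R * l.
    by apply: (sums_uniq complete h); apply: sums_ext (sumsZ p%:R has_lead) => n; case: (Hb n).
  by rewrite mulrC idealMr.
case: (ex_minnP (ex_intro (fun n => a n \notin P') n0 an0)) => k ak kmin.
exists k, (t k); split; first exact: tps.
  by rewrite tE (rpredDr _ (_ : X * t k.+1 \in P')) // mulrC idealMr.
rewrite -t0 (tails_expand k tE) addrK; apply: rpred_sum => i _.
rewrite mulrC idealMr //.
have [|b _ ->] := IH (aC i); last by rewrite mulrC idealMr.
by apply: contraT => /kmin; rewrite leqNgt ltn_ord.
Qed.
End Step.

(** One variable at a time along the chain of primes; at its end, an integer
    in m is divisible by p. *)
Lemma coef_ring_prime xs (P : prime_idealr R) : chain m [seq sval x | x <- xs] P -> p%:R \in P ->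
  forall a, a \in coef_ring xs -> a \in P -> exists2 b, b \in coef_ring xs & a = p%:R * b.
Proof.
elim: xs P => [|x ys IH] P /=.
  move=> Pm _ a aC; rewrite Pm => am.
  have [b [l [/asboolP[k bk] lC ae]]] := pseries_split complete (aC : a \in pseries int_ring pm).
  have km : k%:~R \in m.
    have : a - p%:R * l \in m by rewrite rpredB // mulrC idealMr.
    by rewrite ae addrK bk.
  have [k' ek] := int_in_max km.
  exists (k'%:~R + l); last by rewrite ae bk ek rmorphM mulrDr.
  change (k'%:~R + l \in coef_ring [::]); apply: rpredD => //; apply: pseries_const; apply/asboolP; by exists k'.
move=> [xP [P' [PP' xP' ch]]] pP a.
by apply: (step_prime pP xP PP' xP'); apply: IH ch (PP' _ pP).
Qed.

Lemma coef_ring_sep xs a : a \in coef_ring xs -> a != 0 -> exists k b, [/\ b \in coef_ring xs, a = p%:R ^+ k * b &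
   ~ exists2 c, c \in coef_ring xs & b = p%:R * c].
Proof.
move=> aC a0; apply: contrapT => H; case/eqP: a0; apply: (haus complete) => n.
suff [b _ ->] : exists2 b, b \in coef_ring xs & a = p%:R ^+ n * b by apply: mp_pow.
elim: n => [|n [b bC ab]]; first by exists a; rewrite ?mul1r.
have [[c cC bc]|nb] := pselect (exists2 c, c \in coef_ring xs & b = p%:R * c).
  by exists c; rewrite // exprSr -mulrA -bc.
by exfalso; apply: H; exists n, b.
Qed.

(** Complete integral closedness. Contrary to integral closedness, it passes
    from B to B[[x]] without any finiteness assumption. *)
Definition cint_closed (B : {pred R}) := forall f g c, f \in B -> g \in B -> c \in B -> g != 0 -> c != 0 ->
  (forall n, exists2 h, h \in B & c * f ^+ n = g ^+ n * h) -> exists2 z, z \in B & f = g * z.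

(** By [pseries_approx], from the invertibility of integers prime to p modulo
    p. *)
Lemma base_unit g f : g \in coef_ring [::] -> g \notin m -> f \in coef_ring [::] -> exists2 z, z \in coef_ring [::] & f = g * z.
Proof.
move=> gC gm fC; apply: (pseries_approx complete (B := int_ring) pm (Phi := [set f | f \in coef_ring [::]]%classic)) => // {fC}f fC.
have [c [l [/asboolP[k ck] lC fe]]] := pseries_split complete (fC : f \in pseries int_ring pm).
have [d [l' [/asboolP[k' dk] l'C ge]]] := pseries_split complete (gC : g \in pseries int_ring pm).
have dm : k'%:~R \notin m.
  by apply: contra gm => h; rewrite ge dk rpredD // mulrC idealMr.
have [u [v e]] : exists u v : int, u * p%:Z + v * k' = 1.
  have nd : ~~ (p%:Z %| k')%Z.
    apply: contra dm => /dvdzP[w ->]; rewrite rmorphM /=; exact: idealMr.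
  have cop : coprimez p k' by rewrite coprimezE /= prime_coprime.
  by have [[u v] /= e] := coprimezP _ _ cop; exists u, v.
have Zm (w : int) : w%:~R \in coef_ring [::] by apply: pseries_const; apply/asboolP; exists w.
exists (v * k)%:~R, (l - l' * (v * k)%:~R + (u * k)%:~R); split.
- by apply/asboolP; exists (v * k).
- change (l - l' * (v * k)%:~R + (u * k)%:~R \in coef_ring [::]); apply: rpredD => //.
  by apply: rpredB => //; apply: rpredM.
rewrite fe ge ck dk.
have e1 : k%:~R = (u * p%:Z + v * k')%:~R * k%:~R :> R by rewrite e mul1r.
rewrite {1}e1 !(rmorphD, rmorphM) /=.
rewrite -[p%:~R]/(p%:R); ring.
Qed.

Lemma pow_order (P : prime_idealr R) (y u v : R) i l : y \in P -> y != 0 -> v \notin P -> y ^+ i * u = y ^+ l * v -> (i <= l)%N.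
Proof.
move=> yP y0 vP e; rewrite leqNgt; apply/negP => li.
have e2 : y ^+ (i - l) * u = v.
  apply: (mulfI (expf_neq0 l y0)); rewrite mulrA -exprD subnKC // ltnW //.
by case/negP: vP; rewrite -e2 mulrC idealMr // -(subnSK li) exprS mulrC idealMr.
Qed.

Lemma base_cint_closed : (exists P : prime_idealr R, chain m [::] P) -> cint_closed (coef_ring [::]).
Proof.
move=> [P Pm] f g c fC gC cC g0 c0 H; rewrite /= in Pm.
have [->|f0] := eqVneq f 0; first by exists 0; rewrite ?rpred0 ?mulr0.
have pP : p%:R \in P by rewrite Pm.
have sep a : a \in coef_ring [::] -> a != 0 -> exists k b, [/\ b \in coef_ring [::], a = p%:R ^+ k * b & b \notin P].
  move=> aC a0; have [k [b [bC ab nb]]] := coef_ring_sep aC a0; exists k, b; split=> //.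
  by apply/negP => bP; apply: nb; apply: (@coef_ring_prime [::] P).
have [al [f' [f'C fe f'P]]] := sep f fC f0.
have [be [g' [g'C ge g'P]]] := sep g gC g0.
have [ga [c' [c'C ce c'P]]] := sep c cC c0.
have npow a n : a \notin P -> a ^+ n \notin P.
  move=> aP; elim: n => [|n IH]; first by rewrite expr0 idealr1.
  by rewrite exprS prime_idealrM negb_or aP.
have ord n : (n * be <= ga + n * al)%N.
  have [h hC e] := H n.
  apply: (@pow_order P p%:R (g' ^+ n * h) (c' * f' ^+ n)) => //.
    by rewrite prime_idealrM negb_or c'P npow.
  rewrite exprD mulnC [(n * al)%N]mulnC !exprM -[RHS]/(_ * _ * (_ * _)).
  rewrite [RHS]mulrACA -ce -exprMn -fe e ge exprMn; ring.
have le : (be <= al)%N.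
  have := ord ga.+1; rewrite leqNgt -ltnS => /negP h.
  rewrite leqNgt; apply/negP => lt; apply: h.
  rewrite ltnS leqNgt; apply/negP => h2.
  have : (ga.+1 * al.+1 <= ga + ga.+1 * al)%N.
    apply: leq_trans (ord ga.+1); rewrite leq_mul2l; by rewrite lt.
  by rewrite mulnS addnC [X in (_ <= X)%N]addnC leq_add2l ltnn.
have [z zC e] : exists2 z, z \in coef_ring [::] & f' = g' * z by apply: base_unit; rewrite // -Pm.
exists (p%:R ^+ (al - be) * z); first by rewrite rpredM // rpredX // rpred_nat.
by rewrite fe ge e mulrACA -exprD subnKC // mulrA.
Qed.
End Coefficient.
Arguments coef_ring : simpl never.

(** * Normality, units and finiteness over Z_p[[x_1, ..., x_r]] *)

Section Coefficient.
Variable R : idomainType.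
Variable m : idealr R.
Hypothesis complete : adically_complete m.
Variable p : nat.
Hypotheses (pp : prime p) (p0 : p%:R != 0 :> R) (pm : p%:R \in m).

Local Notation mp := (ideal_power m).
Local Notation sums := (sums m).
Local Notation coef_ring := (coef_ring pm).

Section Step.
Variables (x : max_elt m) (ys : seq (max_elt m)).
Local Notation X := (sval x).
Variables (P P' : prime_idealr R).
Hypotheses (pP : p%:R \in P) (xP : X \notin P) (PP' : {subset P <= P'}) (xP' : X \in P').
Hypothesis IH : forall a, a \in coef_ring ys -> a \in P' -> exists2 b, b \in coef_ring ys & a = p%:R * b.

Local Notation B := (coef_ring ys).
Local Notation C' := (coef_ring (x :: ys)).

Let X0 : X != 0. Proof. by apply: contraNneq xP => ->; rewrite rpred0. Qed.
Let XC : X \in C'. Proof. exact: pseries_y. Qed.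
Local Hint Resolve XC : core.
Let BC b : b \in B -> b \in C'. Proof. exact: pseries_const. Qed.
Let lead0 b l : b \in B -> l \in C' -> b + X * l = 0 -> b = 0.
Proof. exact: (step_lead complete p0 pP xP PP' xP' IH). Qed.
Let split f : f \in C' -> exists b l, [/\ b \in B, l \in C' & f = b + X * l].
Proof. exact: (pseries_split complete). Qed.

(** b is the constant coefficient of the series v in x. *)
Definition has_lead v b := b \in B /\ exists2 l, l \in C' & v = b + X * l.
Lemma has_leadC v b : has_lead v b -> v \in C'.
Proof. move=> [bB [l lC ->]]; by rewrite rpredD ?(BC bB) // rpredM. Qed.
Lemma has_leadM v w b c : has_lead v b -> has_lead w c -> has_lead (v * w) (b * c).
Proof.
move=> [bB [l lC ->]] [cB [k kC ->]]; split; first exact: rpredM.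
exists (b * k + l * (c + X * k)); last by ring.
by rewrite rpredD ?rpredM ?(BC bB) ?rpredD ?(BC cB) // rpredM.
Qed.
Lemma has_leadX v b n : has_lead v b -> has_lead (v ^+ n) (b ^+ n).
Proof.
move=> h; elim: n => [|n IHn]; last by rewrite !exprS; apply: has_leadM.
split; rewrite ?expr0 ?rpred1 //; exists 0; rewrite ?rpred0 //.
by rewrite mulr0 addr0.
Qed.
Lemma has_lead_uniq v b c : has_lead v b -> has_lead v c -> b = c.
Proof.
move=> [bB [l lC e]] [cB [k kC e']]; apply/eqP; rewrite -subr_eq0; apply/eqP.
apply: (@lead0 _ (l - k)); [by rewrite rpredB|by rewrite rpredB|].
rewrite (_ : _ + _ = (b + X * l) - (c + X * k)); last by ring.
by rewrite -e -e' subrr.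
Qed.
Lemma has_lead_mulX v : v \in C' -> has_lead (X * v) 0.
Proof. by move=> vC; split; rewrite ?rpred0 //; exists v; rewrite ?add0r. Qed.

Lemma factorX f : f \in C' -> f != 0 -> exists k g b, [/\ has_lead g b, b != 0 & f = X ^+ k * g].
Proof.
move=> /pseriesP[a [aC h]] f0.
have [t [t0 tps tE _]] := sums_tails complete (svalP x) aC h.
have exk : exists n, a n != 0.
  apply: contrapT => H; case/eqP: f0; apply: (haus complete) => k.
  rewrite -t0 (tails_expand k tE) big1 ?add0r; first by apply: mp_pow; exact: (svalP x).
  move=> i _; have [->|ai] := eqVneq (a i) 0; first by rewrite mul0r.
  by exfalso; apply: H; exists (i : nat).
case: (ex_minnP exk) => k ak kmin.
exists k, (t k), (a k); split=> //; first by split=> //; exists (t k.+1).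
rewrite -t0 (tails_expand k tE) big1 ?add0r // => i _.
have [->|ai] := eqVneq (a i) 0; first by rewrite mul0r.
by have := kmin i ai; rewrite leqNgt ltn_ord.
Qed.

Lemma orderX i l u v b : u \in C' -> has_lead v b -> b != 0 -> X ^+ i * u = X ^+ l * v -> (i <= l)%N.
Proof.
move=> uC vb b0 e; rewrite leqNgt; apply/negP => li; case/eqP: b0.
have e2 : X * (X ^+ (i - l.+1) * u) = v.
  apply: (mulfI (expf_neq0 l X0)); rewrite -e !mulrA -exprSr -exprD subnKC //.
apply: (has_lead_uniq vb); rewrite -e2; apply: has_lead_mulX.
by rewrite rpredM ?rpredX.
Qed.

Lemma divX k g b u h : has_lead g b -> b != 0 -> u \in C' -> h \in C' -> X ^+ k * u = g * h ->
  exists2 h', h' \in C' & h = X ^+ k * h'.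
Proof.
move=> gb b0 uC; elim: k h => [|k IHk] h hC e; first by exists h; rewrite ?mul1r.
have [c [l [cB lC he]]] := split hC.
have hc : has_lead h c by split=> //; exists l.
have bc : b * c = 0.
  apply: (@has_lead_uniq (g * h)); first exact: has_leadM.
  by rewrite -e exprS -mulrA; apply: has_lead_mulX; rewrite rpredM ?rpredX.
have c0 : c = 0 by move/eqP: bc; rewrite mulf_eq0 (negbTE b0) => /eqP.
have hX : h = X * l by rewrite he c0 add0r.
have [|l' l'C le] := IHk l lC; last first.
  by exists l'; rewrite // hX le exprS -mulrA; congr (_ * _).
by apply: (mulfI X0); rewrite mulrA -exprS e hX mulrCA.
Qed.

(** Write f, g, c as powers of x times series with nonzero constant
    coefficients. Comparing orders in c f^n = g^n h_n for large n shows that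
    the order of g is at most that of f, so the powers of x can be removed.
    Then the constant coefficients satisfy the hypothesis over B, which gives
    z0 with f = g z0 + x f1. The element f1 inherits the hypothesis, because
    (x f1)^n = (f - g z0)^n expands by the binomial formula. So
    [pseries_approx] applies. *)
Lemma step_cint_closed : cint_closed B -> cint_closed C'.
Proof.
move=> cB f g c fC gC cC g0 c0 H.
have [->|f0] := eqVneq f 0; first by exists 0; rewrite ?rpred0 ?mulr0.
have [al [f1 [bf [hf bf0 fe]]]] := factorX fC f0.
have [be [g1 [bg [hg bg0 ge]]]] := factorX gC g0.
have [ga [c1 [bc [hc bc0 ce]]]] := factorX cC c0.
have f1C := has_leadC hf; have g1C := has_leadC hg; have c1C := has_leadC hc.
have ord n : (n * be <= ga + n * al)%N.
  have [h hC e] := H n.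
  apply: (@orderX _ _ (g1 ^+ n * h) (c1 * f1 ^+ n) (bc * bf ^+ n)).
  - by rewrite rpredM ?rpredX.
  - by apply: has_leadM => //; apply: has_leadX.
  - by rewrite mulf_neq0 ?expf_neq0.
  rewrite exprD mulnC [(n * al)%N]mulnC !exprM -[RHS]/(_ * _ * (_ * _)).
  rewrite [RHS]mulrACA -ce -exprMn -fe e ge exprMn; ring.
have le : (be <= al)%N.
  have := ord ga.+1; rewrite leqNgt -ltnS => /negP h.
  rewrite leqNgt; apply/negP => lt; apply: h.
  rewrite ltnS leqNgt; apply/negP => h2.
  have : (ga.+1 * al.+1 <= ga + ga.+1 * al)%N.
    apply: leq_trans (ord ga.+1); rewrite leq_mul2l; by rewrite lt.
  by rewrite mulnS addnC [X in (_ <= X)%N]addnC leq_add2l ltnn.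
pose f2 := X ^+ (al - be) * f1.
have ff2 : f = X ^+ be * f2 by rewrite fe /f2 mulrA -exprD subnKC.
have f2C : f2 \in C' by rewrite rpredM ?rpredX.
pose Phi : set R := fun u => u \in C' /\ forall n, exists2 h, h \in C' & c1 * u ^+ n = g1 ^+ n * h.
have Pf2 : Phi f2.
  split=> // n; have [h hC e] := H n.
  have e2 : X ^+ ga * (c1 * f2 ^+ n) = g1 ^+ n * h.
    apply: (mulfI (expf_neq0 n (expf_neq0 be X0))).
    by rewrite [RHS]mulrA -exprMn -ge -e ce ff2 [in RHS]exprMn; ring.
  have [|h' h'C he] := divX (has_leadX n hg) (expf_neq0 n bg0) _ hC e2.
    by rewrite rpredM ?rpredX.
  exists h' => //; apply: (mulfI (expf_neq0 ga X0)).
  by rewrite e2 he mulrCA.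
have step u : Phi u -> exists b u1, [/\ b \in B, Phi u1 & u = g1 * b + X * u1].
  move=> [uC Hu]; have [b [l [bB lC ue]]] := split uC.
  have hu : has_lead u b by split=> //; exists l.
  have [bcB _] := hc; have [bgB [lg lgC g1e]] := hg.
  have [z0 z0B bz] : exists2 z, z \in B & b = bg * z.
    apply: (cB _ _ bc) => // n; have [h hC e] := Hu n.
    have [d [k [dB kC he]]] := split hC; have hh : has_lead h d by split=> //; exists k.
    exists d => //; apply: (@has_lead_uniq (c1 * u ^+ n)); first by apply: has_leadM => //; apply: has_leadX.
    by rewrite e; apply: has_leadM => //; apply: has_leadX.
  have u1C : l - lg * z0 \in C' by rewrite rpredB // rpredM // BC.
  have uX : u = g1 * z0 + X * (l - lg * z0) by rewrite ue g1e bz; ring.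
  exists z0, (l - lg * z0); split=> //; split=> // n.
  have [h hC e] : exists2 h, h \in C' & X ^+ n * (c1 * (l - lg * z0) ^+ n) = g1 ^+ n * h.
    have /choice[h Hh] : forall i, exists h, h \in C' /\ c1 * u ^+ i = g1 ^+ i * h.
      by move=> i; have [h hC e] := Hu i; exists h.
    exists (\sum_(i < n.+1) (h (n - i)%N * (- z0) ^+ i) *+ 'C(n, i)).
      apply: rpred_sum => i _; rewrite rpredMn // rpredM //; first by case: (Hh (n - i)%N).
      by rewrite rpredX // rpredN BC.
    rewrite mulrCA -exprMn (_ : X * _ = u + (- (g1 * z0))); last by rewrite uX; ring.
    rewrite exprDn !mulr_sumr; apply: eq_bigr => i _.
    rewrite -!mulrnAr mulrA; case: (Hh (n - i)%N) => _ ->.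
    have -> : g1 ^+ n = g1 ^+ (n - i) * g1 ^+ i by rewrite -exprD subnK // -ltnS.
    by rewrite -mulrN exprMn -[_ *+ 'C(n, i)]mulr_natr -[_ *+ 'C(n, i)]mulr_natr; ring.
  have [|h' h'C he] := divX (has_leadX n hg) (expf_neq0 n bg0) _ hC e.
    by rewrite rpredM ?rpredX.
  exists h' => //; apply: (mulfI (expf_neq0 n X0)).
  by rewrite e he mulrCA.
have [z zC f2z] := pseries_approx complete (svalP x) step Pf2.
by exists z; rewrite // ff2 f2z ge mulrA.
Qed.

Lemma step_unit a f : a \in C' -> f \in C' -> exists2 z, z \in C' & f = (1 + X * a) * z.
Proof.
move=> aC fC; apply: (pseries_approx complete (svalP x) (Phi := fun u => u \in C')) fC => {}f {}fC.
have [b [l [bB lC fe]]] := split fC.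
exists b, (l - a * b); split=> //.
  by change (l - a * b \in C'); rewrite rpredB // rpredM // BC.
by rewrite fe; ring.
Qed.

(** Modulo P, a coefficient c_i outside P starts with x^k d, where d is
    outside P', so the term c_i^q x^i starts in degree q k + i. These degrees
    are distinct modulo q, and the lowest term does not cancel. *)
Lemma step_frob q (c : nat -> R) : (0 < q)%N -> (forall i, c i \in C') ->
  \sum_(i < q) c i ^+ q * X ^+ i \in P -> forall i, (i < q)%N -> c i \in P.
Proof.
move=> q0 cC sP i0 i0q; apply: contraT => ci0.
have nX k : X ^+ k \notin P.
  elim: k => [|k IHk]; first by rewrite expr0 idealr1.
  by rewrite exprS prime_idealrM negb_or xP.
have /choice[kd Hkd] : forall i, exists kd : nat * R, c i \notin P -> [/\ kd.2 \in C', kd.2 \notin P' & c i - X ^+ kd.1 * kd.2 \in P].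
  move=> i; have [ciP|ciP] := boolP (c i \in P); first by exists (0%N, 0).
  by have [k [d H]] := step_normal_form complete pP xP' IH (cC i) ciP; exists (k, d).
pose w i := (q * (kd i).1 + i)%N.
pose good i := (i < q)%N && (c i \notin P).
have exn : exists n, [exists i : 'I_q, good i && (w i == n)].
  by exists (w i0); apply/existsP; exists (Ordinal i0q); rewrite /good /= i0q ci0 eqxx.
case: (ex_minnP exn) => n /existsP[i1 /andP[/andP[_ ci1] /eqP wi1]] nmin.
have wmin l : (l < q)%N -> c l \notin P -> l != i1 -> (n < w l)%N.
  move=> lq cl li1; have : (n <= w l)%N.
    by apply: nmin; apply/existsP; exists (Ordinal lq); rewrite /good /= lq cl eqxx.
  rewrite leq_eqVlt => /orP[/eqP e|//]; case/eqP: li1.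
  have := congr1 (fun u => u %% q)%N (etrans wi1 e).
  by rewrite /w ![(q * _)%N]mulnC !modnMDl !modn_small.
have npow a : a \notin P' -> a ^+ q \notin P'.
  move=> aP; elim: q {q0 sP i0q w good exn nmin wmin wi1 i1 ci1} => [|k IHk]; first by rewrite expr0 idealr1.
  by rewrite exprS prime_idealrM negb_or aP.
have congr_pow (u v : R) k : u - v \in P -> u ^+ k - v ^+ k \in P.
  by move=> uv; rewrite subrXX mulrC idealMr.
have term l : (l < q)%N -> l != i1 -> exists t, c l ^+ q * X ^+ l - X ^+ n.+1 * t \in P.
  move=> lq li1; have [cl|cl] := boolP (c l \in P).
    exists 0; rewrite mulr0 subr0 mulrC idealMr // -(prednK q0) exprSr idealMr //.
  have [dC dP' h] := Hkd l cl; have := wmin l lq cl li1 => wl.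
  exists (X ^+ (w l - n.+1) * (kd l).2 ^+ q); rewrite mulrA -exprD subnKC //.
  rewrite /w exprD mulnC exprM (_ : _ - _ = X ^+ l * (c l ^+ q - (X ^+ (kd l).1 * (kd l).2) ^+ q)).
    by rewrite idealMr // congr_pow.
  by rewrite exprMn; ring.
have [d1C d1P' h1] := Hkd i1 ci1.
have /choice[t Ht] : forall l, exists t, (l < q)%N -> l != i1 -> c l ^+ q * X ^+ l - X ^+ n.+1 * t \in P.
  move=> l; have [[h1' h2']|h] := pselect ((l < q)%N /\ l != i1).
    by have [t ht] := term l h1' h2'; exists t.
  by exists 0 => h1' h2'; exfalso; apply: h.
have key : X ^+ n * ((kd i1).2 ^+ q + X * \sum_(l < q | l != i1) t l) \in P.
  have e1 : c i1 ^+ q * X ^+ i1 - X ^+ n * (kd i1).2 ^+ q \in P.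
    rewrite -wi1 /w exprD mulnC exprM (_ : _ - _ = X ^+ i1 * (c i1 ^+ q - (X ^+ (kd i1).1 * (kd i1).2) ^+ q)).
      by rewrite idealMr // congr_pow.
    by rewrite exprMn; ring.
  have e2 : \sum_(l < q | l != i1) (c l ^+ q * X ^+ l - X ^+ n.+1 * t l) \in P.
    by apply: rpred_sum => l li; apply: Ht.
  have e3 := rpredD e1 e2.
  have : \sum_(i < q) c i ^+ q * X ^+ i - ((c i1 ^+ q * X ^+ i1 - X ^+ n * (kd i1).2 ^+ q) +
       \sum_(l < q | l != i1) (c l ^+ q * X ^+ l - X ^+ n.+1 * t l)) \in P by rewrite rpredB.
  congr (_ \in P); rewrite (bigD1 i1) //= sumrB -mulr_sumr exprSr; ring.
have : (kd i1).2 ^+ q \in P'.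
  have : (kd i1).2 ^+ q + X * \sum_(l < q | l != i1) t l \in P'.
    by move: key; rewrite prime_idealrM (negbTE (nX n)) => /PP'.
  by rewrite rpredDr // mulrC idealMr.
by rewrite (negbTE (npow _ d1P')).
Qed.
End Step.

Lemma coef_ring_cint_closed xs (P : prime_idealr R) : chain m [seq sval x | x <- xs] P -> p%:R \in P -> cint_closed (coef_ring xs).
Proof.
elim: xs P => [|x ys IH] P ch pP; first by apply: (base_cint_closed complete pp p0); exists P.
case: ch => xP [P' [PP' xP' ch]].
apply: (step_cint_closed pP xP PP' xP'); last exact: IH ch (PP' _ pP).
by move=> a aC aP'; apply: (coef_ring_prime complete pp ch (PP' _ pP)).
Qed.

(** Elements that generate R modulo y generate it over series in y, by
    successive approximation. The coefficients of the i-th generator are taken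
    in their own ring B_i, which is all of R for the generators to be
    eliminated later. *)
Lemma pseries_gen (B : nat -> subringClosed R) y (ym : y \in m) N (G : nat -> R) :
  (forall s, exists c s1, (forall i, (i < N)%N -> c i \in B i) /\ s = \sum_(i < N) c i * G i + y * s1) ->
  forall s, exists c, (forall i, (i < N)%N -> c i \in pseries (B i) ym) /\ s = \sum_(i < N) c i * G i.
Proof.
move=> H s0.
have /choice[cs Hcs] : forall s, exists cs : (nat -> R) * R,
   (forall i, (i < N)%N -> cs.1 i \in B i) /\ s = \sum_(i < N) cs.1 i * G i + y * cs.2.
  by move=> s; have [c [s1 h]] := H s; exists (c, s1).
pose F n := iter n (fun s => (cs s).2) s0.
pose b i n := (cs (F n)).1 i.
have /choice[c Hc] : forall i, exists c, sums y (b i) c by move=> i; apply: (sums_ex complete).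
exists c; split.
  by move=> i iN; apply/pseriesP; exists (b i); split=> // n; case: (Hcs (F n)) => h _; apply: h.
apply/eqP; rewrite -subr_eq0; apply/eqP/(haus complete) => k.
have FE n : F n = \sum_(i < N) b i n * G i + y * F n.+1 by case: (Hcs (F n)).
have -> : s0 = F 0%N by [].
rewrite (@tails_expand R y (fun n => \sum_(i < N) b i n * G i) F k FE).
rewrite (_ : _ - _ = \sum_(i < N) G i * (\sum_(n < k) b i n * y ^+ n - c i) + y ^+ k * F k); last first.
  rewrite addrAC; congr (_ + _).
  have -> : \sum_(n < k) (\sum_(i < N) b i n * G i) * y ^+ n = \sum_(i < N) G i * \sum_(n < k) b i n * y ^+ n.
    under eq_bigr do rewrite mulr_suml.
    rewrite exchange_big /=; apply: eq_bigr => i _; rewrite mulr_sumr; apply: eq_bigr => n _; ring.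
  by rewrite -sumrB; apply: eq_bigr => i _; ring.
by apply: mpD; [apply: mp_sum => i _; apply: mpM; exact: Hc|exact: mp_pow].
Qed.

Lemma setT_closed : subring_closed (predT : {pred R}). Proof. by split. Qed.
Definition allR : subringClosed R := HB.pack (predT : {pred R}) (GRing.isSubringClosed.Build R predT setT_closed).

(** Apply [pseries_gen] to p, then to x_r, ..., x_1 in turn; at each stage the
    variables that are left count as generators with arbitrary
    coefficients. *)
Lemma coef_ring_gen (g : seq R) (xs : seq (max_elt m)) :
  (forall s, exists (c t : nat -> R) u, (forall i, c i \in int_ring R) /\
     s = \sum_(i < size g) c i * g`_i + p%:R * u + \sum_(i < size xs) t i * nth 0 [seq sval x | x <- xs] i) ->
  forall s, exists c : nat -> R, (forall i, c i \in coef_ring xs) /\ s = \sum_(i < size g) c i * g`_i.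
Proof.
set N := size g => H.
have main : forall ys rest, xs = rest ++ ys -> forall s, exists c,
   (forall i, (i < N + size rest)%N -> c i \in if (i < N)%N then coef_ring ys else allR) /\
   s = \sum_(i < N + size rest) c i * nth 0 (g ++ [seq sval x | x <- rest]) i.
  elim=> [|x ys IH] rest xsE.
    rewrite cats0 in xsE; rewrite -xsE.
    pose BB i : subringClosed R := if (i < N)%N then int_ring R else allR.
    have H2 s : exists c s1, (forall i, (i < N + size xs)%N -> c i \in BB i) /\
        s = \sum_(i < N + size xs) c i * nth 0 (g ++ [seq sval x | x <- xs]) i + p%:R * s1.
      have [c [t [u [cZ e]]]] := H s.
      exists (fun i => if (i < N)%N then c i else t (i - N)%N), u; split.
        by move=> i _; rewrite /BB; case: ifP.
      rewrite big_split_ord /= e addrAC; congr (_ + _ + _); apply: eq_bigr => i _.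
        by rewrite ltn_ord nth_cat ltn_ord.
      by rewrite ltnNge leq_addr /= nth_cat ltnNge leq_addr /= addKn.
    move=> s; have [c [cB e]] := pseries_gen pm H2 s; exists c; split=> // i iN.
    have := cB i iN; rewrite /BB; case: ifP => //.
  have xsE' : xs = rcons rest x ++ ys by rewrite cat_rcons.
  pose BB i : subringClosed R := if (i < N)%N then coef_ring ys else allR.
  have H2 s : exists c s1, (forall i, (i < N + size rest)%N -> c i \in BB i) /\
        s = \sum_(i < N + size rest) c i * nth 0 (g ++ [seq sval x | x <- rest]) i + sval x * s1.
    have [c [cB e]] := IH _ xsE' s; exists c, (c (N + size rest)%N); split.
      by move=> i iN; rewrite /BB; have := cB i; rewrite size_rcons addnS ltnS => /(_ (ltnW iN)); case: ifP.
    rewrite e size_rcons addnS big_ord_recr /= map_rcons -rcons_cat; congr (_ + _).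
      apply: eq_bigr => i _; rewrite nth_rcons size_cat size_map -/N.
      by rewrite ltn_ord.
    by rewrite nth_rcons size_cat size_map -/N ltnn eqxx mulrC.
  move=> s; have [c [cB e]] := pseries_gen (svalP x) H2 s; exists c; split=> // i iN.
  by have := cB i iN; rewrite /BB; case: ifP.
move=> s; have [c [cC e]] := main xs [::] erefl s.
exists (fun i => if (i < N)%N then c i else 0); split.
  move=> i; case: ifP => iN; last exact: rpred0.
  by have := cC i; rewrite addn0 iN => /(_ isT).
rewrite e addn0; apply: eq_bigr => i _.
by rewrite ltn_ord /= cats0.
Qed.
End Coefficient.

(** * The structure of complete local domains *)

Section Span.
Variable R : idomainType.
Variable B : subringClosed R.
Implicit Types g h : seq R.

Definition spanned g (s : R) := exists c : nat -> R, (forall i, c i \in B) /\ s = \sum_(i < size g) c i * g`_i.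

Lemma spanned0 g : spanned g 0.
Proof.
exists (fun=> 0); split=> [i|]; first exact: rpred0.
by rewrite big1 // => i _; rewrite mul0r.
Qed.
Lemma spannedD g x y : spanned g x -> spanned g y -> spanned g (x + y).
Proof.
move=> [c [cB ->]] [d [dB ->]]; exists (fun i => c i + d i); split=> [i|]; first by rewrite rpredD.
by rewrite -big_split; apply: eq_bigr => i _; rewrite mulrDl.
Qed.
Lemma spannedZ g b x : b \in B -> spanned g x -> spanned g (b * x).
Proof.
move=> bB [c [cB ->]]; exists (fun i => b * c i); split=> [i|]; first by rewrite rpredM.
by rewrite mulr_sumr; apply: eq_bigr => i _; rewrite mulrA.
Qed.
Lemma spanned_sum g (T : Type) (r : seq T) (F : T -> R) :
  (forall i, spanned g (F i)) -> spanned g (\sum_(i <- r) F i).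
Proof. by move=> H; apply: big_ind => //; [exact: spanned0|exact: spannedD]. Qed.
Lemma spanned_mem g x : x \in g -> spanned g x.
Proof.
move=> xg; exists (fun i => (i == index x g)%:R); split=> [i|]; first by rewrite rpred_nat.
have lt : (index x g < size g)%N by rewrite index_mem.
rewrite (bigD1 (Ordinal lt)) //= eqxx mul1r nth_index // big1 ?addr0 // => i.
by rewrite -(inj_eq val_inj) /= => /negbTE ->; rewrite mul0r.
Qed.
End Span.

Section Cohen.
Variable S : idomainType.
Variable m : idealr S.
Hypothesis mloc : local_ring m.
Hypothesis complete : adically_complete m.
Hypothesis residue : finite_set [set: {ideal_quot m}]%classic.

Local Notation mp := (ideal_power m).

Lemma residue_reps : exists g : seq S, forall s, exists2 r, r \in g & s - r \in m.
Proof.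
have /finite_seqP[t Ht] := residue.
exists [seq repr x | x <- t] => s; exists (repr (\pi_{ideal_quot m}%qT s)).
  apply: map_f; have : [set` t]%classic (\pi_{ideal_quot m}%qT s) by rewrite -Ht.
  by [].
by rewrite Quotient.idealrBE reprK eqxx.
Qed.

(** S / m^k is finite, as the residue field is finite and m finitely
    generated. Integer coefficients are allowed so that the representatives
    form a module over the integers. *)
Lemma finite_mod_power k : exists g : seq S, forall s, exists r, spanned (int_ring S) g r /\ mp k (s - r).
Proof.
elim: k => [|k [g Hg]].
  by exists [::] => s; exists 0; split; [exact: spanned0|exact: mp0].
have [reps Hreps] := residue_reps; have [noeth _ _] := mloc.
have [y Hy] := noeth m.
exists (reps ++ [seq a * b | a <- g, b <- y]) => s.
have [r rr /Hy[c e]] := Hreps s.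
have /choice[d Hd] : forall i : 'I_(size y), exists d, spanned (int_ring S) g d /\ mp k (c i - d) by move=> i; apply: Hg.
exists (r + \sum_i d i * y`_i); split.
  apply: spannedD; first by apply: spanned_mem; rewrite mem_cat rr.
  apply: spanned_sum => i; have [[u [uZ ->]] _] := Hd i.
  rewrite mulr_suml; apply: spanned_sum => l; rewrite -mulrA; apply: spannedZ => //.
  apply: spanned_mem; rewrite mem_cat; apply/orP; right; apply/allpairsP.
  by exists (g`_l, y`_i); split=> //; apply: mem_nth.
rewrite opprD addrA e -sumrB; apply: mp_sum => i _; rewrite -mulrBl mulrC.
apply: mp_mulS; last by case: (Hd i).
apply/Hy; exists (fun l => (l == i)%:R).
rewrite (bigD1 i) //= eqxx mul1r big1 ?addr0 // => l /negbTE ->.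
by rewrite mul0r.
Qed.

Variable p : nat.
Hypothesis mixed : mixed_characteristic S p.

Lemma mixed_neq0 : p%:R != 0 :> S.
Proof.
apply/eqP => p0; case: mixed => reg _; have := @oner_neq0 S; rewrite (reg 1 0) ?eqxx //.
by rewrite p0 !mul0r.
Qed.

Lemma mixed_in_max : p%:R \in m.
Proof.
apply: contraT => h; case: mixed => _; case=> x.
have [noeth _ _] := mloc.
by have [b e] := notin_max_unit noeth mloc h; exists (b * x); rewrite mulrA [_ * b]mulrC e mul1r.
Qed.

Lemma lift_params (xs : seq S) : all (fun x => x \in m) xs -> exists xs' : seq (max_elt m), [seq sval x | x <- xs'] = xs.
Proof.
elim: xs => [|x xs IH]; first by exists [::].
case/andP=> xm /IH[xs' <-]; by exists (exist _ x xm :: xs').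
Qed.

(** Modulo p and the parameters, S is a quotient of S / m^c, which is finite;
    so [coef_ring_gen] applies to representatives. *)
Theorem cohen_structure : exists (xs : seq (max_elt m)) (P : prime_idealr S) (g : seq S),
  [/\ chain m [seq sval x | x <- xs] P, p%:R \in P & forall s, spanned (coef_ring mixed_in_max xs) g s].
Proof.
have [noeth _ _] := mloc.
have pu : (p%:R : S) \isn't a GRing.unit.
  apply/negP => pu; have : 1 \in m by rewrite -(mulVr pu) idealMr // mixed_in_max.
  by rewrite idealr1.
have [ys [ym [c Hc] [P [IP ch]]]] := system_of_parameters noeth mloc (principal_ideal pu).
have [xs xsE] := lift_params ym; have [g Hg] := finite_mod_power c.
exists xs, P, g; split; first by rewrite xsE.
  by apply: IP; apply/asboolP; exists 1; rewrite mulr1.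
apply: (coef_ring_gen complete) => s.
have [r [[a [aZ e]] /Hc[i [t [/asboolP[u ->] e2]]]]] := Hg s.
exists a, t, u; split=> //; rewrite -e -(subrK r s) e2.
have -> : size xs = size ys by rewrite -xsE size_map.
by rewrite xsE; ring.
Qed.
End Cohen.

(** * The base ring inside S *)

(** The element z is an eigenvalue of the matrix c. *)
Lemma integral_of_matrix (A : comNzRingType) (E : fieldType) (j : {rmorphism A -> E}) n
    (c : 'I_n -> 'I_n -> A) (v : 'I_n -> E) (z : E) :
  (exists i, v i != 0) -> (forall i, z * v i = \sum_l j (c i l) * v l) -> integralOver j z.
Proof.
move=> [i vi] H; pose M := \matrix_(k, l) c l k.
exists (char_poly M); first exact: char_poly_monic.
rewrite map_char_poly -eigenvalue_root_char; apply/eigenvalueP.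
exists (\row_k v k); last first.
  by apply: contraNneq vi => /rowP/(_ i); rewrite !mxE => ->.
apply/rowP => k; rewrite !mxE H; apply: eq_bigr => l _.
by rewrite !mxE mulrC.
Qed.

(** The powers of b / a are combinations over A of those of exponent less than
    the degree of a monic relation: a power of a is a common denominator. *)
Lemma integral_pow (A : idomainType) (E : fieldType) (j : {rmorphism A -> E}) a b :
  injective j -> a != 0 -> integralOver j (j b / j a) ->
  exists k, forall n, exists h, a ^+ k * b ^+ n = a ^+ n * h.
Proof.
move=> jinj a0 [f fm fz]; exists (size f) => n.
have ja0 : j a != 0 by rewrite -(inj_eq jinj) rmorph0 in a0.
pose r := Pdiv.Ring.rmodp 'X^n f.
have rs : (size r <= size f)%N.
  by rewrite ltnW // Pdiv.Ring.ltn_rmodpN0 // monic_neq0.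
have e : (j b / j a) ^+ n = \sum_(i < size f) j r`_i * (j b / j a) ^+ i.
  have := congr1 (fun q => (map_poly j q).[j b / j a]) (Pdiv.RingMonic.rdivp_eq fm 'X^n).
  rewrite map_polyXn hornerXn rmorphD rmorphM hornerD hornerM (rootP fz) mulr0 add0r => ->.
  rewrite (horner_coef_wide _ (_ : (_ <= size f)%N)); last by rewrite (leq_trans (size_poly _ _)).
  by apply: eq_bigr => i _; rewrite coef_map.
exists (\sum_(i < size f) r`_i * b ^+ i * a ^+ (size f - i)); apply: jinj.
rewrite !rmorphM !rmorphXn rmorph_sum /=.
have -> : j b ^+ n = j a ^+ n * (j b / j a) ^+ n by rewrite -exprMn [j b / _]mulrC mulVKf.
rewrite e mulrCA; congr (_ * _); rewrite mulr_sumr; apply: eq_bigr => i _.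
rewrite !rmorphM !rmorphXn /= exprMn exprVn.
have ai : j a ^+ size f = j a ^+ (size f - i) * j a ^+ i by rewrite -exprD subnK // ltnW.
rewrite ai; have : j a ^+ i != 0 by rewrite expf_neq0.
move=> h; rewrite [j r`_i * _]mulrA mulrCA mulrA [X in X / _]mulrCA -[RHS]mulr1 -(mulfV h); ring.
Qed.

Lemma map_polyMXaddC (A B : nzRingType) (phi : {rmorphism A -> B}) (f : {poly A}) c :
  map_poly phi (f * 'X + c%:P) = map_poly phi f * 'X + (phi c)%:P.
Proof. by rewrite rmorphD rmorphM /= map_polyX map_polyC. Qed.

(** The constant coefficient of a relation of s, divided by X as long as it
    vanishes. *)
Lemma root_multiple (A S : idomainType) (phi : {rmorphism A -> S}) (f : {poly A}) s :
  f != 0 -> s != 0 -> root (map_poly phi f) s -> exists s' a, a != 0 /\ s * s' = phi a.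
Proof.
move=> f0 s0; elim/poly_ind: f f0 => [|f c IH]; first by rewrite eqxx.
rewrite map_polyMXaddC rootE hornerMXaddC => f0 /eqP e.
have [c0|c0] := eqVneq c 0.
  apply: IH; first by apply: contraNneq f0 => ->; rewrite c0 mul0r addr0.
  by move/eqP: e; rewrite c0 rmorph0 addr0 mulf_eq0 (negbTE s0) orbF.
exists (- (map_poly phi f).[s]), c; split=> //.
by apply/eqP; rewrite mulrN mulrC eq_sym -addr_eq0 addrC e.
Qed.

Section Base.
Variables (S : idomainType) (A : subringClosed S) (E : closedFieldType).
Variable jS : {rmorphism S -> E}.
Hypothesis jS_inj : injective jS.
Variable g : seq S.
Hypothesis gen : forall s, spanned A g s.

Local Notation AT := (subdom A).
Definition jA : {rmorphism AT -> E} := jS \o val.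

Lemma jA_inj : injective jA.
Proof. by move=> x y /jS_inj /val_inj. Qed.

Lemma integral_gen s : integralOver jA (jS s).
Proof.
have /choice[c Hc] : forall i, exists c : nat -> S, (forall l, c l \in A) /\ s * g`_i = \sum_(l < size g) c l * g`_l.
  by move=> i; have [c h] := gen (s * g`_i); exists c.
apply: (@integral_of_matrix _ _ _ (size g) (fun i l => insubd (0 : AT) (c i l)) (fun i => jS g`_i)).
  apply: contrapT => H; have [d [_ e]] := gen 1; case/eqP: (oner_neq0 S).
  rewrite e big1 // => i _; have -> : g`_i = 0; last by rewrite mulr0.
  apply: jS_inj; rewrite rmorph0; apply/eqP; apply: contraT => h.
  by exfalso; apply: H; exists i.
move=> i; rewrite -rmorphM; case: (Hc i) => cA ->.
rewrite rmorph_sum; apply: eq_bigr => l _; rewrite rmorphM; congr (_ * _).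
by rewrite /= insubdK ?cA.
Qed.

Lemma integral_trans z : integralOver jS z -> integralOver jA z.
Proof.
move=> [f fm fz]; apply/intIP; apply: (int_root_monic (f := map_poly jS f)) => //.
  exact: monic_map.
by apply/polyOverP => i; rewrite coef_map; apply/intIP/integral_gen.
Qed.

Lemma multiple_below s : s != 0 -> exists s' (a : AT), a != 0 /\ s * s' = val a.
Proof.
move=> s0; have [f fm fz] := integral_gen s.
apply: (@root_multiple _ _ _ f) => //; first exact: monic_neq0.
by move: fz; rewrite map_poly_comp rootE horner_map /= -(rmorph0 jS) (inj_eq jS_inj).
Qed.

Lemma fin_fractions (M : {pred E}) :
  (forall x, x \in M -> exists a b, b != 0 /\ x = jS a / jS b) -> finite_over jA M.
Proof.
move=> HM; exists [seq jS x | x <- g] => x /HM[a [b [b0 ->]]].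
have [b' [d [d0 e]]] := multiple_below b0.
have [c [cA e2]] := gen (a * b').
exists d, (fun i => insubd (0 : AT) (c i)); split=> //.
have jb0 : jS b != 0 by rewrite -(rmorph0 jS) (inj_eq jS_inj).
have -> : jA d * (jS a / jS b) = jS (a * b') by rewrite /= -e !rmorphM; field.
rewrite e2 rmorph_sum size_map; apply: eq_bigr => i _.
rewrite rmorphM (nth_map 0) //; congr (_ * _).
by rewrite /= insubdK ?cA.
Qed.

(** A multiple b z by the leading coefficient b of a relation is integral, and
    b divides a nonzero element of A. *)
Lemma algebraic_below z : (exists2 f : {poly S}, f != 0 & root (map_poly jS f) z) ->
  exists2 f : {poly AT}, f != 0 & root (map_poly jA f) z.
Proof.
move=> [f f0 fz]; have [_ h] := horner_tail_int (size f).-1 fz.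
have l0 : lead_coef f != 0 by rewrite lead_coef_eq0.
have [b' [a [a0 e]]] := multiple_below l0.
have [q qm qz] : integralOver jA (jA a * z).
  have -> : jA a * z = jS b' * (jS (lead_coef f) * z) by rewrite /= -e rmorphM; ring.
  apply: integral_mul; first exact: integral_gen.
  apply: integral_trans; apply/intIP; move: h.
  have -> : drop_poly (size f).-1 (map_poly jS f) = (jS (lead_coef f))%:P.
    apply/polyP => i; rewrite coef_drop_poly coef_map coefC; case: i => [|i] //=.
    by rewrite nth_default ?rmorph0 // addSn -addnS prednK ?leq_addl // size_poly_gt0.
  by rewrite hornerC.
exists (q \Po (a *: 'X)).
  rewrite comp_poly2_eq0; first exact: monic_neq0.
  by rewrite size_scale // size_polyX.
rewrite map_comp_poly root_comp; move: qz; congr (root _ _).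
by rewrite map_polyZ map_polyX hornerZ hornerX.
Qed.
End Base.

Section Params.
Variables (S : idomainType) (m : idealr S).
Hypothesis complete : adically_complete m.
Variable p : nat.
Hypotheses (pp : prime p) (p0 : p%:R != 0 :> S) (pm : p%:R \in m).
Variables (E : closedFieldType) (jS : {rmorphism S -> E}).
Hypothesis jS_inj : injective jS.
Hypothesis jS_alg : forall z, exists2 f : {poly S}, f != 0 & root (map_poly jS f) z.
Variables (xs : seq (max_elt m)) (P : prime_idealr S).
Hypotheses (ch : chain m [seq sval x | x <- xs] P) (pP : p%:R \in P).
Local Notation AT := (subdom (coef_ring pm xs)).
Local Notation j := (jA (coef_ring pm xs) jS).

(** The prime P of the chain meets A in pA, which makes p prime in A. *)
Lemma dvdby_prime (a : AT) : dvdby p a <-> val a \in P.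
Proof.
split; first by move=> [b ->]; rewrite rmorphM rmorph_nat mulrC idealMr.
move=> aP; have [b bC e] := coef_ring_prime complete pp ch pP (valP a) aP.
by exists (Subdom bC); apply: val_inj; rewrite rmorphM rmorph_nat.
Qed.

Let val_neq0 (a : AT) : a != 0 -> val a != 0.
Proof. by apply: contraNneq => e; apply/eqP/val_inj. Qed.

(** In the absence of variables A is the discrete valuation ring Z_p;
    otherwise the first variable has the required property by [step_frob]. *)
Lemma units_or_parameter :
  (forall a : AT, ~ dvdby p a -> exists b, a * b = 1) \/
  (exists2 x : AT, frob_indep p x & forall a : AT, exists b, (1 + x * a) * b = 1).
Proof.
have := dvdby_prime; move: ch; case: xs => [|x ys] ch' dvP.
  left=> a nd; have [||z zC e] := @base_unit _ _ complete p pp pm (val a) 1 (valP a).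
  - by rewrite -ch'; apply/negP => h; apply: nd; apply/dvP.
  - exact: rpred1.
  by exists (Subdom zC); apply: val_inj; rewrite rmorphM rmorph1.
case: ch' => xP [P' [PP' xP' ch']]; right.
have IH a : a \in coef_ring pm ys -> a \in P' -> exists2 b, b \in coef_ring pm ys & a = p%:R * b.
  by move=> aC aP'; apply: (coef_ring_prime complete pp ch' (PP' _ pP)).
have xC : sval x \in coef_ring pm (x :: ys) by apply: pseries_y.
exists (Subdom xC).
  move=> h c /dvP; rewrite rmorph_sum => hs i ih; apply/dvP.
  apply: (step_frob complete pP xP PP' xP' IH (q := (p ^ h)%N) (c := fun i => val (c i))) => //.
  - by rewrite expn_gt0 prime_gt0.
  - by move=> l; apply: valP.
  move: hs; congr (_ \in P); apply: eq_bigr => l _.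
  by rewrite rmorphM !rmorphXn.
move=> a; have [|z zC e] := step_unit complete (valP a) (f := 1); first exact: rpred1.
by exists (Subdom zC); apply: val_inj; rewrite rmorphM rmorphD !rmorph1 rmorphM.
Qed.

Variable g : seq S.
Hypothesis gen : forall s, spanned (coef_ring pm xs) g s.

Lemma base_ring_params : base_ring p j.
Proof.
split=> //.
- exact: jA_inj.
- by move=> z; apply: (algebraic_below jS_inj gen).
- by rewrite -(inj_eq val_inj) rmorph_nat.
- by move/dvdby_prime; rewrite rmorph1 idealr1.
- move=> a b /dvdby_prime; rewrite rmorphM prime_idealrM => /orP[|] h; [left|right]; exact/dvdby_prime.
- move=> a a0; have [k [b [bC e nb]]] := coef_ring_sep complete (valP a) (val_neq0 a0).
  exists k, (Subdom bC); split; first by apply: val_inj; rewrite rmorphM rmorphXn rmorph_nat.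
  by move=> [c ec]; apply: nb; exists (val c); [exact: valP|rewrite -[b]/(val (Subdom bC)) ec rmorphM rmorph_nat].
- move=> a b a0 hi; have [k Hk] := integral_pow (jA_inj jS_inj) a0 hi.
  have va0 := val_neq0 a0.
  have [||z zC e] := coef_ring_cint_closed complete pp p0 ch pP (valP b) (valP a) (valP (a ^+ k)) va0.
  + by rewrite rmorphXn expf_neq0.
  + by move=> n; have [h e] := Hk n; exists (val h); [exact: valP|rewrite -!rmorphXn -!rmorphM e].
  by exists (Subdom zC); apply: val_inj; rewrite rmorphM.
Qed.

End Params.

(** * The ring T *)

Section Quotients.
Local Open Scope quotient_scope.
Variables (T : comNzRingType) (P : idealr T).
Lemma quot_eq0 x : \pi_{ideal_quot P} x = 0 <-> x \in P.
Proof.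
rewrite -[x in x \in P]subr0 Quotient.idealrBE; split; first by rewrite rmorph0 => ->.
by move/eqP ->; rewrite rmorph0.
Qed.

Lemma pchar_quot p : prime p -> p%:R \in P -> p \in [pchar {ideal_quot P}].
Proof. by move=> pp /quot_eq0; rewrite rmorph_nat inE pp => ->; rewrite eqxx. Qed.
End Quotients.

Section Frobenius.
Local Open Scope quotient_scope.
(** Injectivity is that of Frobenius on a domain of characteristic p. *)
Lemma frobenius_bijective (T : comNzRingType) (P : prime_idealr T) p : prime p -> p%:R \in P ->
  (forall a, exists c, c ^+ p - a \in P) -> bijective (fun x : {ideal_quot P} => x ^+ p).
Proof.
move=> pp pP surj; have ch := pchar_quot pp pP.
have inj : injective (fun x : {ideal_quot P} => x ^+ p).
  move=> x y e; have : (x - y) ^+ p = 0.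
    by rewrite -(pFrobenius_autE ch) pFrobenius_autB_comm ?pFrobenius_autE ?e ?subrr //; apply: mulrC.
  rewrite -[x]reprK -[y]reprK -rmorphB -rmorphXn => /quot_eq0 h.
  apply/eqP; rewrite -Quotient.idealrBE.
  elim: {e}p h {pp pP surj ch} => [|n IH]; first by rewrite expr0 idealr1.
  by rewrite exprS prime_idealrM => /orP[].
have /choice[h hE] : forall y : {ideal_quot P}, exists x, x ^+ p = y.
  move=> y; have [c cP] := surj (repr y); exists (\pi c).
  by rewrite -rmorphXn -[RHS]reprK; apply/eqP; rewrite -Quotient.idealrBE.
by exists h => x; [apply: inj; rewrite hE|rewrite hE].
Qed.
End Frobenius.

(** This transfers relations of a / b between {fraction T} and E, the
    right-hand side being in T. *)
Lemma root_homogenize (T : idomainType) (K : fieldType) (phi : {rmorphism T -> K}) (f : {poly T}) a b z :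
  injective phi -> b != 0 -> z * phi b = phi a ->
  root (map_poly phi f) z = (\sum_(i < size f) f`_i * a ^+ i * b ^+ (size f - i) == 0).
Proof.
move=> inj b0 e; have pb : phi b != 0 by rewrite -(rmorph0 phi) (inj_eq inj).
rewrite -(inj_eq inj) rmorph0 rmorph_sum rootE (horner_coef_wide _ (size_poly _ _)).
rewrite -(inj_eq (mulIf (expf_neq0 (size f) pb))) mul0r mulr_suml; congr (_ == 0).
apply: eq_bigr => i _; rewrite coef_map !rmorphM !rmorphXn -e exprMn /=.
have -> : phi b ^+ size f = phi b ^+ (size f - i) * phi b ^+ i by rewrite -exprD subnK // ltnW.
ring.
Qed.

Section Final.
Variables (p : nat) (S : idomainType) (E : closedFieldType) (jS : {rmorphism S -> E}).
Hypothesis jS_inj : injective jS.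
Variable A : subringClosed S.
Local Notation j := (jA A jS).
Hypothesis B : base_ring p j.
Hypothesis int_S : forall s, integralOver j (jS s).
Variable L : divringClosed E.
Hypothesis SL : forall s, jS s \in L.

Local Notation T := (subdom (integers_of j L)).

Lemma mem_integers_of x : (x \in integers_of j L) = (x \in L) && (x \in intI j).
Proof. by []. Qed.

Lemma integers_of_normal : normal_domain T.
Proof.
move=> z [f fm fz]; have [a [b [b0 e]]] := fraction_rep z.
have tinj : injective (@FracField.tofrac T) by move=> x y /eqP; rewrite tofrac_eq => /eqP.
have vb : val b != 0 by apply: contraNneq b0 => h; apply/eqP/val_inj.
move: fz; rewrite (root_homogenize f tinj b0 e) => fz.
have e' : (val a / val b) * val b = val a by rewrite divfK.
have := root_homogenize f (val_inj : injective (val : T -> E)) b0 e'.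
rewrite fz => fu.
have uL : val a / val b \in integers_of j L.
  have := valP a; have := valP b; rewrite !mem_integers_of => /andP[bL _] /andP[aL _].
  rewrite rpredM ?rpredV //=.
  apply: (int_root_monic (f := map_poly val f)) => //; first exact: monic_map.
  apply/polyOverP => i; rewrite coef_map; have := valP f`_i.
  by rewrite mem_integers_of => /andP[].
exists (Subdom uL); apply: (mulIf (_ : FracField.tofrac b != 0)); first by rewrite tofrac_eq0.
rewrite e -rmorphM; congr (FracField.tofrac _); apply: val_inj.
by rewrite rmorphM /= divfK.
Qed.

Lemma in_integers_of s : jS s \in integers_of j L.
Proof. by rewrite mem_integers_of SL; apply/intIP. Qed.

Lemma integers_of_integral (t : T) : integralOver jS (val t).
Proof.
have := valP t; rewrite mem_integers_of => /andP[_ /intIP[f fm fz]].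
by exists (map_poly val f); [exact: monic_map|rewrite -map_poly_comp].
Qed.

Variables (M : divringClosed E) (pi : E).
Hypothesis jM : forall a, j a \in M.
Hypothesis finM : finite_over j M.
Hypotheses (piM : pi \in M) (piI : pi \in intI j) (p_pi : p%:R / pi \in intI j).
Hypothesis uM : forall P : place p j, unif P M pi.
Hypothesis Lad : admissible p j M pi L.
Hypothesis Lmax : forall L' : divringClosed E, admissible p j M pi L' -> {subset L <= L'} -> {subset L' <= L}.

Lemma pi_integers_of : pi \in integers_of j L.
Proof. by rewrite mem_integers_of piI andbT; case: Lad => h _ _; apply: h. Qed.
Definition piT : T := Subdom pi_integers_of.

Lemma piT_nunit : piT \isn't a GRing.unit.
Proof.
apply/negP => /mulrV/(congr1 val); rewrite rmorphM rmorph1 /= => h.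
have pi0 : pi != 0 by apply/eqP => p0; move: h; rewrite p0 mul0r => /esym/eqP; rewrite oner_eq0.
have : pi^-1 = val (piT^-1) by apply: (mulfI pi0); rewrite divff.
move=> e; case/negP: (pi_nonunit B piI uM).
by rewrite e; have := valP (piT^-1); rewrite mem_integers_of => /andP[].
Qed.

Lemma pi_neq0 : pi != 0.
Proof. by have [P _] := place_inh B; case: (uM P). Qed.

Local Notation J := (principal_ideal piT_nunit).

(** A quotient of elements of L lies in L. *)
Lemma piT_divides (t : T) : t \in J <-> val t / pi \in intI j.
Proof.
split.
  move=> /asboolP[y ->]; rewrite rmorphM /= mulrC mulKf ?pi_neq0 //.
  by have := valP y; rewrite mem_integers_of => /andP[].
move=> h; have tL : val t / pi \in integers_of j L.
  rewrite mem_integers_of h andbT; have := valP t; have := pi_integers_of; rewrite !mem_integers_of => /andP[h1 _] /andP[h2 _].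
  by rewrite rpredM ?rpredV.
apply/asboolP; exists (Subdom tL); apply: val_inj; rewrite rmorphM /=.
by rewrite mulrC divfK ?pi_neq0.
Qed.

Lemma p_in_J : p%:R \in J.
Proof. by apply/piT_divides; rewrite rmorph_nat. Qed.

Lemma integers_of_reduced : reduced {ideal_quot J}.
Proof.
move=> x n; rewrite -[x]reprK -rmorphXn => /quot_eq0/piT_divides; rewrite rmorphXn => h.
apply/quot_eq0/piT_divides; have := valP (repr x); rewrite mem_integers_of => /andP[xL xI].
exact: (reduced_mod_pi B piI p_pi uM Lad xL xI h).
Qed.

(** The kernel of the residue map of a place is contained in Q by
    [place_below], and [frobenius_surj] extracts p-th roots modulo this
    kernel. *)
Lemma integers_of_frobenius (Q : prime_idealr T) : {subset J <= Q} ->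
  bijective (fun x : {ideal_quot Q} => x ^+ p).
Proof.
move=> JQ; have pQ : piT \in Q by apply: JQ; apply/asboolP; exists 1; rewrite mulr1.
have [P PQ] := place_below B piM p_pi uM Lad (erefl : val piT = pi) pQ.
apply: frobenius_bijective; first exact: br_prime B.
  exact: JQ p_in_J.
move=> a; have := valP a; rewrite mem_integers_of => /andP[aL aI].
have [c [cL cI e]] := frobenius_surj B jM finM piM Lad Lmax P aL aI.
have cLI : c \in integers_of j L by rewrite mem_integers_of cL.
exists (Subdom cLI); apply: PQ; by rewrite rmorphB rmorphXn.
Qed.
End Final.

Lemma clear_denominators (S : idomainType) (q : {poly {fraction S}}) :
  exists d (f : {poly S}), d != 0 /\ FracField.tofrac d *: q = map_poly (@FracField.tofrac S) f.
Proof.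
elim/poly_ind: q => [|q c [d [f [d0 e]]]].
  by exists 1, 0; rewrite oner_neq0 scaler0 rmorph0.
have [n [d' [d'0 e']]] := fraction_rep c.
exists (d * d'), ((d' *: f) * 'X + (d * n)%:P); rewrite mulf_neq0 //; split=> //.
rewrite map_polyMXaddC map_polyZ -e /= !tofracM -e'.
by rewrite -!mul_polyC !polyCM; ring.
Qed.

Theorem theoremA (p : nat) (p_prime : prime p)
    (S : idomainType) (m : idealr S)
    (S_local : local_ring m)
    (S_complete : adically_complete m)
    (S_mixed : mixed_characteristic S p)
    (S_residue : finite_set [set: {ideal_quot m}]%classic)
    (E : closedFieldType) (iota : {rmorphism {fraction S} -> E})
    (E_closure : algebraic_closure iota) :
  exists (T : idomainType) (f : {rmorphism S -> T}) (g : {rmorphism T -> E})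
         (pi : T) (pi_nunit : pi \isn't a GRing.unit),
    pi != 0 /\
    [/\ [/\ normal_domain T,
            injective g,
            forall s : S, g (f s) = iota (tofrac s) &
            (range g `<=` absolute_integral_closure iota)%classic],
        p \in [pchar {ideal_quot (principal_ideal pi_nunit)}] /\
        reduced {ideal_quot (principal_ideal pi_nunit)} &
        forall P : prime_idealr T,
          minimal_over (principal_ideal pi_nunit) P ->
          bijective (fun x : {ideal_quot P} => x ^+ p)].
Proof.
pose jS : {rmorphism S -> E} := iota \o @tofrac S.
have jS_inj : injective jS by move=> x y /fmorph_inj/eqP; rewrite tofrac_eq => /eqP.
have jS_alg z : exists2 f : {poly S}, f != 0 & root (map_poly jS f) z.
  have [q q0 qz] := E_closure z; have [d [f [d0 e]]] := clear_denominators q.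
  have td0 : tofrac d != 0 by rewrite tofrac_eq0.
  exists f; first by apply: contraNneq q0 => f0; move/eqP: e; rewrite f0 rmorph0 scaler_eq0 (negbTE td0).
  by rewrite map_poly_comp -e map_polyZ rootE hornerZ mulf_eq0 (eqP qz) eqxx orbT.
have [xs [P [g [ch pP gen]]]] := cohen_structure S_local S_complete S_residue S_mixed.
have p0 := mixed_neq0 S_mixed.
pose A := coef_ring (mixed_in_max S_local S_mixed) xs; pose j := jA A jS.
have B : base_ring p j := base_ring_params S_complete p_prime p0 jS_inj jS_alg ch pP gen.
pose F : {pred E} := fun x => `[< exists z, x = iota z >].
have Fc : divring_closed F.
  split; first by apply/asboolP; exists 1; rewrite rmorph1.
    by move=> _ _ /asboolP[z ->] /asboolP[w ->]; apply/asboolP; exists (z - w); rewrite rmorphB.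
  by move=> _ _ /asboolP[z ->] /asboolP[w ->]; apply/asboolP; exists (z / w); rewrite fmorph_div.
pose M : divringClosed E := HB.pack F (GRing.isDivringClosed.Build E F Fc).
have SM s : jS s \in M by apply/asboolP; exists (tofrac s).
have finM : finite_over j M.
  apply: (fin_fractions jS_inj gen) => x /asboolP[z ->].
  have [n [d [d0 e]]] := fraction_rep z; exists n, d; split=> //.
  have jd : jS d != 0 by rewrite -(rmorph0 jS) (inj_eq jS_inj).
  by apply: (mulIf jd); rewrite divfK // -rmorphM e.
have [M0 [pi [MM0 finM0 [piM piI] p_pi uM]]] :=
  uniform_extension B (fun a => SM (val a)) finM (units_or_parameter S_complete p_prime _ ch pP).
have jM0 a : j a \in M0 by apply/MM0/SM.
have [L Lad Lmax] := maximal_admissible B jM0 uM.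
have SL s : jS s \in L by case: Lad => h _ _; apply/h/MM0/SM.
have int_S := integral_gen jS_inj gen.
exists (subdom (integers_of j L)), (corestrict (in_integers_of int_S SL)), val, (piT piM piI Lad), (piT_nunit B piM piI uM Lad).
split; first by rewrite -(inj_eq val_inj) (pi_neq0 B uM).
split.
- split; [exact: integers_of_normal|exact: val_inj|by []|].
  by move=> _ [t _ <-]; apply: integers_of_integral.
- split; last exact: integers_of_reduced.
  by apply: pchar_quot => //; apply: p_in_J.
by move=> Q [JQ _]; exact: (integers_of_frobenius jM0 finM0 p_pi Lmax JQ).
Qed.
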